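(* Let $\{\mu_\theta\}_{\theta\in\Theta}$ be a family of Borel probability measures on $\mathbb{R}^d$ and let $\mu_{\mathrm{mix}}$ be its mixture with respect to a mixing probability measure $m$ on $\Theta$. Suppose that the measures $\mu_\theta$ satisfy the $\overline{\mathbf{T}}_2^-$ inequality with uniformly bounded constants: $$C_\Theta:=\sup_{\theta\in\Theta}C_{\overline{\mathbf{T}}_2^-}(\mu_\theta)<\infty .$$ Suppose moreover that $$M_\Theta:=\sup_{\theta,\theta'\in\Theta}\chi^2(\mu_\theta\Vert\mu_{\theta'})<\infty .$$ Then $\mu_{\mathrm{mix}}$ satisfies the $\overline{\mathbf{T}}_2^-$ inequality and $$C_{\overline{\mathbf{T}}_2^-}(\mu_{\mathrm{mix}})\le\sup_{\theta\in\Theta}C_{\overline{\mathbf{T}}_2^-}(\mu_\theta)\cdot\Bigl(8+\tfrac14(2+M_\Theta)\log(1+M_\Theta)\Bigr).$$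
   Context: Mixture: $(\Theta,\mathfrak{M},m)$ is a probability space, for every Borel set $A\subset\mathbb{R}^d$ the map $\theta\mapsto\mu_\theta(A)$ is measurable, and $\mu_{\mathrm{mix}}(A):=\int_\Theta \mu_\theta(A)\,dm(\theta)$ for Borel $A\subset\mathbb{R}^d$. $|\cdot|$ is the Euclidean norm; $\mathcal{P}_1(\mathbb{R}^d)$ is the set of Borel probability measures with finite first moment. For probability measures $\mu_1,\mu_2$: $\chi^2(\mu_1\Vert\mu_2):=\int\bigl(\frac{d\mu_1}{d\mu_2}-1\bigr)^2d\mu_2$ and $H(\mu_1|\mu_2):=\int\log\bigl(\frac{d\mu_1}{d\mu_2}\bigr)d\mu_1$ if $\mu_1\ll\mu_2$; both are $+\infty$ otherwise. Weak quadratic transport cost: for $\mu_2\in\mathcal{P}_1(\mathbb{R}^d)$, $$\overline{\mathcal{T}}_2(\mu_2|\mu_1):=\inf_\pi\int_{\mathbb{R}^d}\tfrac12\Bigl|x-\int_{\mathbb{R}^d}y\,p_x(dy)\Bigr|^2\mu_1(dx),$$ where the infimum is over all couplings $\pi$ of $\mu_1$ and $\mu_2$, and $p_x$ is defined ($\mu_1$-a.s.) by $\pi(dx\,dy)=p_x(dy)\mu_1(dx)$. A probability measure $\mu$ (with finite first moment) satisfies $\overline{\mathbf{T}}_2^-$ with constant $C\in(0,\infty)$ if $\overline{\mathcal{T}}_2(\mu|\nu)\le C\,H(\nu|\mu)$ for all $\nu\in\mathcal{P}_1(\mathbb{R}^d)$. $C_{\overline{\mathbf{T}}_2^-}(\mu)$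 is the best such constant (infimum; $+\infty$ if there is none). *)

(* Defs.v *)
From HB Require Import structures.
From mathcomp Require Import all_boot all_order all_algebra.
From mathcomp Require Import all_classical all_reals all_analysis.
From mathcomp Require Import measurable_realfun.

Set Implicit Arguments.
Unset Strict Implicit.
Unset Printing Implicit Defensive.

Import Order.TTheory GRing.Theory Num.Theory.
Import numFieldNormedType.Exports.

Local Open Scope classical_set_scope.
Local Open Scope ring_scope.
Local Open Scope ereal_scope.
Local Open Scope charge_scope.

(* R^d with its Borel sigma-algebra, i.e. the one generated by the open sets
   of the usual topology on row vectors. *)
Definition Rd (R : realType) (d : nat) :=
  g_sigma_algebraType (@open 'rV[R]_d).

(* The library norm `|x| on 'rV[R]_d is the sup norm. *)
Definition enorm (R : realType) (d : nat) (x : 'rV[R]_d) : R :=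
  Num.sqrt (\sum_(i < d) x ord0 i ^+ 2)%R.

Section weak_transport.
Context {R : realType} {d : nat}.
Implicit Types mu nu : probability (Rd R d) R.

Definition P1 mu := \int[mu]_x (enorm x)%:E < +oo.

Definition chi2 mu1 mu2 : \bar R :=
  if `[< mu1 `<< mu2 >]
  then \int[mu2]_x
         (('d (charge_of_finite_measure mu1) '/d mu2) x - 1) ^+ 2
  else +oo.

(* lne maps nonpositive numbers to -oo; the density is positive
   mu1-almost everywhere. *)
Definition relative_entropy mu1 mu2 : \bar R :=
  if `[< mu1 `<< mu2 >]
  then \int[mu1]_x lne (('d (charge_of_finite_measure mu1) '/d mu2) x)
  else +oo.

Definition coupling mu1 mu2 (pi : probability (Rd R d * Rd R d)%type R) :=
  (forall A, measurable A -> pi (fst @^-1` A) = mu1 A) /\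
  (forall A, measurable A -> pi (snd @^-1` A) = mu2 A).

(* pi(dx dy) = p_x(dy) mu1(dx) *)
Definition disintegration mu1 (pi : probability (Rd R d * Rd R d)%type R)
    (p : R.-pker (Rd R d) ~> (Rd R d)) :=
  forall E, measurable E -> pi E = \int[mu1]_x p x (xsection E x).

(* The coordinatewise integral of the identity. A coordinate that is not
   integrable gives a junk value; for a disintegration of a coupling of mu1
   with an element of P1 this happens only on a mu1-null set of points x. *)
Definition barycenter (m : {measure set (Rd R d) -> \bar R}) : 'rV[R]_d :=
  (\row_(i < d) \int[m]_y (y : 'rV[R]_d) ord0 i)%R.

Definition bary_cost mu1 (p : R.-pker (Rd R d) ~> (Rd R d)) : \bar R :=
  \int[mu1]_x (2^-1 * enorm ((x : 'rV[R]_d) - barycenter (p x)) ^+ 2)%:E.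

(* T2bar mu2 mu1 is the cost written T_2(mu2 | mu1): the disintegration is
   with respect to the second argument mu1. A disintegration of pi exists and
   is unique up to a mu1-null set, so that taking the infimum over the pairs
   (pi, p) is taking it over pi. *)
Definition T2bar mu2 mu1 : \bar R :=
  ereal_inf [set c | exists pi p,
    [/\ coupling mu1 mu2 pi, disintegration mu1 pi p & c = bary_cost mu1 p]].

Definition T2minus_with mu (C : R) :=
  [/\ (0 < C)%R, P1 mu &
      forall nu, P1 nu -> T2bar mu nu <= C%:E * relative_entropy nu mu].

Definition T2minus mu := exists C : R, T2minus_with mu C.

Definition C_T2minus mu : \bar R :=
  ereal_inf [set C%:E | C in T2minus_with mu].

End weak_transport.

Section mixture.
Context {disp disp' : measure_display} {Theta : measurableType disp}
  {T : measurableType disp'} {R : realType}.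
Variables (m : probability Theta R) (mu : Theta -> probability T R).
Hypothesis mmu : forall A, measurable A ->
  measurable_fun [set: Theta] (fun theta => mu theta A).

(* The value does not depend on the measurability proof; it is an argument so
   that the probability structure below applies to mixture m mmu. *)
Definition mixture of (forall A, measurable A ->
    measurable_fun [set: Theta] (fun theta => mu theta A)) :=
  fun A : set T => \int[m]_theta mu theta A.

Let mixture0 : mixture mmu set0 = 0.
Proof.
by rewrite /mixture; under eq_integral do rewrite measure0; rewrite integral0.
Qed.

Let mixture_ge0 A : 0 <= mixture mmu A.
Proof. exact: integral_ge0. Qed.

Let mixture_sigma_additive : semi_sigma_additive (mixture mmu).
Proof.
move=> F mF tF mUF; rewrite [X in _ --> X](_ : _ =
    \sum_(0 <= n <oo) mixture mmu (F n)).
  by apply: is_cvg_nneseries => n _ _; exact: mixture_ge0.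
rewrite /mixture -integral_nneseries//; last by move=> n; exact: mmu.
apply: eq_integral => theta _.
exact/esym/cvg_lim/measure_semi_sigma_additive.
Qed.

HB.instance Definition _ := isMeasure.Build _ _ _ (mixture mmu)
  mixture0 mixture_ge0 mixture_sigma_additive.

Let mixture_setT : mixture mmu [set: T] = 1.
Proof.
rewrite /mixture (eq_integral (cst 1)).
  by rewrite integral_cst// mul1e; exact: probability_setT.
by move=> theta _; exact: probability_setT.
Qed.

HB.instance Definition _ := Measure_isProbability.Build _ _ _ (mixture mmu)
  mixture_setT.

End mixture.

(* Main.v *)
Require Import Defs.
From HB Require Import structures.
From mathcomp Require Import all_boot all_order all_algebra.
From mathcomp Require Import all_classical all_reals all_analysis.
From mathcomp Require Import measurable_realfun.
From mathcomp Require Import ring lra.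

Set Implicit Arguments.
Unset Strict Implicit.
Unset Printing Implicit Defensive.

Import Order.TTheory GRing.Theory Num.Theory.
Import numFieldNormedType.Exports.

Local Open Scope classical_set_scope.
Local Open Scope ring_scope.
Local Open Scope ereal_scope.
Local Open Scope charge_scope.

(* Let nu = h mu_mix / Z with h bounded. It is the mixture, with weights
   z_theta = Z_theta / Z, of the tilts h mu_theta / Z_theta of the components.
   Transporting each tilt to mu_theta carries nu to the mixture mu' of the
   mu_theta with weights z_theta, at a cost of at most C times the mean entropy of
   the tilts. From mu' one reaches mu_mix as in Marton's argument: mu_theta gives up
   the fraction (1 - 1 / z_theta)_+ of its mass to the components in deficit. Any
   two components are at cost at most C log (1 + M), and
   z (1 - 1 / z)_+ ^ 2 <= 4 (z log z - z + 1), so that this second step costs at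
   most 4 C log (1 + M) times the entropy of the weights. The chain rule for the
   entropy and the triangle inequality give the constant C (2 + 4 log (1 + M)).

   A measurable choice of transport kernels in theta is avoided by doing this for
   finite mixtures only. The chi-square bound and Maurey's empirical method
   approximate the density of mu_mix, in L^2 of one component, by that of an average
   of finitely many components; the cost is stable under this approximation because
   T_2^- implies exponential, hence fourth, moments. General nu are reached by
   clipping the density. *)

(** The weak cost sees only barycenters, so moving a fraction p of the mass costs p ^ 2 times the
    full cost, where the ordinary quadratic cost would charge p. This is what makes Marton's step
    linear in the entropy: the total variation between the weights is only controlled by the square
    root of their entropy.

    The constant comes from balancing the two steps. With H the entropy of nu and B that of the
    weights, the chain rule leaves C (H - B) for the first step, against 4 C log (1 + M) B for the
    second. The triangle inequality multiplies them by 1 + s and 1 + 1 / s. For s = 1 + 4 log (1 +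
    M) the terms in B have a nonpositive sum, and (1 + s) C H remains. The constant of the theorem
    is larger than this one by an elementary inequality in M.

    The functions h are bounded above and away from zero because one h must tilt every component
    with finite entropy, and because entropies and normalizing constants must be stable when the
    mixture is replaced by an empirical mean. *)

(** * Probabilities and Markov kernels given by their values on measurable sets *)

Section probability_of_measure.
Context {disp : measure_display} {T : measurableType disp} {R : realType}.

Definition prob_of (m : {measure set T -> \bar R}) of m setT = 1 : set T -> \bar R := m.

Variables (m : {measure set T -> \bar R}) (m1 : m setT = 1).

HB.instance Definition _ := Measure.copy (prob_of m1) m.

HB.instance Definition _ := Measure_isProbability.Build _ _ _ (prob_of m1) m1.

(** Later constructions know a measure only through a formula for its values; this turns the formula
    into an element of [probability]. *)
Lemma exists_probability (F : set T -> \bar R) :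
  (forall A, measurable A -> F A = m A) ->
  exists P : probability T R, forall A, measurable A -> P A = F A.
Proof. by move=> Fm; exists (prob_of m1 : probability T R) => A /Fm ->. Qed.

End probability_of_measure.

Section kernel_of_family.
Context {d d' : measure_display} {X : measurableType d}
  {Y : measurableType d'} {R : realType}.

Definition kernel_of (f : X -> probability Y R)
    of (forall A, measurable A -> measurable_fun setT (f ^~ A)) :
  X -> {measure set Y -> \bar R} := f.

Variables (f : X -> probability Y R)
  (mf : forall A, measurable A -> measurable_fun setT (f ^~ A)).

HB.instance Definition _ := isKernel.Build _ _ _ _ _ (kernel_of mf) mf.

Let kernel_ofT x : kernel_of mf x setT = 1.
Proof. exact: probability_setT. Qed.

HB.instance Definition _ :=
  Kernel_isProbability.Build _ _ _ _ _ (kernel_of mf) kernel_ofT.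

End kernel_of_family.

(** The probabilities are chosen pointwise; measurability in [x] survives because it only concerns
    values on measurable sets, which [F] prescribes. *)
Lemma exists_pkernel {d d' : measure_display} {X : measurableType d}
    {Y : measurableType d'} {R : realType} (F : X -> set Y -> \bar R) :
  (forall x, exists P : probability Y R, forall A, measurable A -> P A = F x A) ->
  (forall A, measurable A -> measurable_fun setT (F ^~ A)) ->
  exists p : R.-pker X ~> Y, forall x A, measurable A -> p x A = F x A.
Proof.
move=> /choice[f fF] mF.
have mf A : measurable A -> measurable_fun setT (f ^~ A).
  move=> mA; rewrite (_ : (fun x => f x A) = F ^~ A); first exact: mF.
  by apply/funext => x; exact: fF.
by exists (kernel_of mf : R.-pker X ~> Y) => x A mA; exact: fF.
Qed.

Section kernel_snd.
Context {d d' d'' : measure_display} {W : measurableType d''}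
  {X : measurableType d} {Y : measurableType d'} {R : realType}.
Variable p : R.-pker X ~> Y.

(** Kernel composition takes its second kernel on the product with the first source space; ignoring
    that coordinate makes it apply to a plain kernel. *)
Definition ksnd (wx : W * X) : {measure set Y -> \bar R} := p wx.2.

Let measurable_ksnd A : measurable A -> measurable_fun setT (ksnd ^~ A).
Proof. by move=> mA; exact: measurableT_comp (measurable_kernel p A mA) _. Qed.

HB.instance Definition _ := isKernel.Build _ _ _ _ _ ksnd measurable_ksnd.

Let ksndT x : ksnd x setT = 1.
Proof. exact: prob_kernel. Qed.

HB.instance Definition _ := Kernel_isProbability.Build _ _ _ _ _ ksnd ksndT.

End kernel_snd.

(** With [a] seen as a kernel from [unit], [b] agrees with a composition of kernels, whose integral
    is the iterated one. *)
Lemma integral_bind {d d' : measure_display} {X : measurableType d}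
    {Y : measurableType d'} {R : realType} (a : probability X R)
    (p : R.-pker X ~> Y) (b : {measure set Y -> \bar R}) :
  (forall A, measurable A -> \int[a]_x p x A = b A) ->
  forall f : Y -> \bar R, (forall y, 0 <= f y) -> measurable_fun setT f ->
  \int[b]_y f y = \int[a]_x \int[p x]_y f y.
Proof.
move=> apb f f0 mf.
pose P := kprobability (measurable_cst (a : pprobability X R) : measurable_fun [set: unit] _).
rewrite -(@integral_kcomp _ _ _ unit X Y R P (ksnd p) tt f f0 mf).
by apply: eq_measure_integral => A mA _; rewrite -apb.
Qed.

Section kernel_integrals.
Context {d d' : measure_display} {X : measurableType d}
  {Y : measurableType d'} {R : realType}.

Lemma measurable_integral_pkernel (p : R.-pker X ~> Y) (f : Y -> \bar R) :
  measurable_fun setT f -> measurable_fun setT (fun x => \int[p x]_y f y).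
Proof.
move=> mf.
rewrite [X in measurable_fun _ X](_ : _ =
  (fun x => \int[p x]_y f^\+ y - \int[p x]_y f^\- y)); last first.
  by apply/funext => x; rewrite integralE.
have mp U : measurable U -> measurable_fun setT (p ^~ U).
  by move=> mU; exact: measurable_kernel.
apply: emeasurable_funB; apply: measurable_fun_integral_kernel => //.
  exact: measurable_funepos.
exact: measurable_funeneg.
Qed.

Lemma measurable_Rintegral_pkernel (p : R.-pker X ~> Y) (f : Y -> R) :
  measurable_fun setT f -> measurable_fun setT (fun x => Rintegral (p x) setT f).
Proof.
move=> mf; apply: measurableT_comp => //; apply: measurable_integral_pkernel.
exact/measurable_EFinP.
Qed.

End kernel_integrals.

(** * Densities, and Jensen's inequality for the square *)

Section density.
Context {disp : measure_display} {T : measurableType disp} {R : realType}.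
Implicit Types (rho a : probability T R) (h : T -> R) (f : T -> \bar R).

(** A real-valued, everywhere nonnegative version of the Radon-Nikodym derivative, which keeps
    pointwise algebra free of null sets and infinite values. *)
Definition density rho a h := [/\ measurable_fun setT h,
  forall x, (0 <= h x)%R &
  forall A, measurable A -> a A = \int[rho]_(x in A) (h x)%:E].

Lemma density_dominates rho a h : density rho a h -> a `<< rho.
Proof.
move=> [mh h0 ah]; apply/null_content_dominatesP => A mA A0.
rewrite ah// null_set_integral//.
by apply/measurable_EFinP; exact: measurable_funTS.
Qed.

Lemma density_integrable rho a h :
  density rho a h -> rho.-integrable setT (EFin \o h).
Proof.
move=> [mh h0 ah]; apply/integrableP; split; first exact/measurable_EFinP.
under eq_integral do rewrite /= ger0_norm//.
by rewrite -ah// probability_setT ltry.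
Qed.

Lemma density_RN rho a h : density rho a h ->
  ae_eq rho setT (EFin \o h) ('d (charge_of_finite_measure a) '/d rho).
Proof.
move=> hd; have ar := density_dominates hd; have ih := density_integrable hd.
case: hd => mh h0 ah.
apply: integral_ae_eq => //.
by move=> A _ mA; rewrite -Radon_Nikodym_integral//= -ah.
Qed.

Lemma density_integral rho a h : density rho a h ->
  forall f, (forall x, 0 <= f x) -> measurable_fun setT f ->
  \int[a]_x f x = \int[rho]_x (f x * (h x)%:E).
Proof.
move=> hd f f0 mf; have ar := density_dominates hd.
have ae1 := density_RN hd; case: hd => mh h0 ah.
have ae2 := ae_eq_Radon_Nikodym_SigmaFinite ar measurableT.
rewrite -(Radon_Nikodym_SigmaFinite.change_of_variables ar)//.
have mRN : measurable_fun setT (Radon_Nikodym_SigmaFinite.f a rho).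
  exact: measurable_int (Radon_Nikodym_SigmaFinite.f_integrable ar).
apply: ge0_ae_eq_integral => //.
- exact: emeasurable_funM.
- by apply: emeasurable_funM => //; exact/measurable_EFinP.
- by move=> x _; rewrite mule_ge0// Radon_Nikodym_SigmaFinite.f_ge0.
- by move=> x _; rewrite mule_ge0// lee_fin.
apply: ae_eqe_mul2l; apply: ae_eq_trans ae2 _; exact: ae_eq_sym.
Qed.

Lemma dominates_density rho a : a `<< rho -> exists h, density rho a h.
Proof.
move=> ar; pose g := Radon_Nikodym_SigmaFinite.f a rho.
have gfin : EFin \o (fine \o g) = g.
  by apply/funext => x /=; rewrite fineK// Radon_Nikodym_SigmaFinite.f_fin_num.
have ig := Radon_Nikodym_SigmaFinite.f_integrable ar.
exists (fine \o g); split.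
- by apply/measurable_EFinP; rewrite gfin; exact: measurable_int ig.
- by move=> x; rewrite fine_ge0// Radon_Nikodym_SigmaFinite.f_ge0.
- move=> A mA; rewrite (Radon_Nikodym_SigmaFinite.f_integral ar)//.
  by apply: eq_integral => x _; rewrite -[in LHS]/g -[in LHS]gfin.
Qed.

End density.

Section measure_of_density.
Context {disp : measure_display} {T : measurableType disp} {R : realType}.
Variables (rho : {measure set T -> \bar R}) (h : T -> R).

Definition dens_measure of measurable_fun setT h & (forall x, (0 <= h x)%R) :=
  fun A => \int[rho]_(x in A) (h x)%:E.

Variables (mh : measurable_fun setT h) (h0 : forall x, (0 <= h x)%R).

Let dens_measure0 : dens_measure mh h0 set0 = 0.
Proof. by rewrite /dens_measure integral_set0. Qed.

Let dens_measure_ge0 A : 0 <= dens_measure mh h0 A.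
Proof. by apply: integral_ge0 => x _; rewrite lee_fin. Qed.

Let dens_measure_sigma_additive : semi_sigma_additive (dens_measure mh h0).
Proof. by apply: semi_sigma_additive_nng_induced => //; exact/measurable_EFinP. Qed.

HB.instance Definition _ := isMeasure.Build _ _ _ (dens_measure mh h0)
  dens_measure0 dens_measure_ge0 dens_measure_sigma_additive.

End measure_of_density.

Lemma exists_density {disp : measure_display} {T : measurableType disp}
    {R : realType} (rho : probability T R) (h : T -> R) :
  measurable_fun setT h -> (forall x, (0 <= h x)%R) ->
  \int[rho]_x (h x)%:E = 1 -> exists a : probability T R, density rho a h.
Proof.
move=> mh h0 h1.
have [a ha] := exists_probability (m := dens_measure rho mh h0) h1 (fun _ _ => erefl).
by exists a; split.
Qed.

Lemma sqr_integrable {disp : measure_display} {T : measurableType disp}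
    {R : realType} (m : {measure set T -> \bar R}) (f : T -> R) :
  m setT = 1 -> measurable_fun setT f ->
  \int[m]_x ((f x) ^+ 2)%:E < +oo -> m.-integrable setT (EFin \o f).
Proof.
move=> m1 mf foo.
have if2 : m.-integrable setT (fun x => (f x ^+ 2)%:E).
  apply/integrableP; split; first by apply/measurable_EFinP; exact: measurable_funX.
  by under eq_integral do rewrite gee0_abs ?lee_fin ?sqr_ge0//.
apply: (@le_integrable _ _ _ _ _ _ _ (fun x => (1 + f x ^+ 2)%:E)) => //.
- exact/measurable_EFinP.
- move=> x _ /=; rewrite lee_fin [leRHS]ger0_norm ?addr_ge0 ?sqr_ge0//.
  rewrite ler_norml; have := sqr_ge0 (f x - 1); have := sqr_ge0 (f x + 1).
  by move=> ? ?; apply/andP; split; nra.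
- under eq_fun do rewrite EFinD; apply: integrableD => //.
  apply/integrableP; split; first exact/measurable_EFinP.
  by rewrite /= integral_cst// m1 mule1 /= ltry.
Qed.

(** Integrate the tangent of the square at the mean, 2 e f - e^2 <= f^2. If the right side is
    infinite there is nothing to prove; otherwise [f] is integrable and [Rintegral] is its true
    mean. *)
Lemma sqr_Rintegral_le {disp : measure_display} {T : measurableType disp}
    {R : realType} (m : {measure set T -> \bar R}) (f : T -> R) :
  m setT = 1 -> measurable_fun setT f ->
  ((Rintegral m setT f) ^+ 2)%:E <= \int[m]_x ((f x) ^+ 2)%:E.
Proof.
move=> m1 mf; have [foo|] := ltP (\int[m]_x ((f x) ^+ 2)%:E) +oo; last first.
  by rewrite leye_eq => /eqP ->; rewrite leey.
have mf2 : measurable_fun setT (fun x => (f x ^+ 2)%:E).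
  by apply/measurable_EFinP; exact: measurable_funX.
have if2 : m.-integrable setT (fun x => (f x ^+ 2)%:E).
  apply/integrableP; split => //.
  by under eq_integral do rewrite gee0_abs ?lee_fin ?sqr_ge0//.
have i1 c : m.-integrable setT (EFin \o cst c).
  apply/integrableP; split; first exact/measurable_EFinP.
  by rewrite /comp /cst /= integral_cst// m1 mule1 ltry.
have i_f := sqr_integrable m1 mf foo.
set e := Rintegral _ _ _.
have eE : \int[m]_x (f x)%:E = e%:E.
  by rewrite /e /Rintegral fineK//; exact: integrable_fin_num i_f.
have -> : (e ^+ 2)%:E = \int[m]_x ((2 * e) * f x - e ^+ 2)%:E.
  have iz : m.-integrable setT (fun x => ((2 * e) * f x)%:E).
    by under eq_fun do rewrite EFinM; exact: integrableZl.
  rewrite integralB_EFin//; last exact: i1.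
  under eq_integral do rewrite EFinM.
  rewrite integralZl// eE integral_cst// m1 mule1 -EFinM -EFinB; congr EFin.
  ring.
apply: le_integral => //.
- under eq_fun do rewrite EFinB EFinM.
  apply: integrableB => //; [exact: integrableZl|exact: i1].
- by move=> x _; rewrite lee_fin; have := sqr_ge0 (f x - e); nra.
Qed.

(** * Finite mixtures of measures *)

Section finite_mixture.
Context {disp : measure_display} {T : measurableType disp} {R : realType}.
Implicit Types (m : {measure set T -> \bar R}) (n : nat) (w : nat -> R).

(** A predicate rather than a constructed measure, since one measure gets decomposed in several
    ways: Marton's step writes [mu] both with the weights [c] and with the tilted weights [cz]. *)
Definition mixes n w (m_ : nat -> {measure set T -> \bar R}) m := forall A, measurable A ->
  m A = \sum_(k < n) (w k)%:E * m_ k A.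

Let scaled w (w0 : forall k, (0 <= w k)%R) (m_ : nat -> {measure set T -> \bar R}) k : {measure set T -> \bar R} :=
  mscale (NngNum (w0 k)) (m_ k).

Lemma mixes_integral n w (m_ : nat -> {measure set T -> \bar R}) m : (forall k, (0 <= w k)%R) -> mixes n w m_ m ->
  forall f : T -> \bar R, (forall x, 0 <= f x) -> measurable_fun setT f ->
  \int[m]_x f x = \sum_(k < n) (w k)%:E * \int[m_ k]_x f x.
Proof.
move=> w0 mw f f0 mf.
rewrite (eq_measure_integral (msum (scaled w0 m_) n)).
  rewrite ge0_integral_measure_sum//; apply: eq_bigr => k _.
  by rewrite ge0_integral_mscale.
by move=> A mA _; rewrite mw.
Qed.

Lemma exists_mixture n w (m_ : nat -> {measure set T -> \bar R}) : (forall k, (0 <= w k)%R) ->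
  (forall k, m_ k setT = 1) -> (\sum_(k < n) w k = 1)%R ->
  exists m : probability T R, mixes n w m_ m.
Proof.
move=> w0 m1 w1.
have h : msum (scaled w0 m_) n setT = 1.
  rewrite /= /msum /= /mscale /=; under eq_bigr do rewrite m1 mule1.
  by rewrite sumEFin w1.
by have [P hP] := exists_probability h (fun _ _ => erefl); exists P.
Qed.

End finite_mixture.

Lemma mixes_sum1 {disp : measure_display} {T : measurableType disp}
    {R : realType} n (c : nat -> R) (mu_ : nat -> probability T R)
    (mu : probability T R) :
  mixes n c (fun k => mu_ k) mu -> (\sum_(k < n) c k = 1)%R.
Proof.
move=> mm.
have h : \sum_(k < n) (c k)%:E * mu_ k setT = 1.
  by rewrite -(probability_setT mu); exact/esym/mm.
apply: EFin_inj; rewrite -h -sumEFin; apply: eq_bigr => k _.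
have -> : mu_ k setT = 1 by exact: probability_setT.
by rewrite mule1.
Qed.

(** * The weak transport cost in terms of kernels *)

Section transport_kernels.
Context {R : realType} {d : nat}.
Local Notation E := (Rd R d).
Implicit Types (a b c : probability E R) (p q : R.-pker E ~> E) (i : 'I_d).

Definition coord i (x : E) : R := (x : 'rV[R]_d) ord0 i.

Lemma measurable_coord i : measurable_fun setT (coord i).
Proof.
apply: (measurability _ (RGenOpens.measurableE R)) => _ [_ [r [s ->]] <-].
rewrite setTI; apply: sub_sigma_algebra.
apply: (@open_comp _ _ (fun x : 'rV[R]_d => x ord0 i)); last exact: interval_open.
by move=> x _; exact: coord_continuous.
Qed.

(** The kernel form of a coupling of [a] and [b] disintegrated along [a]; the cost depends on this
    kernel alone. *)
Definition transports a b p := forall A, measurable A -> \int[a]_x p x A = b A.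

Definition bary p i (x : E) : R := Rintegral (p x) setT (coord i).

Definition sqdisp p i (x : E) : R := ((coord i x - bary p i x) ^+ 2)%R.

Lemma measurable_bary p i : measurable_fun setT (bary p i).
Proof.
by apply: measurable_Rintegral_pkernel; exact: measurable_coord.
Qed.

Lemma measurable_sqdisp p i : measurable_fun setT (sqdisp p i).
Proof.
apply: measurable_funX; apply: measurable_funB; first exact: measurable_coord.
exact: measurable_bary.
Qed.

(** The squared Euclidean norm splits over coordinates, so that later estimates are made for one
    coordinate at a time, with one kernel for all of them. *)
Lemma bary_costE a p :
  bary_cost a p = 2^-1%:E * \sum_(i < d) \int[a]_x (sqdisp p i x)%:E.
Proof.
rewrite -ge0_integral_sum//; last 2 first.
- by move=> i; apply/measurable_EFinP; exact: measurable_sqdisp.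
- by move=> i x _; rewrite lee_fin sqr_ge0.
rewrite -ge0_integralZl_EFin//; last 2 first.
- by move=> x _; apply: sume_ge0 => i _; rewrite lee_fin sqr_ge0.
- by apply: emeasurable_sum => i; apply/measurable_EFinP; exact: measurable_sqdisp.
apply: eq_integral => x _.
rewrite sumEFin -EFinM /enorm sqr_sqrtr; last by apply: sumr_ge0 => i _; exact: sqr_ge0.
congr (_ * _)%:E; apply: eq_bigr => i _.
by rewrite /sqdisp /bary /barycenter !mxE.
Qed.

(** The coupling is p_x(dy) a(dx), built as a product of kernels. Together with the next lemma this
    makes [T2bar] an infimum over kernels. *)
Lemma T2bar_le_bary_cost a b p : transports a b p -> T2bar b a <= bary_cost a p.
Proof.
move=> pab; apply: ereal_inf_lbound.
pose P := kprobability (measurable_cst (a : pprobability E R) : measurable_fun [set: unit] _).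
have ED D : measurable D -> mkproduct P (ksnd p) tt D = \int[a]_x p x (xsection D x).
  move=> mD; rewrite /mkproduct /= /kproduct; apply: eq_integral => x _.
  rewrite /kernel.intker_indic integral_indic//; last first.
    by rewrite -[X in measurable X]xsectionE; exact: measurable_xsection.
  by rewrite setIT xsectionE.
have P1 : mkproduct P (ksnd p) tt setT = 1.
  rewrite ED// (eq_integral (cst 1)).
    by rewrite integral_cst// mul1e; exact: probability_setT.
  by move=> x _; rewrite (_ : xsection _ _ = setT) ?prob_kernel// xsectionE.
have [pi hpi] := exists_probability P1 (fun D mD => esym (ED D mD)).
exists pi, p; split => //; split => A mA.
- have mA' : measurable (fst @^-1` A : set (E * E)).
    by rewrite -[X in measurable X]setTI; exact: measurable_fst.
  rewrite hpi// -[in RHS](setIT A) -integral_indic//; apply: eq_integral => x _.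
  rewrite xsectionE indicE; have [xA|xA] := boolP (x \in A).
    rewrite (_ : _ @^-1` _ = setT) ?prob_kernel//; apply/seteqP; split => // y _ /=.
    exact/set_mem.
  rewrite (_ : _ @^-1` _ = set0) ?measure0//; apply/seteqP; split => // y /=.
  by move/mem_set; rewrite (negPf xA).
- have mA' : measurable (snd @^-1` A : set (E * E)).
    by rewrite -[X in measurable X]setTI; exact: measurable_snd.
  by rewrite hpi//= -pab//; apply: eq_integral => x _; rewrite xsectionE.
Qed.

Lemma T2bar_lt_transports a b (e : \bar R) : T2bar b a < e ->
  exists2 p, transports a b p & bary_cost a p < e.
Proof.
move=> /ereal_inf_lt[_ [pi [p [[_ pi2] dis ->]]] lte]; exists p => // A mA.
rewrite -pi2// dis//; last by rewrite -[X in measurable X]setTI; exact: measurable_snd.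
by apply: eq_integral => x _; rewrite xsectionE.
Qed.

End transport_kernels.

(** * Integrals of signed functions along a kernel *)

Section signed_integrals.
Context {d d' : measure_display} {X : measurableType d}
  {Y : measurableType d'} {R : realType}.

Variables (a : probability X R) (p : R.-pker X ~> Y)
  (b : {measure set Y -> \bar R}).
Hypothesis apb : forall A, measurable A -> \int[a]_x p x A = b A.
Variable f : Y -> R.
Hypothesis bf : b.-integrable setT (EFin \o f).

Lemma bind_integrable_ae : {ae a, forall x, (p x).-integrable setT (EFin \o f)}.
Proof.
have mf := measurable_int _ bf.
have maf : measurable_fun setT (fun y => `|(EFin \o f) y|) by exact: measurableT_comp.
have ig : a.-integrable setT (fun x => \int[p x]_y `|(EFin \o f) y|).
  apply/integrableP; split; first exact: measurable_integral_pkernel.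
  under eq_integral do rewrite gee0_abs ?integral_ge0//.
  rewrite -(integral_bind apb)//.
  by case/integrableP : bf.
have := integrable_ae measurableT ig.
apply: filterS => x /(_ I) xfin; apply/integrableP; split => //.
by rewrite ltey_eq xfin.
Qed.

(** Where [f] is not integrable for [p x], [Rintegral] takes a default value, but only on an
    [a]-null set; elsewhere it is the difference of the integrals of the two parts of [f], to which
    [integral_bind] applies. *)
Lemma bind_Rintegral_spec :
  a.-integrable setT (EFin \o (fun x => Rintegral (p x) setT f)) /\
  Rintegral b setT f = Rintegral a setT (fun x => Rintegral (p x) setT f).
Proof.
have mf := measurable_int _ bf.
have mfR : measurable_fun setT f by exact/measurable_EFinP.
pose fp x := \int[p x]_y (EFin \o f)^\+ y.
pose fn x := \int[p x]_y (EFin \o f)^\- y.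
have mfp : measurable_fun setT fp.
  by apply: measurable_integral_pkernel; exact: measurable_funepos.
have mfn : measurable_fun setT fn.
  by apply: measurable_integral_pkernel; exact: measurable_funeneg.
have fp0 x : 0 <= fp x by apply: integral_ge0.
have fn0 x : 0 <= fn x by apply: integral_ge0.
have Ep : \int[b]_y (EFin \o f)^\+ y = \int[a]_x fp x.
  by rewrite (integral_bind apb)//; exact: measurable_funepos.
have En : \int[b]_y (EFin \o f)^\- y = \int[a]_x fn x.
  by rewrite (integral_bind apb)//; exact: measurable_funeneg.
have ip : a.-integrable setT fp.
  apply/integrableP; split => //; under eq_integral do rewrite gee0_abs//.
  by rewrite -Ep; exact: integral_funepos_lt_pinfty.
have in_ : a.-integrable setT fn.
  apply/integrableP; split => //; under eq_integral do rewrite gee0_abs//.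
  by rewrite -En; exact: integral_funeneg_lt_pinfty.
have ae : ae_eq a setT (fp \- fn) (EFin \o (fun x => Rintegral (p x) setT f)).
  have := bind_integrable_ae; apply: filterS => x ix _ /=.
  rewrite /Rintegral fineK; first by rewrite [RHS]integralE.
  exact: integrable_fin_num ix.
have mR : measurable_fun setT (EFin \o (fun x => Rintegral (p x) setT f)).
  by apply/measurable_EFinP; exact: measurable_Rintegral_pkernel.
have iB : a.-integrable setT (fp \- fn) by exact: integrableB.
split.
  apply/integrableP; split => //.
  rewrite -(ge0_ae_eq_integral _ (f := fun x => `|(fp \- fn) x|))//.
  - by case/integrableP : iB.
  - by apply: measurableT_comp => //; exact: emeasurable_funB.
  - exact: measurableT_comp.
  - exact: ae_eq_abse.
rewrite /Rintegral; congr fine.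
rewrite [LHS]integralE Ep En -integralB//; apply: ae_eq_integral => //.
exact: emeasurable_funB.
Qed.

Lemma bind_Rintegrable :
  a.-integrable setT (EFin \o (fun x => Rintegral (p x) setT f)).
Proof. by have [] := bind_Rintegral_spec. Qed.

Lemma bind_Rintegral :
  Rintegral b setT f = Rintegral a setT (fun x => Rintegral (p x) setT f).
Proof. by have [] := bind_Rintegral_spec. Qed.

End signed_integrals.

(** Components of weight zero are exempt from integrability: below, the weights depend on a point
    and may vanish where a kernel has no mean. *)
Lemma mixes_Rintegral {disp : measure_display} {T : measurableType disp}
    {R : realType} n (w : nat -> R) (m_ : nat -> {measure set T -> \bar R})
    (m : {measure set T -> \bar R}) (f : T -> R) :
  (forall k, (0 <= w k)%R) -> mixes n w m_ m -> measurable_fun setT f ->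
  (forall k, (k < n)%N -> w k = 0%R \/ (m_ k).-integrable setT (EFin \o f)) ->
  Rintegral m setT f = (\sum_(k < n) w k * Rintegral (m_ k) setT f)%R.
Proof.
move=> w0 mm mf h.
have mfE : measurable_fun setT (EFin \o f) by exact/measurable_EFinP.
rewrite /Rintegral integralE.
rewrite !(mixes_integral w0 mm)//; last 2 first.
- exact: measurable_funeneg.
- exact: measurable_funepos.
have Ep (k : 'I_n) : (w k)%:E * \int[m_ k]_x (EFin \o f)^\+ x =
    (w k * fine (\int[m_ k]_x (EFin \o f)^\+ x))%:E.
  case: (h k (ltn_ord k)) => [->|ik]; first by rewrite mul0e mul0r.
  by rewrite EFinM fineK//; exact: integrable_pos_fin_num.
have En (k : 'I_n) : (w k)%:E * \int[m_ k]_x (EFin \o f)^\- x =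
    (w k * fine (\int[m_ k]_x (EFin \o f)^\- x))%:E.
  case: (h k (ltn_ord k)) => [->|ik]; first by rewrite mul0e mul0r.
  by rewrite EFinM fineK//; exact: integrable_neg_fin_num.
rewrite (eq_bigr _ (fun k _ => Ep k)) (eq_bigr _ (fun k _ => En k)) !sumEFin/=.
rewrite -sumrB; apply: eq_bigr => k _.
case: (h k (ltn_ord k)) => [->|ik]; first by rewrite !mul0r subrr.
rewrite -mulrBr; congr (_ * _)%R.
have -> : \int[m_ k]_x (f x)%:E =
    \int[m_ k]_x (EFin \o f)^\+ x - \int[m_ k]_x (EFin \o f)^\- x.
  by rewrite integralE.
have ip := integrable_pos_fin_num measurableT ik.
have in_ := integrable_neg_fin_num measurableT ik.
by rewrite (fineB ip in_).
Qed.

Lemma exists_kcomp {d d' d'' : measure_display} {X : measurableType d}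
    {Y : measurableType d'} {Z : measurableType d''} {R : realType}
    (p : R.-pker X ~> Y) (q : R.-pker Y ~> Z) :
  exists r : R.-pker X ~> Z,
    forall x A, measurable A -> r x A = \int[p x]_y q y A.
Proof.
apply: exists_pkernel => [x|A mA].
  have m1 : mkcomp p (ksnd q) x setT = 1.
    rewrite /mkcomp /= /kcomp (eq_integral (cst 1)).
      by rewrite integral_cst// mul1e; exact: prob_kernel.
    by move=> y _; exact: prob_kernel.
  exact: (exists_probability m1 (fun _ _ => erefl)).
apply: measurable_integral_pkernel.
exact: measurable_kernel.
Qed.

Lemma exists_kmix {d d' : measure_display} {X : measurableType d}
    {Y : measurableType d'} {R : realType} n (w : nat -> X -> R)
    (p : nat -> R.-pker X ~> Y) :
  (forall k, measurable_fun setT (w k)) -> (forall k x, (0 <= w k x)%R) ->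
  (forall x, \sum_(k < n) w k x = 1)%R ->
  exists r : R.-pker X ~> Y,
    forall x, mixes n (fun k => w k x) (fun k => p k x) (r x).
Proof.
move=> mw w0 w1.
apply: (@exists_pkernel _ _ _ _ _
  (fun x A => \sum_(k < n) (w k x)%:E * p k x A)) => [x|A mA].
  apply: (@exists_mixture _ _ _ n (fun k => w k x) (fun k => p k x)) => // k.
  exact: prob_kernel.
apply: (@emeasurable_sum _ _ _ _ _ _
  (fun (k : 'I_n) x => (w k x)%:E * p k x A)) => k; apply: emeasurable_funM.
  exact/measurable_EFinP.
exact: measurable_kernel.
Qed.

(** * The triangle inequality *)

Section weak_cost_calculus.
Context {R : realType} {d : nat}.
Local Notation E := (Rd R d).
Implicit Types (a b c : probability E R) (p q r : R.-pker E ~> E) (i : 'I_d).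

Definition finite_second_moment (m : {measure set E -> \bar R}) :=
  forall i, \int[m]_x ((coord i x) ^+ 2)%:E < +oo.

Lemma measurable_sqcoord i : measurable_fun setT (fun x : E => (coord i x ^+ 2)%:E).
Proof. by apply/measurable_EFinP; apply: measurable_funX; exact: measurable_coord. Qed.

Lemma integrable_coord b i : finite_second_moment b ->
  b.-integrable setT (EFin \o coord i).
Proof.
move=> /(_ i) bi; apply: sqr_integrable => //; last exact: measurable_coord.
exact: probability_setT.
Qed.

Lemma measurable_EFin_sqdisp p i : measurable_fun setT (fun x => (sqdisp p i x)%:E).
Proof. by apply/measurable_EFinP; exact: measurable_sqdisp. Qed.

Lemma EFin_sqdisp_ge0 p i x : 0 <= (sqdisp p i x)%:E.
Proof. by rewrite lee_fin sqr_ge0. Qed.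

(** If u is the displacement under p at x, that of the composition is u + v, with v the mean under
    p_x of the displacements of q. Then (u + v)^2 <= (1 + s) u^2 + (1 + 1/s) v^2, Jensen bounds v^2
    by the mean of the squared displacements of q, and integrating p_x against [a] gives [b]. *)
Lemma sqdisp_kcomp a b c p q r i (s : R) : (0 < s)%R ->
  finite_second_moment b -> finite_second_moment c ->
  transports a b p -> transports b c q ->
  (forall x A, measurable A -> r x A = \int[p x]_y q y A) ->
  \int[a]_x (sqdisp r i x)%:E <=
  (1 + s)%:E * \int[a]_x (sqdisp p i x)%:E +
  (1 + s^-1)%:E * \int[b]_x (sqdisp q i x)%:E.
Proof.
move=> s0 b2 c2 pab qbc rE.
have ib := integrable_coord i b2.
have ic := integrable_coord i c2.
have acr : transports a c r.
  move=> A mA; rewrite -qbc// (integral_bind pab)//; last exact: measurable_kernel.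
  by apply: eq_integral => x _; rewrite rE.
have ae1 := bind_integrable_ae pab ib.
have ae2 := bind_integrable_ae acr ic.
have ibq : b.-integrable setT (EFin \o bary q i) := bind_Rintegrable qbc ic.
have ae3 := bind_integrable_ae pab ibq.
have s1 : (0 <= s^-1)%R by rewrite invr_ge0 ltW.
have mqb : measurable_fun setT (fun x => \int[p x]_y (sqdisp q i y)%:E).
  by apply: measurable_integral_pkernel; exact: measurable_EFin_sqdisp.
rewrite (integral_bind pab); [|exact: EFin_sqdisp_ge0|exact: measurable_EFin_sqdisp].
have c1 : (0 <= 1 + s)%R by rewrite addr_ge0// ltW.
have c2' : (0 <= 1 + s^-1)%R by rewrite addr_ge0.
have p0 x : [set: E] x -> 0 <= (sqdisp p i x)%:E by rewrite lee_fin sqr_ge0.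
have q0 x : [set: E] x -> 0 <= \int[p x]_y (sqdisp q i y)%:E.
  by move=> _; apply: integral_ge0 => y _; exact: EFin_sqdisp_ge0.
have mp := measurable_EFin_sqdisp p i.
rewrite -!ge0_integralZl_EFin//.
rewrite -ge0_integralD//; last 4 first.
- by move=> x _; rewrite mule_ge0// p0.
- exact: measurable_funeM.
- by move=> x _; rewrite mule_ge0// q0.
- exact: measurable_funeM.
apply: ae_ge0_le_integral => //.
- by move=> x _; exact: EFin_sqdisp_ge0.
- exact: measurable_EFin_sqdisp.
- by move=> x _; rewrite adde_ge0// mule_ge0// ?p0// q0.
- by apply: emeasurable_funD; apply: measurable_funeM.
move: ae1 ae2 ae3; apply: filterS3 => x i1 i2 i3 _.
have rq : bary r i x = Rintegral (p x) setT (bary q i).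
  have px1 : p x setT = 1 by exact: prob_kernel.
  pose px : probability E R := prob_of px1.
  apply: (@bind_Rintegral _ _ _ _ R px q (r x)) => //.
  by move=> A mA; rewrite rE.
pose u := (coord i x - bary p i x)%R.
pose v := Rintegral (p x) setT (fun y => coord i y - bary q i y)%R.
have uv : (coord i x - bary r i x = u + v)%R.
  rewrite /u /v RintegralB// rq; rewrite /bary; lra.
have v2 : (v ^+ 2)%:E <= \int[p x]_y (sqdisp q i y)%:E.
  apply: sqr_Rintegral_le; first exact: prob_kernel.
  by apply: measurable_funB; [exact: measurable_coord|exact: measurable_bary].
apply: (@le_trans _ _ ((1 + s)%:E * (sqdisp p i x)%:E + (1 + s^-1)%:E * (v ^+ 2)%:E)).
  rewrite -!EFinM -EFinD lee_fin /sqdisp uv -/u.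
  rewrite -subr_ge0 [leRHS](_ : _ = s^-1 * (s * u - v) ^+ 2)%R; last by field; lra.
  by rewrite mulr_ge0// sqr_ge0.
by rewrite leeD2l// lee_wpmul2l// lee_fin addr_ge0.
Qed.

Lemma T2bar_ge0 a b : 0 <= T2bar b a.
Proof.
apply: le_ereal_inf_tmp => _ [pi [p [_ _ ->]]].
by apply: integral_ge0 => x _; rewrite lee_fin mulr_ge0// sqr_ge0.
Qed.

Lemma T2bar_le_transports a b (u e : R) : T2bar b a <= u%:E -> (0 < e)%R ->
  exists2 p, transports a b p &
    2^-1%:E * \sum_(i < d) \int[a]_x (sqdisp p i x)%:E <= (u + e)%:E.
Proof.
move=> Tu e0; have /T2bar_lt_transports[p pab] : T2bar b a < (u + e)%:E.
  by rewrite (le_lt_trans Tu)// lte_fin ltrDl.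
by rewrite bary_costE => /ltW ?; exists p.
Qed.

Lemma T2bar_le_sqdisp a b p : transports a b p ->
  T2bar b a <= 2^-1%:E * \sum_(i < d) \int[a]_x (sqdisp p i x)%:E.
Proof. by move=> pab; rewrite -bary_costE; exact: T2bar_le_bary_cost. Qed.

(** Near-optimal kernels are composed. The parameter [s] stays free because each use tunes it to the
    sizes of [u] and [v]. *)
Lemma T2bar_triangle a b c (u v s : R) : (0 < s)%R ->
  finite_second_moment b -> finite_second_moment c ->
  T2bar b a <= u%:E -> T2bar c b <= v%:E ->
  T2bar c a <= ((1 + s) * u + (1 + s^-1) * v)%:E.
Proof.
move=> s0 b2 c2 Tu Tv; apply/lee_addgt0Pr => e e0.
have s1 : (0 < s^-1)%R by rewrite invr_gt0.
(* [2 + s + s^-1] is the sum of the two coefficients, so that the slacks of the two kernels add up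
   to [e]. *)
pose e1 := (e / (2 + s + s^-1))%R.
have e10 : (0 < e1)%R by rewrite divr_gt0// !addr_gt0.
have [p pab hp] := T2bar_le_transports Tu e10.
have [q qbc hq] := T2bar_le_transports Tv e10.
have [r rE] := exists_kcomp p q.
have acr : transports a c r.
  move=> A mA; rewrite -qbc// (integral_bind pab)//; last exact: measurable_kernel.
  by apply: eq_integral => x _; rewrite rE.
apply: (le_trans (T2bar_le_sqdisp acr)).
have h i := sqdisp_kcomp i s0 b2 c2 pab qbc rE.
apply: (@le_trans _ _ (2^-1%:E * \sum_(i < d)
  ((1 + s)%:E * \int[a]_x (sqdisp p i x)%:E +
  (1 + s^-1)%:E * \int[b]_x (sqdisp q i x)%:E))).
  by rewrite lee_wpmul2l ?lee_fin// lee_sum.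
have I0 (m : probability E R) q' i : 0 <= \int[m]_x (sqdisp q' i x)%:E.
  by apply: integral_ge0 => x _; exact: EFin_sqdisp_ge0.
rewrite big_split/= -!ge0_sume_distrr//.
have S0 (m : probability E R) q' : 0 <= \sum_(i < d) \int[m]_x (sqdisp q' i x)%:E.
  by apply: sume_ge0 => i _.
have c1 : 0 <= (1 + s)%:E by rewrite lee_fin addr_ge0// ltW.
have c2' : 0 <= (1 + s^-1)%:E by rewrite lee_fin addr_ge0// ltW.
rewrite ge0_muleDr; [|exact: mule_ge0|exact: mule_ge0].
rewrite muleCA [X in _ + X]muleCA.
apply: (@le_trans _ _ ((1 + s)%:E * (u + e1)%:E + (1 + s^-1)%:E * (v + e1)%:E)).
  by apply: leeD; apply: lee_wpmul2l => //; rewrite lee_fin addr_ge0// ltW.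
rewrite -!EFinM -!EFinD lee_fin.
have -> : (e = (2 + s + s^-1) * e1)%R.
  by rewrite /e1 mulrC divfK// gt_eqF// !addr_gt0.
lra.
Qed.

End weak_cost_calculus.

(** * Joint convexity of the weak cost *)

(** Bayes' formula: [w k x] is the posterior probability, given a point [x] drawn from [a], that it
    came from component [k], namely c_k da_k/da. *)
Lemma exists_mixing_weights {disp : measure_display} {T : measurableType disp}
    {R : realType} n (c : nat -> R) (a_ : nat -> probability T R)
    (a : probability T R) :
  (forall k, (0 <= c k)%R) -> mixes n c (fun k => a_ k) a ->
  exists w : nat -> T -> R, [/\ forall k, measurable_fun setT (w k),
    forall k x, (0 <= w k x)%R, forall x, (\sum_(k < n) w k x = 1)%R &
    forall k, (k < n)%N -> forall f, (forall x, 0 <= f x) ->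
      measurable_fun setT f ->
      (c k)%:E * \int[a_ k]_x f x = \int[a]_x (f x * (w k x)%:E)].
Proof.
move=> c0 mc.
have hk k : exists h : T -> R, [/\ measurable_fun setT h,
    forall x, (0 <= h x)%R & (k < n)%N -> forall f, (forall x, 0 <= f x) ->
      measurable_fun setT f ->
      (c k)%:E * \int[a_ k]_x f x = \int[a]_x (f x * (h x)%:E)].
  have [ck0|ckn0] := eqVneq (c k) 0%R.
    (* A component of weight zero need not be dominated by [a]; its posterior weight is set to zero
       by hand. *)
    exists (cst 0%R); split => // _ f f0 mf; rewrite ck0 mul0e.
    by under eq_integral do rewrite mule0; rewrite integral0.
  have ckp : (0 < c k)%R by rewrite lt_neqAle eq_sym ckn0 c0.
  have [kn|kn] := ltnP k n; last by exists (cst 0%R); split.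
  have : a_ k `<< a.
    apply/null_content_dominatesP => A mA aA0.
    have := mc A mA; rewrite [X in X = _ -> _](_ : _ = 0); last exact: aA0.
    rewrite (bigD1 (Ordinal kn))//= => /esym h0.
    have : (c k)%:E * a_ k A <= 0.
      by rewrite -h0 leeDl// sume_ge0// => j _; rewrite mule_ge0 ?lee_fin.
    by rewrite pmule_rle0 ?lte_fin// measure_le0 => /eqP.
  move=> /dominates_density[h hd]; case: (hd) => mh h0 ah.
  exists (fun x => c k * h x)%R; split.
  - exact: measurable_funM.
  - by move=> x; rewrite mulr_ge0.
  - move=> _ f f0 mf; rewrite (density_integral hd)//.
    rewrite -ge0_integralZl_EFin//.
    + by apply: eq_integral => x _; rewrite muleCA EFinM.
    + by move=> x _; rewrite mule_ge0// lee_fin.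
    + by apply: emeasurable_funM => //; exact/measurable_EFinP.
have [h hP] := choice hk.
have n0 : (0 < n)%N.
  case: n mc {hk h hP} => // /(_ _ measurableT); rewrite big_ord0 => a0.
  by have := probability_setT a; rewrite a0 => /eqP; rewrite eqe eq_sym oner_eq0.
have mh k : measurable_fun setT (h k) by have [] := hP k.
have h0 k x : (0 <= h k x)%R by have [] := hP k.
pose S x := (\sum_(k < n) h k x)%R.
have mS : measurable_fun setT S by exact: measurable_sum.
have S0 x : (0 <= S x)%R by apply: sumr_ge0.
have SA A : measurable A -> \int[a]_(x in A) (S x)%:E = a A.
  move=> mA; rewrite mc//.
  rewrite (_ : (fun x => _) = (fun x => \sum_(k < n) (h k x)%:E)); last first.
    by apply/funext => x; rewrite sumEFin.
  rewrite ge0_integral_sum//; last 2 first.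
  - by move=> k; apply/measurable_EFinP; exact: measurable_funTS.
  - by move=> k x _; rewrite lee_fin.
  apply: eq_bigr => k _; have [_ _ /(_ (ltn_ord k)) hk'] := hP k.
  have := hk' (fun x => (\1_A x)%:E); rewrite integral_indic// setIT => -> //.
    rewrite integral_mkcond; apply: eq_integral => x _.
    by rewrite patchE indicE; case: ifPn => xA; rewrite ?mul1e ?mul0e.
  exact/measurable_EFinP.
have iS : a.-integrable setT (EFin \o S).
  apply/integrableP; split; first exact/measurable_EFinP.
  under eq_integral do rewrite /= ger0_norm//.
  by rewrite SA// probability_setT ltry.
have Sae : ae_eq a setT (EFin \o S) (cst 1).
  apply: integral_ae_eq => //.
  by move=> A _ mA; rewrite SA// integral_cst// mul1e.
(* The densities sum to one only [a]-almost everywhere. Elsewhere all the weight goes to index 0, so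
   that a kernel can be mixed at every point. *)
pose w k x : R := if S x == 1%R then h k x else ((k == 0)%N)%:R.
have mw k : measurable_fun setT (w k).
  apply: measurable_fun_ifT => //.
  by apply: (measurable_fun_eqr mS); exact: measurable_cst.
exists w; split => //.
- by move=> k x; rewrite /w; case: ifP.
- move=> x; rewrite /w; have [//|_] := eqVneq (S x) 1%R.
  rewrite (bigD1 (Ordinal n0))//= big1 ?addr0// => j.
  by rewrite -val_eqE/= => /negPf ->.
- move=> k kn f f0 mf; have [_ _ /(_ kn) ->//] := hP k.
  apply: ge0_ae_eq_integral => //.
  + by apply: emeasurable_funM => //; exact/measurable_EFinP.
  + by apply: emeasurable_funM => //; exact/measurable_EFinP.
  + by move=> x _; rewrite mule_ge0// lee_fin.
  + by move=> x _; rewrite mule_ge0// lee_fin /w; case: ifP.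
  + move: Sae; apply: filterS => x /(_ I)/= [Sx1] _.
    by rewrite /w Sx1 eqxx.
Qed.

Lemma sqr_sum_le {R : realType} n (w u : 'I_n -> R) :
  (forall k, (0 <= w k)%R) -> (\sum_k w k = 1)%R ->
  ((\sum_k w k * u k) ^+ 2 <= \sum_k w k * u k ^+ 2)%R.
Proof.
move=> w0 w1; set m := (\sum_k _ * u k)%R.
have : (0 <= \sum_k w k * (u k - m) ^+ 2)%R.
  by apply: sumr_ge0 => k _; rewrite mulr_ge0// sqr_ge0.
have key (z : R) : (\sum_k w k * (u k - z) ^+ 2 =
    \sum_k w k * u k ^+ 2 - 2 * z * (\sum_k w k * u k) + z ^+ 2 * \sum_k w k)%R.
  rewrite !mulr_sumr -sumrB -big_split/=; apply: eq_bigr => k _.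
  move: (w k) (u k) => ? ?; ring.
rewrite key -/m w1; nra.
Qed.

Section weak_cost_convexity.
Context {R : realType} {d : nat}.
Local Notation E := (Rd R d).
Implicit Types (a b c : probability E R) (p q r : R.-pker E ~> E) (i : 'I_d).

Lemma mixes_second_moment n (c : nat -> R) (a_ : nat -> probability E R) a :
  (forall k, (0 <= c k)%R) -> mixes n c (fun k => a_ k) a ->
  (forall k, finite_second_moment (a_ k)) -> finite_second_moment a.
Proof.
move=> c0 mc a2 i; rewrite (mixes_integral c0 mc).
- apply: lte_sum_pinfty => k _; rewrite lte_mul_pinfty ?lee_fin//; exact: a2.
- by move=> x; rewrite lee_fin sqr_ge0.
- exact: measurable_sqcoord.
Qed.

Lemma sqdisp_kmix n (w : nat -> R) (p : nat -> R.-pker E ~> E) r i x :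
  (forall k, (0 <= w k)%R) -> (\sum_(k < n) w k = 1)%R ->
  mixes n w (fun k => p k x) (r x) ->
  (forall k, (k < n)%N -> w k = 0%R \/ (p k x).-integrable setT (EFin \o coord i)) ->
  (sqdisp r i x <= \sum_(k < n) w k * sqdisp (p k) i x)%R.
Proof.
move=> w0 w1 mm h.
rewrite /sqdisp /bary (mixes_Rintegral w0 mm _ h); last exact: measurable_coord.
rewrite -[coord i x]mul1r -{1}w1 mulr_suml -sumrB.
under eq_bigr do rewrite -mulrBr.
under [leRHS]eq_bigr do rewrite mul1r.
by apply: sqr_sum_le => // k.
Qed.

(** Transport [x] by the kernels [p k] mixed with the posterior weights of [x]. Displacements
    average with these weights, Jensen bounds the square, and the identity defining the weights
    integrates each term back to [a_ k]. *)
Lemma T2bar_mixes n (c : nat -> R) (a_ b_ : nat -> probability E R) a b (u : nat -> R) :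
  (forall k, (0 <= c k)%R) ->
  mixes n c (fun k => a_ k) a -> mixes n c (fun k => b_ k) b ->
  (forall k, finite_second_moment (b_ k)) ->
  (forall k, (k < n)%N -> T2bar (b_ k) (a_ k) <= (u k)%:E) ->
  T2bar b a <= (\sum_(k < n) c k * u k)%:E.
Proof.
move=> c0 mca mcb b2 Tu.
suff H (e : R) : (0 < e)%R ->
    T2bar b a <= (\sum_(k < n) c k * u k)%:E + e%:E.
  by apply/lee_addgt0Pr => e; exact: H.
move=> e0.
have c1 := mixes_sum1 mca.
have [w [mw w0 w1 wE]] := exists_mixing_weights c0 mca.
have hp k : exists p : R.-pker E ~> E, (k < n)%N -> transports (a_ k) (b_ k) p /\
   2^-1%:E * \sum_(i < d) \int[a_ k]_x (sqdisp p i x)%:E <= (u k + e)%:E.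
  have [kn|kn] := ltnP k n.
    by have [p ? ?] := T2bar_le_transports (Tu k kn) e0; exists p.
  by exists (kdirac (@measurable_id _ E setT)).
have {hp}[p hp] := choice hp.
have [r rm] := exists_kmix p mw w0 w1.
have abr : transports a b r.
  move=> A mA; rewrite mcb//.
  under eq_integral do rewrite rm//.
  rewrite ge0_integral_sum//; last 2 first.
  - move=> k; apply: emeasurable_funM; first exact/measurable_EFinP.
    exact: measurable_kernel.
  - by move=> k x _; rewrite mule_ge0// lee_fin.
  apply: eq_bigr => k _; have [tk _] := hp k (ltn_ord k).
  transitivity ((c k)%:E * \int[a_ k]_x p k x A); last first.
    by congr (_ * _); exact: tk.
  rewrite wE//; last exact: measurable_kernel.
  by apply: eq_integral => x _; rewrite muleC.
apply: (le_trans (T2bar_le_sqdisp abr)).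
(* Integrating under [a_ k] is integrating under [a] with the posterior weight, so finiteness is
   only obtained where this weight is positive. *)
have ae i (k : 'I_n) : {ae a, forall x, w k x = 0%R \/
    (p k x).-integrable setT (EFin \o coord i)}.
  have [tk _] := hp k (ltn_ord k).
  have mc : measurable_fun [set: E] (EFin \o coord i).
    exact: measurable_int (integrable_coord i (b2 k)).
  have mac : measurable_fun [set: E] (fun y => `|(EFin \o coord i) y|).
    exact: measurableT_comp.
  have mg : measurable_fun [set: E] (fun x => \int[p k x]_y `|(EFin \o coord i) y|).
    exact: measurable_integral_pkernel.
  have ig : a.-integrable setT
      (fun x => \int[p k x]_y `|(EFin \o coord i) y| * (w k x)%:E).
    apply/integrableP; split.
      by apply: emeasurable_funM => //; exact/measurable_EFinP.
    under eq_integral do rewrite gee0_abs ?mule_ge0 ?integral_ge0// ?lee_fin//.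
    rewrite -wE//; last by move=> x; exact: integral_ge0.
    rewrite -(integral_bind tk)// lte_mul_pinfty ?lee_fin//.
    by have /integrableP[] := integrable_coord i (b2 k).
  have := integrable_ae measurableT ig; apply: filterS => x /(_ I) xfin.
  have [->|wn0] := eqVneq (w k x) 0%R; [by left|right].
  apply/integrableP; split => //.
  move: xfin; have := @integral_ge0 _ _ _ (p k x) setT (fun y => `|(EFin \o coord i) y|).
  case: (\int[p k x]_y _) => [s _ _|h|/(_ (fun x _ => abse_ge0 _))//]; first exact: ltry.
  by rewrite gt0_mulye// lte_fin lt_neqAle eq_sym wn0 w0.
have cost i : \int[a]_x (sqdisp r i x)%:E <=
    \sum_(k < n) (c k)%:E * \int[a_ k]_x (sqdisp (p k) i x)%:E.
  rewrite (eq_bigr (fun k : 'I_n => \int[a]_x ((sqdisp (p k) i x)%:E * (w k x)%:E))); last first.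
    move=> k _; rewrite wE//; last exact: measurable_EFin_sqdisp.
    by move=> x; exact: EFin_sqdisp_ge0.
  have mm (k : 'I_n) : measurable_fun setT (fun x => (sqdisp (p k) i x)%:E * (w k x)%:E).
    apply: emeasurable_funM; first exact: measurable_EFin_sqdisp.
    exact/measurable_EFinP.
  have m0 (k : 'I_n) x : [set: E] x -> 0 <= (sqdisp (p k) i x)%:E * (w k x)%:E.
    by move=> _; rewrite mule_ge0 ?EFin_sqdisp_ge0// lee_fin.
  rewrite -ge0_integral_sum//.
  apply: ae_ge0_le_integral => //.
  - by move=> x _; exact: EFin_sqdisp_ge0.
  - exact: measurable_EFin_sqdisp.
  - by move=> x _; apply: sume_ge0 => k _; exact: m0.
  - exact: emeasurable_sum.
  have : {ae a, forall x, forall k : 'I_n, w k x = 0%R \/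
      (p k x).-integrable setT (EFin \o coord i)}.
    have aen : forall m : nat, {ae a, forall x, (m < n)%N -> w m x = 0%R \/
      (p m x).-integrable setT (EFin \o coord i)}.
      move=> m; have [mn|mn] := ltnP m n; last by apply: aeW => x.
      by have := ae i (Ordinal mn); apply: filterS => x /=.
    by have := ae_foralln aen; apply: filterS => x hx k; exact: hx.
  apply: filterS => x hx _.
  under eq_bigr do rewrite muleC -EFinM.
  rewrite sumEFin lee_fin; apply: (sqdisp_kmix (w := fun k => w k x)) => //.
  by move=> k kn; exact: (hx (Ordinal kn)).
apply: (@le_trans _ _ (2^-1%:E * \sum_(i < d) \sum_(k < n)
    (c k)%:E * \int[a_ k]_x (sqdisp (p k) i x)%:E)).
  by rewrite lee_wpmul2l ?lee_fin// lee_sum.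
have I0 k i : 0 <= \int[a_ k]_x (sqdisp (p k) i x)%:E.
  by apply: integral_ge0 => x _; exact: EFin_sqdisp_ge0.
rewrite exchange_big/=.
under eq_bigr do rewrite -ge0_sume_distrr//.
rewrite ge0_sume_distrr//; last first.
  by move=> k _; rewrite mule_ge0 ?lee_fin// sume_ge0.
apply: (@le_trans _ _ (\sum_(k < n) (c k * (u k + e))%:E)).
  apply: lee_sum => k _; rewrite muleCA EFinM lee_wpmul2l ?lee_fin//.
  by have [] := hp k (ltn_ord k).
rewrite sumEFin -EFinD lee_fin.
rewrite (eq_bigr (fun k : 'I_n => c k * u k + c k * e)%R).
  by rewrite big_split/= -mulr_suml c1 mul1r.
by move=> k _; rewrite mulrDr.
Qed.

End weak_cost_convexity.

(** * Lazy transport, and stability in weighted total variation *)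

Section lazy_and_near.
Context {R : realType} {d : nat}.
Local Notation E := (Rd R d).
Implicit Types (a b c rho : probability E R) (p q r : R.-pker E ~> E) (i : 'I_d).

Lemma integrable_dirac (x : E) i :
  (\d_x : {measure set E -> \bar R}).-integrable setT (EFin \o coord i).
Proof.
have mc : measurable_fun [set: E] (EFin \o coord i).
  by apply/measurable_EFinP; exact: measurable_coord.
apply/integrableP; split => //.
rewrite integral_dirac//=; first by rewrite diracT mul1e ltry.
apply/measurable_EFinP; apply: measurableT_comp => //.
exact: measurable_coord.
Qed.

Lemma Rintegral_dirac (x : E) i :
  Rintegral (\d_x : {measure set E -> \bar R}) setT (coord i) = coord i x.
Proof.
rewrite /Rintegral integral_dirac//; first by rewrite diracT mul1e.
by apply/measurable_EFinP; exact: measurable_coord.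
Qed.

(** The Dirac part has mean [x], so the displacement is multiplied by [w x]. The fraction depends on
    [x] because [T2bar_near] moves only the local excess of mass. *)
Lemma exists_lazy_kernel p (w : E -> R) : measurable_fun setT w ->
  (forall x, 0 <= w x)%R -> (forall x, w x <= 1)%R ->
  exists r, (forall x A, measurable A ->
      r x A = (1 - w x)%:E * \d_x A + (w x)%:E * p x A) /\
    (forall x i, w x = 0%R \/ (p x).-integrable setT (EFin \o coord i) ->
      sqdisp r i x = (w x ^+ 2 * sqdisp p i x)%R).
Proof.
move=> mw w0 w1.
pose wk (k : nat) (x : E) : R := if k is 0 then (1 - w x)%R else w x.
pose pk : nat -> R.-pker E ~> E := fun k => if k is 0
  return (R.-pker E ~> E) then kdirac (@measurable_id _ E setT) else p.
have mwk k : measurable_fun setT (wk k) by case: k => //; exact: measurable_funB.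
have wk0 k x : (0 <= wk k x)%R by case: k => //=; rewrite subr_ge0.
have wk1 x : (\sum_(k < 2) wk k x = 1)%R.
  by rewrite !big_ord_recl big_ord0 /= addr0 subrK.
have [r rm] := @exists_kmix _ _ E E R 2 wk pk mwk wk0 wk1.
exists r; split => [x A mA|x i h].
  by rewrite rm// !big_ord_recl big_ord0 /= adde0.
have -> : (sqdisp r i x = (coord i x - bary r i x) ^+ 2)%R by [].
rewrite {1}/bary (mixes_Rintegral _ (rm x)).
- rewrite !big_ord_recl big_ord0 /= addr0.
  have -> : Rintegral (kdirac (@measurable_id _ E setT) x) setT (coord i) = coord i x.
    exact: Rintegral_dirac.
  rewrite /sqdisp -/(bary p i x) -exprMn; congr (_ ^+ 2)%R; lra.
- by move=> k; exact: wk0.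
- exact: measurable_coord.
- move=> [|k] _ /=; last exact: h.
  by right; exact: integrable_dirac.
Qed.

(* Transporting only the fraction t of the mass scales the barycentric
   displacement by t, hence the quadratic cost by t ^ 2. *)
Lemma T2bar_lazy a b c (t u : R) : (0 <= t <= 1)%R -> finite_second_moment b ->
  (forall A, measurable A -> c A = (1 - t)%:E * a A + t%:E * b A) ->
  T2bar b a <= u%:E -> T2bar c a <= (t ^+ 2 * u)%:E.
Proof.
move=> /andP[t0 t1] b2 cE Tu.
suff H (e : R) : (0 < e)%R -> T2bar c a <= (t ^+ 2 * u)%:E + e%:E.
  by apply/lee_addgt0Pr => e; exact: H.
move=> e0.
have [p pab hp] := T2bar_le_transports Tu e0.
have [r [rE rs]] : exists r, (forall x A, measurable A ->
      r x A = (1 - t)%:E * \d_x A + t%:E * p x A) /\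
    (forall x i, t = 0%R \/ (p x).-integrable setT (EFin \o coord i) ->
      sqdisp r i x = (t ^+ 2 * sqdisp p i x)%R).
  exact: (exists_lazy_kernel p (measurable_cst t)).
have acr : transports a c r.
  move=> A mA; under eq_integral do rewrite rE//.
  have md : measurable_fun [set: E] (fun x => \d_x A : \bar R).
    exact: measurable_fun_dirac.
  have mp : measurable_fun [set: E] (fun x => p x A) by exact: measurable_kernel.
  have t1' : (0 <= 1 - t)%R by rewrite subr_ge0.
  rewrite ge0_integralD//; last 4 first.
  - by move=> x _; rewrite mule_ge0.
  - exact: measurable_funeM.
  - by move=> x _; rewrite mule_ge0.
  - exact: measurable_funeM.
  rewrite !ge0_integralZl_EFin//.
  rewrite cE//; congr (_ * _ + _ * _); last exact: pab.
  by rewrite -[in RHS](setIT A) -integral_indic.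
apply: (le_trans (T2bar_le_sqdisp acr)).
have cost i : \int[a]_x (sqdisp r i x)%:E <= (t ^+ 2)%:E * \int[a]_x (sqdisp p i x)%:E.
  have mp := measurable_EFin_sqdisp p i.
  have p0 x : [set: E] x -> 0 <= (sqdisp p i x)%:E by rewrite lee_fin sqr_ge0.
  rewrite -ge0_integralZl_EFin ?sqr_ge0//.
  apply: ae_ge0_le_integral => //.
  - by move=> x _; exact: EFin_sqdisp_ge0.
  - exact: measurable_EFin_sqdisp.
  - by move=> x _; rewrite mule_ge0 ?lee_fin ?sqr_ge0.
  - exact: measurable_funeM.
  have := bind_integrable_ae pab (integrable_coord i b2).
  by apply: filterS => x ix _; rewrite rs; [rewrite EFinM|right].
apply: (@le_trans _ _ (2^-1%:E * \sum_(i < d) (t ^+ 2)%:E * \int[a]_x (sqdisp p i x)%:E)).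
  by rewrite lee_wpmul2l ?lee_fin// lee_sum.
rewrite -ge0_sume_distrr; last first.
  by move=> i _; apply: integral_ge0 => x _; exact: EFin_sqdisp_ge0.
rewrite muleCA; apply: (@le_trans _ _ ((t ^+ 2)%:E * (u + e)%:E)).
  by rewrite lee_wpmul2l// lee_fin sqr_ge0.
rewrite -EFinM -EFinD lee_fin mulrDr lerD2l.
by apply: ler_piMl; [exact: ltW|rewrite expr_le1].
Qed.

Lemma T2bar_self a b : (forall A, measurable A -> b A = a A) -> T2bar b a <= 0.
Proof.
move=> ab; pose p := (kdirac (@measurable_id _ E setT) : R.-pker E ~> E).
have pab : transports a b p.
  by move=> A mA; rewrite ab// -[in RHS](setIT A) -integral_indic.
apply: (le_trans (T2bar_le_sqdisp pab)).
rewrite big1 ?mule0// => i _; rewrite integral0_eq// => x _.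
have -> : sqdisp p i x = ((coord i x - coord i x) ^+ 2)%R.
  by congr ((_ - _) ^+ 2)%R; exact: Rintegral_dirac.
by rewrite subrr expr0n.
Qed.

Lemma T2bar_near rho a b (f g : E -> R) (u : R) :
  density rho a f -> density rho b g ->
  \sum_(i < d) \int[rho]_x (`|f x - g x| * (coord i x) ^+ 2)%:E <= u%:E ->
  T2bar b a <= u%:E.
Proof.
move=> af bg hu; have [mf f0 afE] := af; have [mg g0 bgE] := bg.
(* The common mass stays in place; the excess D of a is spread according to the
   normalized excess G of b, whatever the starting point. *)
pose D x : R := Num.max (f x - g x)%R 0%R; pose G x : R := Num.max (g x - f x)%R 0%R.
have D0 x : (0 <= D x)%R by rewrite le_max lexx orbT.
have G0 x : (0 <= G x)%R by rewrite le_max lexx orbT.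
have mD : measurable_fun setT D.
  by apply: measurable_maxr => //; exact: measurable_funB.
have mG : measurable_fun setT G.
  by apply: measurable_maxr => //; exact: measurable_funB.
have fD x : (D x <= f x)%R by rewrite ge_max f0 andbT lerBlDr lerDl.
have DGabs x : (D x + G x = `|f x - g x|)%R.
  rewrite /D /G; have /orP[h|h] := le_total (f x) (g x).
    rewrite (elimT max_idPr) ?subr_le0// (elimT max_idPl) ?subr_ge0// add0r.
    by rewrite distrC ger0_norm// subr_ge0.
  rewrite (elimT max_idPl) ?subr_ge0// (elimT max_idPr) ?subr_le0//.
  by rewrite addr0 ger0_norm// subr_ge0.
have DGfg x : (f x + G x = g x + D x)%R.
  rewrite /D /G; have /orP[h|h] := le_total (f x) (g x).
    by rewrite (elimT max_idPl) ?subr_ge0// (elimT max_idPr) ?subr_le0//; lra.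
  by rewrite (elimT max_idPr) ?subr_le0// (elimT max_idPl) ?subr_ge0//; lra.
have iD : rho.-integrable setT (EFin \o D).
  apply: (@le_integrable _ _ _ _ _ measurableT _ (EFin \o f)) => //.
  - exact/measurable_EFinP.
  - by move=> x _ /=; rewrite lee_fin !ger0_norm.
  - exact: density_integrable af.
have iG : rho.-integrable setT (EFin \o G).
  apply: (@le_integrable _ _ _ _ _ measurableT _ (EFin \o g)) => //.
  - exact/measurable_EFinP.
  - move=> x _ /=; rewrite lee_fin !ger0_norm//.
    by rewrite ge_max g0 andbT lerBlDr lerDl.
  - exact: density_integrable bg.
pose tau := Rintegral rho setT G.
have tauG : \int[rho]_x (G x)%:E = tau%:E.
  by rewrite /tau /Rintegral fineK//; exact: (integrable_fin_num measurableT iG).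
have tau0 : (0 <= tau)%R by apply: Rintegral_ge0 => x _; exact: G0.
have h1 A : measurable A ->
    a A + \int[rho]_(x in A) (G x)%:E = b A + \int[rho]_(x in A) (D x)%:E.
  have mA (h : E -> R) : measurable_fun setT h ->
      measurable_fun A (fun x => (h x)%:E).
    by move=> mh; apply/measurable_EFinP; exact: measurable_funTS.
  have pA (h : E -> R) : (forall x, 0 <= h x)%R ->
      forall x, A x -> 0 <= (h x)%:E by move=> h0 x _; rewrite lee_fin.
  move=> mA'; rewrite afE// bgE//.
  have [mfA mgA mGA mDA] := And4 (mA f mf) (mA g mg) (mA G mG) (mA D mD).
  have [f0A g0A G0A D0A] := And4 (pA f f0) (pA g g0) (pA G G0) (pA D D0).
  rewrite -!ge0_integralD//.
  by apply: eq_integral => x _; rewrite -!EFinD DGfg.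
have tauD : \int[rho]_x (D x)%:E = tau%:E.
  have := h1 _ measurableT; rewrite !probability_setT tauG.
  have := integrable_fin_num measurableT iD; rewrite /comp.
  by case: (\int[rho]_x (D x)%:E) => // s _ [] /addrI ->.
have Xfin i : \int[rho]_x (`|f x - g x| * (coord i x) ^+ 2)%:E < +oo.
  apply: le_lt_trans (ltry u); apply: le_trans hu.
  rewrite (bigD1 i)//= leeDl// sume_ge0// => j _; apply: integral_ge0 => x _.
  by rewrite lee_fin mulr_ge0// sqr_ge0.
have mX2 i : measurable_fun [set: E] (fun x => coord i x ^+ 2)%R.
  by apply: measurable_funX; exact: measurable_coord.
have mGX i : measurable_fun [set: E] (fun x => (G x * (coord i x) ^+ 2)%:E).
  by apply/measurable_EFinP; exact: measurable_funM.
have mDX i : measurable_fun [set: E] (fun x => (D x * (coord i x) ^+ 2)%:E).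
  by apply/measurable_EFinP; exact: measurable_funM.
have GX0 i x : 0 <= (G x * (coord i x) ^+ 2)%:E.
  by rewrite lee_fin mulr_ge0// sqr_ge0.
have DX0 i x : 0 <= (D x * (coord i x) ^+ 2)%:E.
  by rewrite lee_fin mulr_ge0// sqr_ge0.
have DGX i : \int[rho]_x (`|f x - g x| * (coord i x) ^+ 2)%:E =
    \int[rho]_x (D x * (coord i x) ^+ 2)%:E + \int[rho]_x (G x * (coord i x) ^+ 2)%:E.
  rewrite -ge0_integralD//; apply: eq_integral => x _.
  by rewrite -EFinD -mulrDl DGabs.
(* Without excess there is nothing to normalize, but then [a] and [b] coincide. *)
have [tau_eq0|taun0] := eqVneq tau 0%R.
  have u0 : 0 <= u%:E.
    apply: le_trans hu; apply: sume_ge0 => i _; apply: integral_ge0 => x _.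
    by rewrite lee_fin mulr_ge0// sqr_ge0.
  apply: le_trans u0; apply: T2bar_self => A mA.
  have z (h : E -> R) : measurable_fun setT h -> (forall x, 0 <= h x)%R ->
      \int[rho]_x (h x)%:E = tau%:E -> \int[rho]_(x in A) (h x)%:E = 0.
    move=> mh h0 hE; apply/eqP; rewrite eq_le; apply/andP; split; last first.
      by apply: integral_ge0 => x _; rewrite lee_fin.
    rewrite -[leRHS]/(0%R%:E) -tau_eq0 -hE; apply: ge0_subset_integral => //.
    - exact/measurable_EFinP.
    - by move=> x _; rewrite lee_fin.
  by have := h1 A mA; rewrite (z G)// (z D)// !adde0.
have taup : (0 < tau)%R by rewrite lt_neqAle eq_sym taun0.
have [b' b'd] : exists b' : probability E R, density rho b' (fun x => G x / tau)%R.
  apply: exists_density.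
  - by apply: measurable_funM => //; exact: measurable_cst.
  - by move=> x; rewrite divr_ge0.
  - under eq_integral do rewrite mulrC EFinM.
    rewrite ge0_integralZl_EFin//; first by rewrite tauG -EFinM mulVf.
    + by move=> x _; rewrite lee_fin.
    + exact/measurable_EFinP.
    + by rewrite invr_ge0.
have b'int (h : E -> \bar R) : (forall x, 0 <= h x) -> measurable_fun setT h ->
    tau%:E * \int[b']_x h x = \int[rho]_x (h x * (G x)%:E).
  move=> h0 mh; rewrite (density_integral b'd)//.
  rewrite -ge0_integralZl_EFin//.
  - apply: eq_integral => x _; rewrite muleCA -EFinM; congr (_ * _%:E).
    by rewrite mulrC divfK.
  - by move=> x _; rewrite mule_ge0// lee_fin divr_ge0.
  - apply: emeasurable_funM => //; apply/measurable_EFinP.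
    by apply: measurable_funM => //; exact: measurable_cst.
have b'X i : tau%:E * \int[b']_x ((coord i x) ^+ 2)%:E =
    \int[rho]_x (G x * (coord i x) ^+ 2)%:E.
  rewrite b'int//; last exact: measurable_sqcoord.
    by apply: eq_integral => x _; rewrite muleC -EFinM.
  by move=> x; rewrite lee_fin sqr_ge0.
have b'2 : finite_second_moment b'.
  move=> i; have : tau%:E * \int[b']_x ((coord i x) ^+ 2)%:E < +oo.
    rewrite b'X; apply: le_lt_trans (Xfin i); rewrite DGX leeDr//.
    exact: integral_ge0.
  case: (\int[b']_x _) => [s _| |//]; first exact: ltry.
  by rewrite gt0_muley// lte_fin.
have [p pE] : exists p : R.-pker E ~> E, forall x A, measurable A -> p x A = b' A.
  by apply: (@exists_pkernel _ _ _ _ _ (fun _ => b')) => // x; exists b'.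
(* The fraction of the mass of [a] at [x] that is in excess. Where [f x] is zero so is [D x], and
   the default value of the inverse does no harm. *)
pose w x := (D x / f x)%R.
have wf x : (w x * f x = D x)%R.
  rewrite /w; have [fx0|?] := eqVneq (f x) 0%R; last by rewrite divfK.
  by rewrite fx0 mulr0; apply/esym/eqP; rewrite eq_le D0 -fx0 fD.
have w0 x : (0 <= w x)%R by rewrite divr_ge0.
have w1 x : (w x <= 1)%R.
  rewrite /w; have [->|fx0] := eqVneq (f x) 0%R; first by rewrite invr0 mulr0.
  by rewrite ler_pdivrMr ?mul1r// lt_neqAle eq_sym fx0 f0.
have mw : measurable_fun setT w.
  rewrite (_ : w = fun x => D x * f x `^ (-1))%R.
    by apply: measurable_funM => //; exact: (measurableT_comp (@measurable_powR R (-1)%R)).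
  by apply/funext => x; rewrite powR_inv1.
have [r [rE rs]] := exists_lazy_kernel p mw w0 w1.
have mwE : measurable_fun [set: E] (fun x => (w x)%:E) by exact/measurable_EFinP.
have abr : transports a b r.
  move=> A mA.
  have mdA : measurable_fun [set: E] (fun x => \d_x A : \bar R) by exact: measurable_fun_dirac.
  rewrite (eq_integral (fun x => (1 - w x)%:E * \d_x A + (w x)%:E * b' A)); last first.
    by move=> x _; rewrite rE// pE.
  have m1w : measurable_fun [set: E] (fun x => (1 - w x)%:E).
    by apply/measurable_EFinP; exact: measurable_funB.
  rewrite ge0_integralD//; last 4 first.
  - by move=> x _; rewrite mule_ge0// lee_fin subr_ge0.
  - exact: emeasurable_funM.
  - by move=> x _; rewrite mule_ge0// lee_fin.
  - by apply: emeasurable_funM => //; exact: measurable_cst.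
  rewrite ge0_integralZr//; last by move=> x _; rewrite lee_fin.
  have p1 x : 0 <= (1 - w x)%:E * \d_x A by rewrite mule_ge0// lee_fin subr_ge0.
  have mm1 : measurable_fun [set: E] (fun x => (1 - w x)%:E * \d_x A).
    exact: emeasurable_funM.
  rewrite !(density_integral af)//.
  under [X in _ + X * _]eq_integral do rewrite -EFinM wf.
  rewrite tauD.
  have -> : tau%:E * b' A = \int[rho]_(x in A) (G x)%:E.
    have i0 x : 0 <= (\1_A x)%:E :> \bar R by rewrite lee_fin.
    have mi : measurable_fun [set: E] (fun x => (\1_A x)%:E : \bar R).
      by apply/measurable_EFinP.
    have := b'int _ i0 mi; rewrite integral_indic// setIT => ->.
    rewrite [RHS]integral_mkcond; apply: eq_integral => x _.
    by rewrite patchE indicE; case: ifPn => xA; rewrite ?mul1e ?mul0e.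
  have -> : \int[rho]_x ((1 - w x)%:E * \d_x A * (f x)%:E) =
      \int[rho]_(x in A) (f x - D x)%:E.
    rewrite [RHS]integral_mkcond; apply: eq_integral => x _.
    rewrite patchE diracE; case: ifPn => xA; rewrite ?mule1 ?mule0 ?mul0e//.
    by rewrite -EFinM mulrBl mul1r wf.
  rewrite bgE// -ge0_integralD//; last 4 first.
  - by move=> x _; rewrite lee_fin subr_ge0.
  - by apply/measurable_EFinP; apply: measurable_funTS; exact: measurable_funB.
  - by move=> x _; rewrite lee_fin.
  - by apply/measurable_EFinP; exact: measurable_funTS.
  by apply: eq_integral => x _; rewrite -EFinD; congr EFin; have := DGfg x; lra.
have mE i : exists m : R, forall x, bary p i x = m.
  exists (Rintegral b' setT (coord i)) => x; rewrite /bary /Rintegral; congr fine.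
  by apply: eq_measure_integral => A mA _; exact: pE.
have pint x i : (p x).-integrable setT (EFin \o coord i).
  have /integrableP[mc bc] := integrable_coord i b'2.
  apply/integrableP; split => //.
  rewrite (eq_measure_integral b')// => A mA _; exact: pE.
(* Here w^2 f = w D <= D and (x - m)^2 <= 2 x^2 + 2 m^2. The remaining term tau m^2 is at most the
   integral of G x^2 by Jensen. The factor 2 cancels the 1/2 of the cost. *)
have cost i : \int[a]_x (sqdisp r i x)%:E <=
    2%:E * \int[rho]_x (`|f x - g x| * (coord i x) ^+ 2)%:E.
  have [m mEi] := mE i.
  have tm : (tau * m ^+ 2)%:E <= \int[rho]_x (G x * (coord i x) ^+ 2)%:E.
    rewrite -b'X EFinM lee_wpmul2l ?lee_fin//.
    have <- : Rintegral b' setT (coord i) = m.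
      rewrite -(mEi point) /bary /Rintegral; congr fine.
      by apply: eq_measure_integral => A mA _; exact/esym/pE.
    apply: sqr_Rintegral_le; first exact: probability_setT.
    exact: measurable_coord.
  have mDm : measurable_fun [set: E] (fun x => (D x * m ^+ 2)%:E).
    by apply/measurable_EFinP; apply: measurable_funM => //; exact: measurable_cst.
  have Dm0 x : 0 <= (D x * m ^+ 2)%:E by rewrite lee_fin mulr_ge0// sqr_ge0.
  rewrite (density_integral af); [|exact: EFin_sqdisp_ge0|exact: measurable_EFin_sqdisp].
  apply: (@le_trans _ _ (\int[rho]_x (2%:E * ((D x * (coord i x) ^+ 2)%:E + (D x * m ^+ 2)%:E)))).
    apply: ge0_le_integral => //.
    - by move=> x _; rewrite mule_ge0 ?EFin_sqdisp_ge0// lee_fin.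
    - apply: emeasurable_funM; first exact: measurable_EFin_sqdisp.
      exact/measurable_EFinP.
    - by apply: measurable_funeM; exact: emeasurable_funD.
    - move=> x _; rewrite rs; last by right.
      rewrite /sqdisp mEi -EFinD -!EFinM lee_fin.
      have -> : (w x ^+ 2 * (coord i x - m) ^+ 2 * f x =
          D x * (w x * (coord i x - m) ^+ 2))%R by rewrite -(wf x); ring.
      rewrite -mulrDr [leRHS]mulrCA; apply: ler_wpM2l => //.
      apply: (@le_trans _ _ ((coord i x - m) ^+ 2)%R).
        by rewrite ler_piMl// sqr_ge0.
      by have := sqr_ge0 (coord i x + m); lra.
  rewrite ge0_integralZl_EFin//; last 2 first.
  - by move=> x _; rewrite adde_ge0.
  - exact: emeasurable_funD.
  rewrite ge0_integralD// DGX lee_wpmul2l ?lee_fin// leeD2l//.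
  apply: le_trans tm.
  under eq_integral do rewrite mulrC EFinM.
  rewrite ge0_integralZl_EFin ?sqr_ge0//; last 2 first.
  - by move=> x _; rewrite lee_fin.
  - exact/measurable_EFinP.
  by rewrite tauD -EFinM mulrC.
apply: (le_trans (T2bar_le_sqdisp abr)); apply: le_trans hu.
apply: (@le_trans _ _ (2^-1%:E * \sum_(i < d)
    2%:E * \int[rho]_x (`|f x - g x| * (coord i x) ^+ 2)%:E)).
  by rewrite lee_wpmul2l ?lee_fin// lee_sum.
rewrite -ge0_sume_distrr; last first.
  by move=> i _; apply: integral_ge0 => x _; rewrite lee_fin mulr_ge0// sqr_ge0.
by rewrite muleA -EFinM mulVf// mul1e.
Qed.

End lazy_and_near.

(** * Tools for integrals and changes of density *)

Section integral_tools.
Context {disp : measure_display} {T : measurableType disp} {R : realType}.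
Implicit Types (a rho : probability T R).

(** Comparing positive and negative parts separately requires no integrability. *)
Lemma le_integral_measurable (m : {measure set T -> \bar R}) (f g : T -> \bar R) :
  measurable_fun setT f -> measurable_fun setT g -> (forall x, f x <= g x) ->
  \int[m]_x f x <= \int[m]_x g x.
Proof.
move=> mf mg fg; rewrite integralE [leRHS]integralE; apply: leeB.
- apply: ge0_le_integral => //; [exact: measurable_funepos|exact: measurable_funepos|].
  by move=> x _; rewrite !funeposE ge_max le_max fg/= le_max lexx orbT.
- apply: ge0_le_integral => //; [exact: measurable_funeneg|exact: measurable_funeneg|].
  by move=> x _; rewrite !funenegE ge_max le_max leeN2 fg/= le_max lexx orbT.
Qed.

(** Monotone convergence for truncations: [g n x] reaches [f x] at a finite index, so the limit of
    the [g n] need not be identified. *)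
Lemma integral_le_of_exhaustion (m : {measure set T -> \bar R}) (f : T -> R)
    (g : nat -> T -> R) (K : \bar R) :
  measurable_fun setT f -> (forall x, 0 <= f x)%R ->
  (forall n, measurable_fun setT (g n)) -> (forall n x, 0 <= g n x)%R ->
  (forall x, nondecreasing_seq (g ^~ x)) ->
  (forall x, exists n, f x <= g n x)%R ->
  (forall n, \int[m]_x (g n x)%:E <= K) -> \int[m]_x (f x)%:E <= K.
Proof.
move=> mf f0 mg g0 ndg fg gK.
have mgE n : measurable_fun setT (fun x => (g n x)%:E) by exact/measurable_EFinP.
have g0E n x : [set: T] x -> 0 <= (g n x)%:E by rewrite lee_fin.
have ndgE x : [set: T] x -> {homo (fun n => (g n x)%:E) : n k / (n <= k)%N >-> n <= k}.
  by move=> _ n k nk; rewrite lee_fin ndg.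
have cv : cvgn (fun n => \int[m]_x (g n x)%:E).
  apply: ereal_nondecreasing_is_cvgn => n k nk; apply: ge0_le_integral => //.
    by move=> x Tx; exact: g0E.
  by move=> x Tx; exact: (ndgE x Tx).
apply: (@le_trans _ _ (\int[m]_x limn (fun n => (g n x)%:E))).
  apply: ge0_le_integral => //.
  - by move=> x _; rewrite lee_fin.
  - exact/measurable_EFinP.
  - apply: (emeasurable_fun_cvg (fun n x => (g n x)%:E)) => // x _.
    by apply: ereal_nondecreasing_is_cvgn; exact: ndgE.
  - move=> x _; have [n fgn] := fg x; apply: (@le_trans _ _ (g n x)%:E).
      by rewrite lee_fin.
    rewrite (cvg_lim _ (ereal_nondecreasing_cvgn (ndgE x I)))//.
    by apply: ereal_sup_ubound; exists n.
rewrite monotone_convergence//; apply: lime_le => //; exact: nearW.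
Qed.

Lemma bounded_integrable a (f : T -> R) (B : R) :
  measurable_fun setT f -> (forall x, `|f x| <= B)%R ->
  a.-integrable setT (EFin \o f).
Proof.
move=> mf fB; apply/integrableP; split; first exact/measurable_EFinP.
apply: (@le_lt_trans _ _ (\int[a]_x B%:E)).
  apply: ge0_le_integral => //; last by move=> x _ /=; rewrite lee_fin.
  by apply: measurableT_comp => //; exact/measurable_EFinP.
by rewrite integral_cst// [X in _ * X]probability_setT mule1 ltry.
Qed.

Lemma density_integral_signed rho a (h : T -> R) (f : T -> \bar R) :
  density rho a h -> a.-integrable setT f ->
  \int[a]_x f x = \int[rho]_x (f x * (h x)%:E).
Proof.
move=> hd af; have ar := density_dominates hd.
rewrite -(Radon_Nikodym_change_of_variables ar measurableT af).
have mf := measurable_int _ af; case: (hd) => mh h0 _.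
apply: ae_eq_integral => //.
- by apply: emeasurable_funM => //; exact: measurable_int (Radon_Nikodym_integrable _).
- by apply: emeasurable_funM => //; exact/measurable_EFinP.
- by apply: ae_eqe_mul2l; apply: ae_eq_sym; exact: density_RN.
Qed.

Lemma density_Rintegral rho a (h f : T -> R) :
  density rho a h -> a.-integrable setT (EFin \o f) ->
  Rintegral a setT f = Rintegral rho setT (fun x => f x * h x)%R.
Proof.
move=> hd af; rewrite /Rintegral (density_integral_signed hd af).
by congr fine; apply: eq_integral => x _; rewrite -EFinM.
Qed.

Lemma measurable_lne_EFin (h : T -> R) : measurable_fun setT h ->
  measurable_fun setT (fun x => lne (h x)%:E).
Proof.
move=> mh; apply: measurable_fun_ifT => //.
  by apply: measurable_fun_ler => //; exact: measurable_cst.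
by apply/measurable_EFinP; apply: measurableT_comp => //; exact: measurable_ln.
Qed.

Lemma density_ae_eq rho a (h : T -> R) : density rho a h ->
  ae_eq a setT ('d (charge_of_finite_measure a) '/d rho) (EFin \o h).
Proof.
move=> hd; have [N [mN N0 sN]] := ae_eq_sym (density_RN hd).
by exists N; split => //; have /null_content_dominatesP := density_dominates hd; apply.
Qed.

End integral_tools.

(** * Entropy of bounded tilts *)

Section entropy.
Context {R : realType} {d : nat}.
Local Notation E := (Rd R d).
Implicit Types (mu nu : probability E R) (h : E -> R).

Lemma relative_entropy_density mu nu h : density mu nu h ->
  relative_entropy nu mu = \int[nu]_x lne (h x)%:E.
Proof.
move=> hd; have num := density_dominates hd; rewrite /relative_entropy asboolT//.
apply: ae_eq_integral => //.
- rewrite (_ : (fun x => _) = (fun x =>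
    lne (fine (('d (charge_of_finite_measure nu) '/d mu) x))%:E)).
    by apply: measurable_lne_EFin; apply: measurableT_comp.
  by apply/funext => x; rewrite fineK// Radon_Nikodym_fin_num.
- by apply: measurable_lne_EFin; case: hd.
- by have := density_ae_eq hd; apply: filterS => x /[apply] ->.
Qed.

(** One bound for [h] and its inverse makes [ln h] bounded. The condition does not mention a
    measure, so the same [h] tilts every component, with normalizing constants between [B^-1] and
    [B]. *)
Definition bounded_pos h :=
  measurable_fun setT h /\ exists B : R, (0 < B)%R /\ forall x, (B^-1 <= h x <= B)%R.

Lemma bounded_pos_gt0 h x : bounded_pos h -> (0 < h x)%R.
Proof.
by case=> _ [B [B0 /(_ x)/andP[+ _]]]; apply: lt_le_trans; rewrite invr_gt0.
Qed.

Lemma bounded_pos_integrable mu h : bounded_pos h -> mu.-integrable setT (EFin \o h).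
Proof.
move=> hb; case: (hb) => mh [B [B0 hB]]; apply: (@bounded_integrable _ _ _ _ _ B) => // x.
by rewrite gtr0_norm ?bounded_pos_gt0//; case/andP : (hB x).
Qed.

Lemma bounded_pos_ln h : bounded_pos h ->
  measurable_fun setT (fun x => ln (h x)) /\
  exists B, forall x, (`|ln (h x)| <= B)%R.
Proof.
move=> hb; case: (hb) => mh [B [B0 hB]]; split.
  by apply: measurableT_comp => //; exact: measurable_ln.
exists (ln B) => x; have /andP[h1 h2] := hB x; have h0 := bounded_pos_gt0 x hb.
rewrite ler_norml -lnV ?posrE// !ler_ln ?posrE ?invr_gt0//.
Qed.

Lemma bounded_pos_Z_gt0 mu h : bounded_pos h -> (0 < Rintegral mu setT h)%R.
Proof.
move=> hb; case: (hb) => mh [B [B0 hB]].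
apply: (@lt_le_trans _ _ B^-1%R); first by rewrite invr_gt0.
have -> : (B^-1 = Rintegral mu setT (fun=> B^-1))%R.
  rewrite Rintegral_cst// [X in fine X](_ : _ = 1) ?mulr1//.
  exact: probability_setT.
apply: le_Rintegral => //.
- by apply: (@bounded_integrable _ _ _ _ _ `|B^-1|%R) => //; exact: measurable_cst.
- exact: bounded_pos_integrable.
- by move=> x _; case/andP : (hB x).
Qed.

Lemma bounded_pos_entropy_integrable mu h : bounded_pos h ->
  mu.-integrable setT (EFin \o (fun x => h x * ln (h x))%R).
Proof.
move=> hb; case: (hb) => mh [B [B0 hB]]; have [ml [L hL]] := bounded_pos_ln hb.
apply: (@bounded_integrable _ _ _ _ _ (B * L)%R) => [|x]; first exact: measurable_funM.
rewrite normrM ler_pM// gtr0_norm ?bounded_pos_gt0//.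
by case/andP : (hB x).
Qed.

Lemma exists_tilt mu h : bounded_pos h ->
  exists nu, density mu nu (fun x => h x / Rintegral mu setT h)%R.
Proof.
move=> hb; have Z0 := bounded_pos_Z_gt0 mu hb; case: (hb) => mh _.
apply: exists_density.
- by apply: measurable_funM => //; exact: measurable_cst.
- by move=> x; rewrite divr_ge0// ltW// bounded_pos_gt0.
- under eq_integral do rewrite mulrC EFinM.
  rewrite integralZl//; last exact: bounded_pos_integrable.
  rewrite (_ : \int[mu]_x (h x)%:E = (Rintegral mu setT h)%:E).
    by rewrite -EFinM mulVf// gt_eqF.
  rewrite /Rintegral fineK//.
  exact: (integrable_fin_num measurableT (bounded_pos_integrable mu hb)).
Qed.

Lemma tilt_entropy mu nu h : bounded_pos h ->
  density mu nu (fun x => h x / Rintegral mu setT h)%R ->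
  relative_entropy nu mu =
  (Rintegral mu setT (fun x => h x * ln (h x)) / Rintegral mu setT h
    - ln (Rintegral mu setT h))%:E.
Proof.
move=> hb hd; set Z := Rintegral mu setT h.
have Z0 : (0 < Z)%R := bounded_pos_Z_gt0 mu hb.
rewrite (relative_entropy_density hd) -/Z.
have [ml [L hL]] := bounded_pos_ln hb.
have il : nu.-integrable setT (EFin \o (fun x => ln (h x))).
  exact: bounded_integrable hL.
have ic : nu.-integrable setT (EFin \o (fun=> ln Z)).
  by apply: (@bounded_integrable _ _ _ _ _ `|ln Z|%R) => //; exact: measurable_cst.
under eq_integral.
  move=> x _; rewrite lne_EFin ?divr_gt0 ?bounded_pos_gt0//.
  rewrite ln_div ?posrE ?bounded_pos_gt0//.
  over.
rewrite /= integralB_EFin// integral_cst// [X in _ * X]probability_setT mule1.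
rewrite -(fineK (integrable_fin_num measurableT il)) -EFinB; congr ((_ - _)%:E)%R.
transitivity (Rintegral nu setT (fun x => ln (h x))) => //.
rewrite (density_Rintegral hd)//.
have ih := bounded_pos_entropy_integrable mu hb.
rewrite -RintegralZr//; apply: eq_Rintegral => x _.
by rewrite mulrA [(ln _ * _)%R]mulrC.
Qed.

End entropy.

(** * Moments implied by the transport inequality *)

Section T2minus_consequences.
Context {R : realType} {d : nat}.
Local Notation E := (Rd R d).
Implicit Types (mu nu : probability E R) (h : E -> R) (i : 'I_d).

Lemma measurable_enorm : measurable_fun setT (@enorm R d : E -> R).
Proof.
apply: (measurableT_comp (f := @Num.sqrt R)).
  by apply: continuous_measurable_fun; exact: sqrt_continuous.
by apply: measurable_sum => i; apply: measurable_funX; exact: measurable_coord.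
Qed.

Lemma normr_coord_le_enorm i (x : E) : (`|coord i x| <= enorm x)%R.
Proof.
rewrite -sqrtr_sqr ler_wsqrtr// (bigD1 i)//= lerDl.
by apply: sumr_ge0 => j _; exact: sqr_ge0.
Qed.

Lemma P1_integrable_coord mu i : P1 mu -> mu.-integrable setT (EFin \o coord i).
Proof.
move=> mu1; apply/integrableP; split.
  by apply/measurable_EFinP; exact: measurable_coord.
apply: le_lt_trans mu1; apply: ge0_le_integral => //.
- by apply: measurableT_comp => //; apply/measurable_EFinP; exact: measurable_coord.
- by apply/measurable_EFinP; exact: measurable_enorm.
- by move=> x _ /=; rewrite lee_fin normr_coord_le_enorm.
Qed.

Lemma P1_density rho mu h (B : R) : (forall x, h x <= B)%R ->
  density rho mu h -> P1 rho -> P1 mu.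
Proof.
move=> hB hd; have [mh h0 _] := hd; rewrite /P1 => rho1.
have mE : measurable_fun [set: E] (fun x => (enorm x)%:E).
  by apply/measurable_EFinP; exact: measurable_enorm.
have E0 (x : E) : 0 <= (enorm x)%:E by rewrite lee_fin sqrtr_ge0.
have B0 : (0 <= B)%R by apply: le_trans (hB point).
rewrite (density_integral hd)//.
apply: (@le_lt_trans _ _ (\int[rho]_x (B%:E * (enorm x)%:E))).
  apply: ge0_le_integral => //.
  - by move=> x _; rewrite mule_ge0// lee_fin.
  - by apply: emeasurable_funM => //; exact/measurable_EFinP.
  - exact: measurable_funeM.
  - by move=> x _; rewrite muleC lee_wpmul2r// lee_fin.
rewrite ge0_integralZl_EFin//; first by rewrite lte_mul_pinfty ?lee_fin.
Qed.

Lemma T2minus_tilt mu nu h (C : R) : T2minus_with mu C -> bounded_pos h ->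
  density mu nu (fun x => h x / Rintegral mu setT h)%R ->
  T2bar mu nu <=
  (C * (Rintegral mu setT (fun x => h x * ln (h x)) / Rintegral mu setT h
    - ln (Rintegral mu setT h)))%:E.
Proof.
move=> [C0 mu1 muC] hb hd; rewrite EFinM -(tilt_entropy hb hd).
have Z0 := bounded_pos_Z_gt0 mu hb; have [_ [B [B0 hB]]] := hb.
apply: muC.
apply: (@P1_density mu nu _ (B / Rintegral mu setT h)%R _ hd mu1) => x.
by rewrite ler_pM2r ?invr_gt0//; case/andP : (hB x).
Qed.

(* Apply the inequality to the tilts by exp (min `|x_i| n). The entropy of a tilt
   is linear in the mean of the exponent, and a displacement t is at most
   t ^ 2 / (2 C) + C / 2, so that the means cancel and the normalizing constants
   are bounded uniformly in n. *)
Lemma T2minus_exp_moment mu (C : R) i : T2minus_with mu C ->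
  \int[mu]_x (expR `|coord i x|)%:E < +oo.
Proof.
move=> muT; have [C0 mu1 muC] := muT.
have mX : measurable_fun [set: E] (fun x => `|coord i x|)%R.
  by apply: measurableT_comp => //; exact: measurable_coord.
have iX := P1_integrable_coord i mu1.
pose a := Rintegral mu setT (fun x => `|coord i x|%R).
have aE : \int[mu]_x `|coord i x|%:E = a%:E.
  rewrite /a /Rintegral fineK//; apply: (integrable_fin_num measurableT).
  exact: integrable_norm iX.
pose u (n : nat) (x : E) := Num.min `|coord i x|%R n%:R.
have u0 n x : (0 <= u n x)%R by rewrite le_min normr_ge0 ler0n.
have mu_ n : measurable_fun [set: E] (u n).
  by apply: measurable_minr => //; exact: measurable_cst.
(* The 1 is the slack [C] of a near-optimal kernel divided by [C], the term C / 2 comes from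
   bounding the displacement by its square, and [a] is the mean of the absolute coordinate under the
   target [mu]. *)
pose K := expR (1 + C / 2 + a)%R.
suff : \int[mu]_x (expR `|coord i x|)%:E <= K%:E.
  by move=> h; apply: le_lt_trans h (ltry _).
apply: (@integral_le_of_exhaustion _ _ _ _ _ (fun n x => expR (u n x))).
- by apply: measurableT_comp => //; exact: measurable_expR.
- by move=> x; rewrite expR_ge0.
- by move=> n; apply: measurableT_comp => //; exact: measurable_expR.
- by move=> n x; rewrite expR_ge0.
- move=> x n m nm; rewrite ler_expR /u le_min ge_min lexx/= ge_min.
  by rewrite ler_nat nm orbT.
- move=> x; exists (Num.truncn `|coord i x|).+1.
  rewrite ler_expR le_min lexx/= ltW//.
  by have /truncn_itv/andP[] : (0 <= `|coord i x|)%R by [].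
move=> n; pose h x := expR (u n x).
have hb : bounded_pos h.
  split; first by apply: measurableT_comp => //; exact: measurable_expR.
  exists (expR n%:R); split; first exact: expR_gt0.
  move=> x; rewrite -expRN !ler_expR ge_min lexx orbT andbT.
  by rewrite (le_trans _ (u0 n x))// oppr_le0.
have Z0 := bounded_pos_Z_gt0 mu hb.
set Z := Rintegral mu setT h in Z0.
have ZE : \int[mu]_x (h x)%:E = Z%:E.
  rewrite /Z /Rintegral fineK//.
  exact: (integrable_fin_num measurableT (bounded_pos_integrable mu hb)).
rewrite ZE lee_fin.
have [nu hd] := exists_tilt mu hb.
have := T2minus_tilt muT hb hd.
have hlnE : Rintegral mu setT (fun x => h x * ln (h x))%R =
    Rintegral mu setT (fun x => u n x * h x)%R.
  by apply: eq_Rintegral => x _; rewrite /h expRK mulrC.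
have iu : nu.-integrable setT (EFin \o u n).
  apply: (@bounded_integrable _ _ _ _ _ n%:R) => // x.
  by rewrite ger0_norm// ge_min lexx orbT.
have Unu : (Rintegral mu setT (fun x => h x * ln (h x)) / Z)%R =
    Rintegral nu setT (u n).
  rewrite hlnE (density_Rintegral hd)// -RintegralZr//.
    by apply: eq_Rintegral => x _; rewrite mulrA.
  have := bounded_pos_entropy_integrable mu hb.
  by apply: eq_integrable => // x _; rewrite /= /h expRK mulrC.
rewrite Unu -/Z; set e := Rintegral nu setT (u n).
have eE : \int[nu]_x (u n x)%:E = e%:E.
  by rewrite /e /Rintegral fineK//; exact: (integrable_fin_num measurableT iu).
move=> /(T2bar_le_transports) => /(_ _ C0)[p pnu hp].
have sqE : \int[nu]_x (sqdisp p i x)%:E <= (2 * (C * (e - ln Z) + C))%:E.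
  have I0 j : 0 <= \int[nu]_x (sqdisp p j x)%:E.
    by apply: integral_ge0 => x _; exact: EFin_sqdisp_ge0.
  rewrite EFinM -lee_pdivrMl//; apply: le_trans hp.
  by rewrite lee_wpmul2l ?lee_fin// (bigD1 i)//= leeDl// sume_ge0.
have mpX : measurable_fun [set: E] (fun x => \int[p x]_y `|coord i y|%:E).
  by apply: measurable_integral_pkernel; exact/measurable_EFinP.
have key : e%:E <= ((2 * C)^-1)%:E * \int[nu]_x (sqdisp p i x)%:E +
    (C / 2)%:E + a%:E.
  rewrite -eE -aE (integral_bind pnu)//; last exact/measurable_EFinP.
  have -> : (C / 2)%:E = \int[nu]_x (cst (C / 2)%:E x).
    by rewrite integral_cst// [X in _ * X]probability_setT mule1.
  have C2 : (0 <= (2 * C)^-1)%R by rewrite invr_ge0 mulr_ge0// ltW.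
  have ms := measurable_EFin_sqdisp p i.
  have s0 x : [set: E] x -> 0 <= (sqdisp p i x)%:E by rewrite lee_fin sqr_ge0.
  have q0 x : [set: E] x -> 0 <= \int[p x]_y `|coord i y|%:E by move=> _; exact: integral_ge0.
  have c0 x : [set: E] x -> 0 <= cst (C / 2)%:E x by rewrite lee_fin divr_ge0// ltW.
  have s0' x : [set: E] x -> 0 <= ((2 * C)^-1)%:E * (sqdisp p i x)%:E.
    by move=> Tx; rewrite mule_ge0// s0.
  have ms' : measurable_fun [set: E] (fun x => ((2 * C)^-1)%:E * (sqdisp p i x)%:E).
    exact: measurable_funeM.
  have s0'' x : [set: E] x -> 0 <= ((2 * C)^-1)%:E * (sqdisp p i x)%:E + cst (C / 2)%:E x.
    by move=> Tx; rewrite adde_ge0// ?s0'// c0.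
  have ms'' : measurable_fun [set: E] (fun x =>
      ((2 * C)^-1)%:E * (sqdisp p i x)%:E + cst (C / 2)%:E x).
    by apply: emeasurable_funD => //; exact: measurable_cst.
  rewrite -ge0_integralZl_EFin// -ge0_integralD// -ge0_integralD//.
  apply: ae_ge0_le_integral => //.
  - by move=> x _; rewrite lee_fin.
  - exact/measurable_EFinP.
  - by move=> x Tx; rewrite adde_ge0// ?s0''// q0.
  - exact: emeasurable_funD.
  have := bind_integrable_ae pnu iX; apply: filterS => x ix _.
  have bx : `|bary p i x|%:E <= \int[p x]_y `|coord i y|%:E.
    rewrite (_ : \int[p x]_y _ = (Rintegral (p x) setT (fun y => `|coord i y|%R))%:E).
      by rewrite lee_fin; exact: le_normr_Rintegral.
    rewrite /Rintegral fineK//; apply: (integrable_fin_num measurableT).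
    exact: integrable_norm ix.
  apply: (@le_trans _ _ (((2 * C)^-1)%:E * (sqdisp p i x)%:E + cst (C / 2)%:E x +
      `|bary p i x|%:E)); last by rewrite leeD2l.
  rewrite -EFinM -!EFinD lee_fin /sqdisp.
  apply: (@le_trans _ _ `|coord i x|%R); first by rewrite ge_min lexx.
  apply: (@le_trans _ _ (`|coord i x - bary p i x| + `|bary p i x|)%R).
    by rewrite -[in leLHS](subrK (bary p i x) (coord i x)) ler_normD.
  rewrite lerD2r (_ : (coord i x - bary p i x) ^+ 2 =
      `|coord i x - bary p i x| ^+ 2)%R; last by rewrite -normrX ger0_norm// sqr_ge0.
  set t := `|_|%R.
  have : (0 <= (2 * C)^-1 * (t - C) ^+ 2)%R by rewrite mulr_ge0// sqr_ge0.
  rewrite (_ : (2 * C)^-1 * (t - C) ^+ 2 = (2 * C)^-1 * t ^+ 2 + C / 2 - t)%R.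
    by rewrite subr_ge0.
  by field; lra.
have key2 : (e <= (2 * C)^-1 * (2 * (C * (e - ln Z) + C)) + C / 2 + a)%R.
  rewrite -lee_fin; apply: le_trans key _; rewrite !EFinD leeD2r// leeD2r//.
  by rewrite EFinM lee_wpmul2l// lee_fin invr_ge0 mulr_ge0// ltW.
have lnZ : (ln Z <= 1 + C / 2 + a)%R.
  move: key2; rewrite (_ : (2 * C)^-1 * (2 * (C * (e - ln Z) + C)) = e - ln Z + 1)%R.
    by lra.
  by field; lra.
by rewrite -[Z]lnK ?posrE// ler_expR.
Qed.

(** From t / 4 <= exp (t / 4). Fourth moments put the squared coordinates in L^2, where they pair
    with the square-integrable densities of the components. *)
Lemma T2minus_moment4 mu (C : R) i : T2minus_with mu C ->
  \int[mu]_x ((coord i x) ^+ 4)%:E < +oo.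
Proof.
move=> muT; have := T2minus_exp_moment i muT => h.
have mc := @measurable_coord R d i.
apply: (@le_lt_trans _ _ (\int[mu]_x ((4 ^+ 4)%:E * (expR `|coord i x|)%:E))).
  apply: ge0_le_integral => //.
  - by move=> x _; rewrite lee_fin exprn_even_ge0.
  - by apply/measurable_EFinP; exact: measurable_funX.
  - apply: measurable_funeM; apply/measurable_EFinP; apply: measurableT_comp.
      exact: measurable_expR.
    exact: measurableT_comp.
  - move=> x _; rewrite -EFinM lee_fin.
    set t := `|coord i x|%R; have t0 : (0 <= t)%R by exact: normr_ge0.
    have -> : (coord i x ^+ 4 = t ^+ 4)%R by rewrite /t -normrX ger0_norm// exprn_even_ge0.
    have {1}-> : (t = 4 * (t / 4))%R by rewrite mulrC divfK.
    have -> : (expR t = expR (t / 4) ^+ 4)%R by rewrite -expRM_natl mulrC divfK.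
    rewrite exprMn ler_pM2l ?exprn_gt0// lerXn2r ?nnegrE ?expR_ge0 ?divr_ge0//.
    by apply: le_trans (expR_ge1Dx _); rewrite lerDr.
rewrite ge0_integralZl_EFin//.
- by rewrite lte_mul_pinfty ?lee_fin.
- apply/measurable_EFinP; apply: measurableT_comp; first exact: measurable_expR.
  exact: measurableT_comp.
Qed.

End T2minus_consequences.

(** * Square-integrable functions *)

Section square_integrable.
Context {disp : measure_display} {T : measurableType disp} {R : realType}.
Variable rho : probability T R.
Implicit Types f g : T -> R.

Definition square_integrable f :=
  measurable_fun setT f /\ \int[rho]_x ((f x) ^+ 2)%:E < +oo.

Lemma square_integrable_sqr f : square_integrable f ->
  rho.-integrable setT (EFin \o (fun x => f x ^+ 2)%R).
Proof.
move=> [mf foo]; apply/integrableP; split.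
  by apply/measurable_EFinP; exact: measurable_funX.
by under eq_integral do rewrite /= ger0_norm ?sqr_ge0//.
Qed.

Lemma square_integrableM f g : square_integrable f -> square_integrable g ->
  rho.-integrable setT (EFin \o (fun x => f x * g x)%R).
Proof.
move=> f2 g2; have [mf _] := f2; have [mg _] := g2.
apply: (@le_integrable _ _ _ _ _ measurableT _ (fun x => (f x ^+ 2 + g x ^+ 2)%:E)).
- by apply/measurable_EFinP; exact: measurable_funM.
- move=> x _ /=; rewrite lee_fin [leRHS]ger0_norm ?addr_ge0 ?sqr_ge0//.
  rewrite ler_norml; have := sqr_ge0 (f x + g x); have := sqr_ge0 (f x - g x).
  have := sqr_ge0 (f x); have := sqr_ge0 (g x).
  by move=> *; apply/andP; split; lra.
- by under eq_fun do rewrite EFinD; apply: integrableD => //; exact: square_integrable_sqr.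
Qed.

Lemma square_integrableD f g : square_integrable f -> square_integrable g ->
  square_integrable (fun x => f x + g x)%R.
Proof.
move=> f2 g2; have [mf foo] := f2; have [mg goo] := g2; split.
  exact: measurable_funD.
have i : rho.-integrable setT (fun x => (2 * f x ^+ 2 + 2 * g x ^+ 2)%:E).
  under eq_fun do rewrite EFinD !EFinM.
  apply: integrableD => //; apply: integrableZl => //; exact: square_integrable_sqr.
have /integrableP[_] : rho.-integrable setT (EFin \o (fun x => (f x + g x) ^+ 2)%R).
  apply: le_integrable i => //.
    by apply/measurable_EFinP; apply: measurable_funX; exact: measurable_funD.
  move=> x _ /=; rewrite lee_fin ger0_norm ?sqr_ge0//.
  have f0 := sqr_ge0 (f x); have g0 := sqr_ge0 (g x).
  rewrite ger0_norm; last by rewrite addr_ge0// mulr_ge0.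
  by have := sqr_ge0 (f x - g x); lra.
rewrite (eq_integral (fun x => ((f x + g x) ^+ 2)%:E))// => x _.
by rewrite /= ger0_norm// sqr_ge0.
Qed.

Lemma square_integrable_cst (c : R) : square_integrable (fun=> c).
Proof.
split; first exact: measurable_cst.
by rewrite integral_cst// [X in _ * X]probability_setT mule1 ltry.
Qed.

Lemma square_integrableZ f (c : R) : square_integrable f ->
  square_integrable (fun x => c * f x)%R.
Proof.
move=> [mf foo]; split; first by apply: measurable_funM => //; exact: measurable_cst.
under eq_integral do rewrite exprMn EFinM.
rewrite ge0_integralZl_EFin ?sqr_ge0//.
- by rewrite lte_mul_pinfty ?lee_fin ?sqr_ge0.
- by move=> x _; rewrite lee_fin sqr_ge0.
- by apply/measurable_EFinP; exact: measurable_funX.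
Qed.

Lemma square_integrableB f g : square_integrable f -> square_integrable g ->
  square_integrable (fun x => f x - g x)%R.
Proof.
move=> f2 /(square_integrableZ (-1)) g2.
have := square_integrableD f2 g2.
by under eq_fun do rewrite mulN1r.
Qed.

Lemma square_integrable_sum n (F : nat -> T -> R) :
  (forall k, square_integrable (F k)) ->
  square_integrable (fun x => \sum_(k < n) F k x)%R.
Proof.
move=> F2; elim: n => [|n ih].
  under eq_fun do rewrite big_ord0; exact: square_integrable_cst.
under eq_fun do rewrite big_ord_recr/=.
exact: square_integrableD.
Qed.

End square_integrable.

(** * Chi-square and entropy between components *)

Section chi_square.
Context {R : realType} {d : nat}.
Local Notation E := (Rd R d).
Implicit Types (mu nu rho : probability E R) (i : 'I_d).

(** Expanding (g - 1)^2 for a density g, which has mean one, shows that the chi-square divergence is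
    the integral of g^2 minus one. *)
Lemma chi2_density mu1 mu2 (M : R) : chi2 mu1 mu2 <= M%:E ->
  exists2 g : E -> R, density mu2 mu1 g &
    \int[mu2]_x ((g x) ^+ 2)%:E <= (1 + M)%:E.
Proof.
rewrite /chi2; case: asboolP => // mu12 hM.
have [g gd] := dominates_density mu12; exists g => //.
have [mg g0 _] := gd.
have gRN := density_RN gd.
have E1 : \int[mu2]_x (('d (charge_of_finite_measure mu1) '/d mu2) x - 1) ^+ 2 =
    \int[mu2]_x ((g x - 1) ^+ 2)%:E.
  have RNE x : ('d (charge_of_finite_measure mu1) '/d mu2) x =
      (fine (('d (charge_of_finite_measure mu1) '/d mu2) x))%:E.
    by rewrite fineK// Radon_Nikodym_fin_num.
  under eq_integral do rewrite RNE -EFinB -EFin_expe.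
  apply: ae_eq_integral => //.
  - apply/measurable_EFinP; apply: measurable_funX; apply: measurable_funB => //.
    exact: measurableT_comp.
  - by apply/measurable_EFinP; apply: measurable_funX; exact: measurable_funB.
  - by move: gRN; apply: filterS => x /[apply] <-.
rewrite E1 in hM.
have mg1 : measurable_fun setT (fun x => g x - 1)%R by exact: measurable_funB.
have g12 : square_integrable mu2 (fun x => g x - 1)%R.
  by split => //; apply: le_lt_trans hM (ltry _).
have gi := density_integrable gd.
have g1 : \int[mu2]_x (g x)%:E = 1.
  by case: gd => _ _ <-//; exact: probability_setT.
have -> : \int[mu2]_x ((g x) ^+ 2)%:E =
    \int[mu2]_x (((g x - 1) ^+ 2)%:E + (2 * (g x) - 1)%:E).
  by apply: eq_integral => x _; rewrite -EFinD; congr EFin; ring.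
have i2 : mu2.-integrable setT (fun x => (2 * g x)%:E).
  by under eq_fun do rewrite EFinM; exact: integrableZl.
have i1 : mu2.-integrable setT (fun x => 1%R%:E : \bar R).
  by apply: (@bounded_integrable _ _ _ _ (fun=> 1%R) 1%R) => // x; rewrite normr1.
have i21 : mu2.-integrable setT (fun x => (2 * g x - 1)%:E).
  by under eq_fun do rewrite EFinB; exact: integrableB.
rewrite integralD//; last exact: square_integrable_sqr.
have -> : \int[mu2]_x (2 * g x - 1)%:E = 1.
  rewrite integralB_EFin// integral_cst// [X in _ * X]probability_setT mule1.
  under eq_integral do rewrite EFinM.
  by rewrite integralZl// g1 mule1 -EFinB; congr EFin; ring.
by rewrite addeC EFinD leeD2l.
Qed.

(** Jensen for the logarithm under [mu1], where the mean of [g] is the integral of g^2 under [mu2].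
    It takes the form of the tangent at a = 1 + M: ln g <= g / a + ln a - 1. *)
Lemma relative_entropy_le_ln mu1 mu2 (g : E -> R) (M : R) : (0 <= M)%R ->
  density mu2 mu1 g -> \int[mu2]_x ((g x) ^+ 2)%:E <= (1 + M)%:E ->
  relative_entropy mu1 mu2 <= (ln (1 + M))%:E.
Proof.
move=> M0 gd gM; have [mg g0 _] := gd; rewrite (relative_entropy_density gd).
set a := (1 + M)%R; have a0 : (0 < a)%R by rewrite ltr_pwDl.
have gi : \int[mu1]_x (g x)%:E <= a%:E.
  have mgE : measurable_fun [set: E] (fun x => (g x)%:E) by exact/measurable_EFinP.
  rewrite (density_integral gd)// (eq_integral (fun x => (g x ^+ 2)%:E))//.
have ig : mu1.-integrable setT (EFin \o g).
  apply/integrableP; split; first exact/measurable_EFinP.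
  under eq_integral do rewrite /= ger0_norm//.
  exact: le_lt_trans gi (ltry _).
apply: (@le_trans _ _ (\int[mu1]_x (a^-1 * g x + (ln a - 1))%:E)).
  apply: le_integral_measurable.
  - exact: measurable_lne_EFin.
  - apply/measurable_EFinP; apply: measurable_funD => //.
    by apply: measurable_funM => //; exact: measurable_cst.
  - move=> x; have [gx0|gx0] := leP (g x) 0%R; first by rewrite le0_lneNy ?lee_fin ?leNye.
    rewrite lne_EFin// lee_fin.
    have q0 : (0 < a^-1 * g x)%R by rewrite mulr_gt0 ?invr_gt0.
    have -> : (ln (g x) = ln (a^-1 * g x) + ln a)%R.
      by rewrite -lnM ?posrE// mulrC mulrA mulfV ?mul1r// gt_eqF.
    have : (ln (1 + (a^-1 * g x - 1)) <= a^-1 * g x - 1)%R.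
      by apply: le_ln1Dx; rewrite ltrBrDr addNr.
    by rewrite subrKC; lra.
have ic : mu1.-integrable setT (fun x => (ln a - 1)%:E).
  by apply: (@bounded_integrable _ _ _ _ (fun=> ln a - 1) `|ln a - 1|)%R => //; exact: measurable_cst.
have iag : mu1.-integrable setT (fun x => (a^-1 * g x)%:E).
  by under eq_fun do rewrite EFinM; exact: integrableZl.
under eq_integral do rewrite EFinD.
rewrite integralD// integral_cst// [X in _ * X]probability_setT mule1.
under eq_integral do rewrite EFinM.
rewrite integralZl//.
apply: (@le_trans _ _ (a^-1%:E * a%:E + (ln a - 1)%:E)).
  by rewrite leeD2r// lee_wpmul2l// lee_fin invr_ge0 ltW.
by rewrite -EFinM -EFinD lee_fin mulVf ?gt_eqF//; lra.
Qed.

End chi_square.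

(** * Empirical approximation of the density of the mixture *)

Section mixture_integrals.
Context {disp disp' : measure_display} {Theta : measurableType disp}
  {T : measurableType disp'} {R : realType}.
Variables (m : probability Theta R) (mu : Theta -> probability T R).
Hypothesis mmu : forall A, measurable A ->
  measurable_fun [set: Theta] (fun theta => mu theta A).
Local Notation mix := (mixture m mmu : probability T R).

Lemma mixture_bind A : measurable A ->
  \int[m]_theta (kernel_of mmu : R.-pker Theta ~> T) theta A = mix A.
Proof. by []. Qed.

Lemma integral_mixture (f : T -> \bar R) : (forall x, 0 <= f x) ->
  measurable_fun setT f ->
  \int[mix]_x f x = \int[m]_theta \int[mu theta]_x f x.
Proof. exact: (integral_bind mixture_bind). Qed.

(** Otherwise the excess over the mean would be an everywhere positive function of [theta] with zero
    integral. This selects the next point in Maurey's argument. *)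
Lemma exists_Rintegral_le_mixture (f : T -> R) :
  mix.-integrable setT (EFin \o f) ->
  exists theta, (Rintegral (mu theta) setT f <= Rintegral mix setT f)%R.
Proof.
move=> fi; apply: contrapT => /forallNP h.
set c := Rintegral mix setT f in h.
have iG := bind_Rintegrable mixture_bind fi.
have EG := bind_Rintegral mixture_bind fi.
pose G theta := (Rintegral (mu theta) setT f - c)%R.
have G0 theta : (0 < G theta)%R by rewrite subr_gt0 ltNge; exact/negP/h.
have ic : m.-integrable setT (EFin \o (fun=> c)).
  by apply: (@bounded_integrable _ _ _ _ _ `|c|%R) => //; exact: measurable_cst.
have iGc : m.-integrable setT (EFin \o G).
  rewrite (_ : EFin \o G = (EFin \o (fun theta => Rintegral (mu theta) setT f))
    \- (EFin \o (fun=> c))); first exact: integrableB.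
  by apply/funext => theta /=; rewrite EFinB.
have mG := measurable_int _ iGc.
have int0 : \int[m]_theta `|(EFin \o G) theta| = 0.
  under eq_integral do rewrite gee0_abs ?lee_fin ?ltW//.
  rewrite integralB_EFin// integral_cst// [X in _ * X]probability_setT mule1.
  have := EG; rewrite {1}/Rintegral -/c => cE.
  have -> : \int[m]_theta (Rintegral (mu theta) setT f)%:E = c%:E.
    rewrite [c]EG [in RHS]/Rintegral fineK//.
    exact: (integrable_fin_num measurableT iG).
  by rewrite -EFinB subrr.
have [N [mN N0 sN]] := (ae_eq_integral_abs m measurableT mG).1 int0.
have : [set: Theta] `<=` N.
  move=> theta _; apply: sN => /(_ I) /= [] G0'.
  by have := G0 theta; rewrite G0' ltxx.
rewrite subTset => NT; move: N0; rewrite NT.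
rewrite [X in X = _](_ : _ = 1); last exact: probability_setT.
by move=> /eqP; rewrite eqe oner_eq0.
Qed.

Variables (rho : probability T R) (g : Theta -> T -> R) (gbar : T -> R) (V : R).
Hypothesis gd : forall theta, density rho (mu theta) (g theta).
Hypothesis gV : forall theta, \int[rho]_x ((g theta x) ^+ 2)%:E <= V%:E.
Hypothesis gbard : density rho mix gbar.

Let g2 theta : square_integrable rho (g theta).
Proof.
split; first by case: (gd theta).
exact: le_lt_trans (gV theta) (ltry _).
Qed.

(** Duality avoids any measurability of [g] jointly in theta and x. For a truncation f of [gbar],
    the integral I of f^2 is at most the integral of f under the mixture, hence at most the mean
    over theta of the integrals of f g_theta. Each of these is at most I / 2 + V / 2, so I <= V. *)
Lemma mixture_density_sqr : \int[rho]_x ((gbar x) ^+ 2)%:E <= V%:E.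
Proof.
have [mg g0 _] := gbard.
pose f (n : nat) x := Num.min (gbar x) n%:R.
have f0 n x : (0 <= f n x)%R by rewrite le_min g0 ler0n.
have mf n : measurable_fun setT (f n).
  by apply: measurable_minr => //; exact: measurable_cst.
apply: (@integral_le_of_exhaustion _ _ _ _ _ (fun n x => f n x ^+ 2)%R).
- exact: measurable_funX.
- by move=> x; exact: sqr_ge0.
- by move=> n; exact: measurable_funX.
- by move=> n x; exact: sqr_ge0.
- move=> x n k nk; rewrite lerXn2r ?nnegrE// le_min ge_min lexx/= ge_min.
  by rewrite ler_nat nk orbT.
- move=> x; exists (Num.truncn (gbar x)).+1.
  rewrite lerXn2r ?nnegrE// le_min lexx/= ltW//.
  by have /truncn_itv/andP[] := g0 x.
move=> n.
have f2 : square_integrable rho (f n).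
  split => //; apply: (@le_lt_trans _ _ (\int[rho]_x (n%:R ^+ 2)%:E)).
    apply: ge0_le_integral => //.
    - by move=> x _; rewrite lee_fin sqr_ge0.
    - by apply/measurable_EFinP; exact: measurable_funX.
    - move=> x _; rewrite lee_fin lerXn2r ?nnegrE//.
      by rewrite ge_min lexx orbT.
  by rewrite integral_cst// [X in _ * X]probability_setT mule1 ltry.
have if2 := square_integrable_sqr f2.
set I := \int[rho]_x (f n x ^+ 2)%:E.
have If : I \is a fin_num by exact: (integrable_fin_num measurableT if2).
have h1 : I <= \int[mix]_x (f n x)%:E.
  rewrite (density_integral gbard); last 2 first.
  - by move=> x; rewrite lee_fin.
  - exact/measurable_EFinP.
  apply: ge0_le_integral => //.
  - by move=> x _; rewrite lee_fin sqr_ge0.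
  - by apply/measurable_EFinP; exact: measurable_funX.
  - by apply: emeasurable_funM; exact/measurable_EFinP.
  - move=> x _; rewrite -EFinM lee_fin expr2 ler_wpM2l//.
    by rewrite ge_min lexx.
have h2 theta : \int[mu theta]_x (f n x)%:E <= 2^-1%:E * I + (2^-1 * V)%:E.
  have [mgt gt0 _] := gd theta.
  rewrite (density_integral (gd theta)); last 2 first.
  - by move=> x; rewrite lee_fin.
  - exact/measurable_EFinP.
  rewrite EFinM; apply: (@le_trans _ _ (2^-1%:E * I +
      2^-1%:E * \int[rho]_x ((g theta x) ^+ 2)%:E)); last first.
    by rewrite leeD2l// lee_wpmul2l ?lee_fin.
  have mf2 : measurable_fun setT (fun x => (f n x ^+ 2)%:E).
    by apply/measurable_EFinP; exact: measurable_funX.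
  have mg2 : measurable_fun setT (fun x => (g theta x ^+ 2)%:E).
    by apply/measurable_EFinP; exact: measurable_funX.
  have p1 x : [set: T] x -> 0 <= (f n x ^+ 2)%:E by rewrite lee_fin sqr_ge0.
  have p2 x : [set: T] x -> 0 <= (g theta x ^+ 2)%:E by rewrite lee_fin sqr_ge0.
  have p1' x : [set: T] x -> 0 <= 2^-1%:E * (f n x ^+ 2)%:E.
    by move=> Tx; rewrite mule_ge0// p1.
  have p2' x : [set: T] x -> 0 <= 2^-1%:E * (g theta x ^+ 2)%:E.
    by move=> Tx; rewrite mule_ge0// p2.
  have mf2' : measurable_fun setT (fun x => 2^-1%:E * (f n x ^+ 2)%:E).
    exact: measurable_funeM.
  have mg2' : measurable_fun setT (fun x => 2^-1%:E * (g theta x ^+ 2)%:E).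
    exact: measurable_funeM.
  rewrite /I -!ge0_integralZl_EFin// -ge0_integralD//.
  apply: ge0_le_integral => //.
  - by move=> x _; rewrite mule_ge0 ?lee_fin.
  - by apply: emeasurable_funM; exact/measurable_EFinP.
  - exact: emeasurable_funD.
  - move=> x _; rewrite -!EFinM -EFinD lee_fin.
    by have := sqr_ge0 (f n x - g theta x); lra.
have h3 : I <= 2^-1%:E * I + (2^-1 * V)%:E.
  apply: (le_trans h1); rewrite integral_mixture; last 2 first.
  - by move=> x; rewrite lee_fin.
  - exact/measurable_EFinP.
  apply: (@le_trans _ _ (\int[m]_theta (2^-1%:E * I + (2^-1 * V)%:E))).
    apply: le_integral_measurable => //.
      by apply: (measurable_integral_pkernel (kernel_of mmu : R.-pker _ ~> _)); exact/measurable_EFinP.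
  by rewrite integral_cst// [X in _ * X]probability_setT mule1.
move: h3; rewrite -(fineK If) -EFinM -EFinD !lee_fin; lra.
Qed.

Let gbar2 : square_integrable rho gbar.
Proof.
by split; [case: gbard|exact: le_lt_trans mixture_density_sqr (ltry _)].
Qed.

(* Maurey's argument: the next point is chosen so that its deviation makes a
   nonpositive scalar product with the deviation accumulated so far. *)
Lemma exists_empirical_deviation n : exists theta : nat -> Theta,
  \int[rho]_x ((\sum_(k < n) (g (theta k) x - gbar x)) ^+ 2)%:E <=
  (n%:R * (4 * V))%:E.
Proof.
elim: n => [|n [th ih]].
  exists (fun _ => point); under eq_integral do rewrite big_ord0 expr0n.
  by rewrite integral0 mul0r.
pose S x := (\sum_(k < n) (g (th k) x - gbar x))%R.
have D2 theta : square_integrable rho (fun x => g theta x - gbar x)%R.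
  exact: square_integrableB.
have S2 : square_integrable rho S.
  exact: (@square_integrable_sum _ _ _ rho n (fun k x => g (th k) x - gbar x)%R).
have [mS _] := S2.
have Sint a (h : T -> R) : density rho a h -> square_integrable rho h ->
    a.-integrable setT (EFin \o S).
  move=> hd h2; have [mh h0 _] := hd; apply/integrableP; split; first exact/measurable_EFinP.
  rewrite (density_integral hd)//; last by apply: measurableT_comp => //; exact/measurable_EFinP.
  have /integrableP[_] := square_integrableM S2 h2.
  rewrite (eq_integral (fun x => `|(EFin \o S) x| * (h x)%:E))// => x _ /=.
  by rewrite -EFinM normrM [`|h x|%R]ger0_norm.
have [t tle] := exists_Rintegral_le_mixture (Sint _ _ gbard gbar2).
rewrite (density_Rintegral (gd t) (Sint _ _ (gd t) (g2 t))) in tle.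
rewrite (density_Rintegral gbard (Sint _ _ gbard gbar2)) in tle.
have i1 := square_integrableM S2 (g2 t).
have i2 := square_integrableM S2 gbar2.
pose th' k := if (k < n)%N then th k else t; exists th'.
pose D x := (g t x - gbar x)%R.
have SE x : (\sum_(k < n.+1) (g (th' k) x - gbar x) = S x + D x)%R.
  rewrite big_ord_recr/= /th' ltnn; congr (_ + _)%R.
  by apply: eq_bigr => k _; rewrite ltn_ord.
have iD := square_integrable_sqr (D2 t).
have iS := square_integrable_sqr S2.
have iSD : rho.-integrable setT (EFin \o (fun x => 2 * (S x * D x))%R).
  rewrite (_ : _ \o _ = (fun x => 2%:E * (EFin \o (fun x => S x * D x)%R) x)).
    by apply: integrableZl => //; exact: square_integrableM S2 (D2 t).
  by apply/funext => x /=; rewrite EFinM.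
have iSSD : rho.-integrable setT (EFin \o (fun x => S x ^+ 2 + 2 * (S x * D x))%R).
  rewrite (_ : _ \o _ = (EFin \o (fun x => S x ^+ 2)%R) \+
    (EFin \o (fun x => 2 * (S x * D x))%R)); first exact: integrableD.
  by apply/funext => x /=; rewrite EFinD.
have -> : \int[rho]_x ((\sum_(k < n.+1) (g (th' k) x - gbar x)) ^+ 2)%:E =
   \int[rho]_x (S x ^+ 2)%:E + \int[rho]_x (2 * (S x * D x))%:E + \int[rho]_x (D x ^+ 2)%:E.
  rewrite -integralD_EFin// -integralD//; apply: eq_integral => x _.
  by rewrite SE -EFinD/=; congr EFin; ring.
have hSD : \int[rho]_x (2 * (S x * D x))%:E <= 0.
  have -> : \int[rho]_x (2 * (S x * D x))%:E =
      (2 * (Rintegral rho setT (fun x => S x * g t x) -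
        Rintegral rho setT (fun x => S x * gbar x)))%:E.
    rewrite -RintegralB// -RintegralZl//.
      rewrite /Rintegral fineK.
        by apply: eq_integral => x _; rewrite /D mulrBr.
      apply: (integrable_fin_num measurableT).
      by apply: eq_integrable iSD => // x _; rewrite /= /D mulrBr.
    apply: eq_integrable (square_integrableM S2 (D2 t)) => // x _.
    by rewrite /= mulrBr.
  by rewrite lee_fin pmulr_rle0// subr_le0.
(* The factor 4 comes from (g - gbar)^2 <= 2 g^2 + 2 gbar^2, where both squares have integral at
   most [V]. *)
have hD : \int[rho]_x (D x ^+ 2)%:E <= (4 * V)%:E.
  have ig2 := square_integrable_sqr (g2 t); have ib2 := square_integrable_sqr gbar2.
  apply: (@le_trans _ _ (\int[rho]_x (2 * (g t x ^+ 2) + 2 * (gbar x ^+ 2))%:E)).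
    have [mgt _] := g2 t; have [mgb _] := gbar2.
    apply: le_integral_measurable.
    - by apply/measurable_EFinP; apply: measurable_funX; exact: measurable_funB.
    - by apply/measurable_EFinP; apply: measurable_funD; apply: measurable_funM;
        by [exact: measurable_cst|exact: measurable_funX].
    - move=> x; rewrite lee_fin /D; have := sqr_ge0 (g t x + gbar x); lra.
  under eq_integral do rewrite EFinD !EFinM.
  rewrite integralD//; [|exact: integrableZl|exact: integrableZl].
  rewrite !integralZl//.
  apply: (@le_trans _ _ (2%:E * V%:E + 2%:E * V%:E)).
    apply: leeD; rewrite lee_wpmul2l ?lee_fin//.
      exact: gV.
    exact: mixture_density_sqr.
  by rewrite -!EFinM -EFinD lee_fin; lra.
have -> : (n.+1%:R * (4 * V))%:E = (n%:R * (4 * V))%:E + (4 * V)%:E.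
  by rewrite -EFinD -natr1 mulrDl mul1r.
apply: leeD => //.
by rewrite -[leRHS]adde0; apply: leeD.
Qed.

(** Cauchy-Schwarz in the form y w <= (t y^2 + w^2 / t) / 2, applied to the empirical deviation y,
    whose square has integral at most 4 V / n. *)
Lemma exists_empirical_mean (w : T -> R) (e : R) : square_integrable rho w ->
  (forall x, 0 <= w x)%R -> (0 < e)%R ->
  exists n (theta : nat -> Theta), (0 < n)%N /\
  \int[rho]_x (`|(\sum_(k < n) n%:R^-1 * g (theta k) x) - gbar x| * w x)%:E <= e%:E.
Proof.
move=> w2 w0 e0; have [mw wfin] := w2.
have V0 : (0 <= V)%R.
  rewrite -lee_fin; apply: le_trans (gV point).
  by apply: integral_ge0 => x _; rewrite lee_fin sqr_ge0.
have iw := square_integrable_sqr w2.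
pose W := fine (\int[rho]_x ((w x) ^+ 2)%:E).
have WE : \int[rho]_x ((w x) ^+ 2)%:E = W%:E.
  by rewrite /W fineK//; exact: (integrable_fin_num measurableT iw).
have W0 : (0 <= W)%R.
  by rewrite -lee_fin -WE; apply: integral_ge0 => x _; rewrite lee_fin sqr_ge0.
(* This makes W / t at most [e], the added 1 keeping [t] positive; then [n] makes 4 V t / n at most
   [e]. Each enters with a factor 1/2. *)
pose t := ((W + 1) / e)%R; have t0 : (0 < t)%R by rewrite divr_gt0// ltr_wpDl.
pose n := (Num.truncn (4 * V * t / e)).+1.
have nV : (4 * V * t / e < n%:R)%R.
  have : (0 <= 4 * V * t / e)%R.
    by rewrite divr_ge0 ?(ltW e0)// mulr_ge0 ?(ltW t0)// mulr_ge0.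
  by move=> /truncn_itv/andP[].
have [th hth] := exists_empirical_deviation n.
exists n, th; split => //.
pose S x := (\sum_(k < n) (g (th k) x - gbar x))%R.
have S2 : square_integrable rho S.
  apply: (@square_integrable_sum _ _ _ rho n (fun k x => g (th k) x - gbar x)%R) => k.
  exact: square_integrableB.
have [mS _] := S2.
have DE x : ((\sum_(k < n) n%:R^-1 * g (th k) x) - gbar x = n%:R^-1 * S x)%R.
  rewrite /S sumrB sumr_const card_ord mulrBr -mulr_sumr; congr (_ - _)%R.
  by rewrite -[X in (_ = _ * X)%R]mulr_natl mulKf// gt_eqF.
pose a := (2^-1 * t / n%:R ^+ 2)%R; pose b := (2^-1 / t)%R.
have a0 : (0 <= a)%R by rewrite /a divr_ge0 ?sqr_ge0// mulr_ge0 ?(ltW t0)// invr_ge0.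
have b0 : (0 <= b)%R by rewrite /b divr_ge0 ?(ltW t0)// invr_ge0.
have mS2 : measurable_fun setT (fun x => (S x ^+ 2)%:E).
  by apply/measurable_EFinP; exact: measurable_funX.
have mw2 : measurable_fun setT (fun x => (w x ^+ 2)%:E).
  by apply/measurable_EFinP; exact: measurable_funX.
have pS x : [set: T] x -> 0 <= (S x ^+ 2)%:E by rewrite lee_fin sqr_ge0.
have pw x : [set: T] x -> 0 <= (w x ^+ 2)%:E by rewrite lee_fin sqr_ge0.
apply: (@le_trans _ _ (\int[rho]_x (a%:E * (S x ^+ 2)%:E + b%:E * (w x ^+ 2)%:E))).
  apply: le_integral_measurable.
  - rewrite (_ : (fun x => _) = (fun x => (`|n%:R^-1 * S x| * w x)%:E)); last first.
      by apply/funext => x; rewrite DE.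
    apply/measurable_EFinP; apply: measurable_funM => //.
    apply: measurableT_comp => //; exact: measurable_funM.
  - by apply: emeasurable_funD; exact: measurable_funeM.
  - move=> x; rewrite DE -!EFinM -EFinD lee_fin.
    set y := (n%:R^-1 * S x)%R.
    have -> : (a * S x ^+ 2 = 2^-1 * t * `|y| ^+ 2)%R.
      rewrite /a /y -normrX ger0_norm ?sqr_ge0// exprMn exprVn; ring.
    have : (0 <= 2^-1 * t^-1 * (t * `|y| - w x) ^+ 2)%R.
      by rewrite mulr_ge0 ?sqr_ge0// mulr_ge0// invr_ge0 ltW.
    rewrite (_ : _ * (_ - _) ^+ 2 = 2^-1 * t * `|y| ^+ 2 + b * w x ^+ 2 - `|y| * w x)%R.
      by rewrite subr_ge0.
    by rewrite /b; field; rewrite gt_eqF.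
rewrite ge0_integralD//; last 4 first.
- by move=> x Tx; rewrite mule_ge0// pS.
- exact: measurable_funeM.
- by move=> x Tx; rewrite mule_ge0// pw.
- exact: measurable_funeM.
rewrite !ge0_integralZl_EFin// WE.
apply: (@le_trans _ _ (a%:E * (n%:R * (4 * V))%:E + b%:E * W%:E)).
  by rewrite leeD2r// lee_wpmul2l.
rewrite -!EFinM -EFinD lee_fin.
have h1 : (a * (n%:R * (4 * V)) <= e / 2)%R.
  have -> : (a * (n%:R * (4 * V)) = 2^-1 * ((4 * V * t) / n%:R))%R.
    by rewrite /a; field; rewrite gt_eqF.
  have : ((4 * V * t) / n%:R <= e)%R.
    by move: nV; rewrite ltr_pdivrMr// ler_pdivrMr// [(n%:R * e)%R]mulrC => /ltW.
  by lra.
have h2 : (b * W <= e / 2)%R.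
  have -> : (b * W = 2^-1 * (W / t))%R by rewrite /b; ring.
  have : (W / t <= e)%R.
    by rewrite ler_pdivrMr// /t mulrC divfK ?gt_eqF// lerDl.
  by lra.
lra.
Qed.

End mixture_integrals.

(** * The inequality for bounded tilts of finite mixtures *)

Section finite_mixture_inequality.
Context {R : realType} {d : nat}.
Local Notation E := (Rd R d).
Implicit Types (mu nu : probability E R) (h : E -> R) (i : 'I_d).

(** With t = sqrt z, the bound ln t >= 1 - 1 / t gives (t - 1)^2 <= z ln z - z + 1. For z >= 1 the
    left side is (t - 1)^2 (1 + 1 / t)^2 with 1 + 1 / t <= 2; for z <= 1 it vanishes. *)
Lemma marton_le (z : R) : (0 < z)%R ->
  (z * (Num.max (1 - z^-1) 0) ^+ 2 <= 4 * (z * ln z - z + 1))%R.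
Proof.
move=> z0; pose t := Num.sqrt z.
have t0 : (0 < t)%R by rewrite sqrtr_gt0.
have zt : (z = t ^+ 2)%R by rewrite sqr_sqrtr// ltW.
have lnt : (1 - t^-1 <= ln t)%R.
  have : (ln (1 + (t^-1 - 1)) <= t^-1 - 1)%R.
    by apply: le_ln1Dx; rewrite ltrBrDr addNr invr_gt0.
  by rewrite subrKC lnV ?posrE//; lra.
have zlnz : ((t - 1) ^+ 2 <= z * ln z - z + 1)%R.
  have -> : (ln z = 2 * ln t)%R by rewrite zt lnXn// mulr_natl.
  have : (t ^+ 2 * (1 - t^-1) <= t ^+ 2 * ln t)%R by rewrite ler_pM2l ?exprn_gt0.
  rewrite (_ : t ^+ 2 * (1 - t^-1) = t ^+ 2 - t)%R; last by field; rewrite gt_eqF.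
  by rewrite zt; lra.
apply: (@le_trans _ _ (4 * (t - 1) ^+ 2)%R); last by rewrite ler_pM2l.
have [z1|z1] := leP z 1%R.
  have -> : (Num.max (1 - z^-1) 0 = 0)%R.
    by apply/max_idPr; rewrite subr_le0 invf_ge1.
  by rewrite expr0n mulr0 mulr_ge0// sqr_ge0.
have t1 : (1 <= t)%R by rewrite -[leLHS]sqrtr1 ler_wsqrtr// ltW.
have -> : (Num.max (1 - z^-1) 0 = 1 - z^-1)%R.
  by apply/max_idPl; rewrite subr_ge0 invf_le1// ltW.
have -> : (z * (1 - z^-1) ^+ 2 = (t - 1) ^+ 2 * ((t + 1) ^+ 2 / t ^+ 2))%R.
  by rewrite zt; field; rewrite gt_eqF.
rewrite mulrC ler_wpM2r ?sqr_ge0// ler_pdivrMr ?exprn_gt0//.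
have : (0 <= (t - 1) * (3 * t + 1))%R by rewrite mulr_ge0 ?subr_ge0//; lra.
lra.
Qed.

Lemma T2minus_second_moment mu (C : R) : T2minus_with mu C -> finite_second_moment mu.
Proof.
move=> muT i; have h4 := T2minus_moment4 i muT.
have mc := @measurable_coord R d i.
have x22 : square_integrable mu (fun x => coord i x ^+ 2)%R.
  split; first exact: measurable_funX.
  by rewrite (eq_integral (fun x => (coord i x ^+ 4)%:E))// => x _; rewrite -exprM.
have [ms _] := x22.
have := sqr_integrable (probability_setT mu) ms x22.2 => /integrableP[_].
rewrite (eq_integral (fun x => (coord i x ^+ 2)%:E))// => x _.
by rewrite /= ger0_norm ?sqr_ge0.
Qed.

Lemma T2bar_finite_mixture n (c : nat -> R) (mu_ : nat -> probability E R) mu nu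
    h (C L : R) : (0 <= L)%R -> (forall k, (0 <= c k)%R) ->
  mixes n c (fun k => mu_ k) mu -> (forall k, T2minus_with (mu_ k) C) ->
  (forall j k, T2bar (mu_ j) (mu_ k) <= (C * L)%:E) -> bounded_pos h ->
  density mu nu (fun x => h x / Rintegral mu setT h)%R ->
  T2bar mu nu <= (C * (2 + 4 * L) *
    (Rintegral mu setT (fun x => h x * ln (h x)) / Rintegral mu setT h
      - ln (Rintegral mu setT h)))%:E.
Proof.
move=> L0 c0 mm muT muL hb hd.
have C0 : (0 < C)%R by have [] := muT 0%N.
have mu2 k : finite_second_moment (mu_ k) by exact: T2minus_second_moment.
have c1 := mixes_sum1 mm.
have [mh _] := hb.
have h0 x := bounded_pos_gt0 x hb.
set Z := Rintegral mu setT h in hd *.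
set e := Rintegral mu setT (fun x => h x * ln (h x))%R.
have Z0 : (0 < Z)%R := bounded_pos_Z_gt0 mu hb.
pose Zk k := Rintegral (mu_ k) setT h.
have Zk0 k : (0 < Zk k)%R by exact: bounded_pos_Z_gt0.
pose ek k := Rintegral (mu_ k) setT (fun x => h x * ln (h x))%R.
have ZE : (Z = \sum_(k < n) c k * Zk k)%R.
  by apply: (mixes_Rintegral c0 mm) => // k _; right; exact: bounded_pos_integrable.
have eE : (e = \sum_(k < n) c k * ek k)%R.
  apply: (mixes_Rintegral c0 mm) => [|k _]; last first.
    by right; exact: bounded_pos_entropy_integrable.
  by apply: measurable_funM => //; have [] := bounded_pos_ln hb.
pose z k := (Zk k / Z)%R.
have z0 k : (0 < z k)%R by rewrite divr_gt0.
(* mu' below is the mixture with the weights cz of the tilt; B is the relative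
   entropy of these weights with respect to c. *)
pose cz k := (c k * z k)%R.
have cz0 k : (0 <= cz k)%R by rewrite mulr_ge0// ltW.
have cz1 : (\sum_(k < n) cz k = 1)%R.
  rewrite /cz /z; under eq_bigr do rewrite mulrA.
  by rewrite -mulr_suml -ZE divff// gt_eqF.
have fE k A : measurable A -> mu_ k A = (fine (mu_ k A))%:E.
  by move=> mA; rewrite fineK// fin_num_measure.
have [nu_ nud] := choice (fun k => exists_tilt (mu_ k) hb).
have nuM : mixes n cz (fun k => nu_ k) nu.
  move=> A mA.
  have key (m1 m2 : probability E R) (Y : R) : (0 < Y)%R ->
      density m1 m2 (fun x => h x / Y)%R ->
      Y%:E * m2 A = \int[m1]_x (h x * \1_A x)%:E.
    move=> Y0 [_ _ ->]//.
    rewrite integral_mkcond -ge0_integralZl_EFin ?ltW//.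
    - apply: eq_integral => x _; rewrite patchE indicE.
      case: ifPn => xA; rewrite ?mulr1 ?mulr0 ?mule0//.
      by rewrite -EFinM mulrC divfK// gt_eqF.
    - by move=> x _; rewrite patchE; case: ifPn => // _; rewrite lee_fin divr_ge0// ltW.
    - apply/(measurable_restrictT _ _).1 => //; apply/measurable_EFinP.
      by apply: measurable_funTS; apply: measurable_funM => //; exact: measurable_cst.
  have nuA := key _ _ _ Z0 hd.
  have nukA k := key _ _ _ (Zk0 k) (nud k).
  have : Z%:E * nu A = Z%:E * \sum_(k < n) (cz k)%:E * nu_ k A.
    rewrite nuA (mixes_integral c0 mm); last 2 first.
    - by move=> x; rewrite lee_fin mulr_ge0// ltW.
    - by apply/measurable_EFinP; apply: measurable_funM.
    rewrite ge0_sume_distrr; last by move=> k _; rewrite mule_ge0// lee_fin.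
    apply: eq_bigr => k _; rewrite -nukA !muleA -!EFinM; congr (_%:E * _).
    by rewrite /cz /z; field; rewrite gt_eqF.
  move/(congr1 (fun y => Z^-1%:E * y)); rewrite !muleA -EFinM mulVf ?gt_eqF//.
  by rewrite !mul1e.
have [mu' mu'M] := exists_mixture (m_ := fun k => mu_ k) cz0
  (fun k => probability_setT (mu_ k)) cz1.
pose B := (\sum_(k < n) cz k * ln (z k))%R.
have T1 : T2bar mu' nu <= (C * ((e / Z - ln Z) - B))%:E.
  have := T2bar_mixes cz0 nuM mu'M mu2 (fun k _ => T2minus_tilt (muT k) hb (nud k)).
  rewrite (_ : (\sum_(k < n) _)%R = C * ((e / Z - ln Z) - B))%R//.
  rewrite (eq_bigr (fun k : 'I_n => C * (c k * ek k / Z - cz k * ln Z - cz k * ln (z k))))%R.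
    by rewrite -mulr_sumr !sumrB -!mulr_suml -eE cz1 mul1r.
  move=> k _; rewrite -/(Zk k) -/(ek k).
  have -> : (ln (Zk k) = ln Z + ln (z k))%R.
    by rewrite -lnM ?posrE// /z [(Z * _)%R]mulrC divfK// gt_eqF.
  by rewrite /cz /z; field; rewrite !gt_eqF.
(* Component k gives up the fraction p k of its mass, spread over the components
   with a deficit q in proportion to the deficit. *)
pose q k : R := Num.max (1 - z k)%R 0%R.
pose p k : R := Num.max (1 - (z k)^-1)%R 0%R.
have q0 k : (0 <= q k)%R by rewrite le_max lexx orbT.
have p0 k : (0 <= p k)%R by rewrite le_max lexx orbT.
have p1 k : (p k <= 1)%R by rewrite ge_max ler01 andbT lerBlDr lerDl invr_ge0 ltW.
(* Surplus minus deficit of one component. Its mean under [c] is zero, so that surplus and deficit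
   have the same total [tau]. *)
have zpq k : (z k * p k - q k = z k - 1)%R.
  have z1 : (z k * (z k)^-1 = 1)%R by rewrite divff// gt_eqF.
  rewrite /p /q; have /orP[h1|h1] := le_total (z k) 1%R.
    rewrite (elimT max_idPr); last by rewrite subr_le0 invf_ge1.
    by rewrite (elimT max_idPl) ?subr_ge0//; lra.
  rewrite (elimT max_idPl); last by rewrite subr_ge0 invf_le1.
  by rewrite (elimT max_idPr) ?subr_le0//; lra.
pose tau := (\sum_(k < n) c k * q k)%R.
have tau0 : (0 <= tau)%R by apply: sumr_ge0 => k _; rewrite mulr_ge0.
have tauE : (\sum_(k < n) cz k * p k = tau)%R.
  have : (\sum_(k < n) (cz k * p k - c k * q k) = 0)%R.
    rewrite (eq_bigr (fun k : 'I_n => cz k - c k)%R).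
      by rewrite sumrB cz1 c1 subrr.
    by move=> k _; rewrite /cz -mulrA -mulrBr zpq; ring.
  by rewrite sumrB => /subr0_eq.
(* If there is no deficit then nothing moves, and any weights of sum one will do. *)
pose b k := if tau == 0%R then c k else (c k * q k / tau)%R.
have b0 k : (0 <= b k)%R by rewrite /b; case: ifP => // _; rewrite divr_ge0// mulr_ge0.
have b1 : (\sum_(k < n) b k = 1)%R.
  rewrite /b; have [//|tn0] := eqVneq tau 0%R.
  by rewrite -mulr_suml divff.
have taub k : (k < n)%N -> (tau * b k = c k * q k)%R.
  move=> kn; rewrite /b; have [t0|tn0] := eqVneq tau 0%R; last first.
    by rewrite mulrC divfK.
  rewrite t0 mul0r; apply/esym.
  have pos (j : 'I_n) : true -> (0 <= c j * q j)%R by rewrite mulr_ge0.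
  have t0' : (\sum_(j < n) c j * q j = 0)%R := t0.
  exact: (@psumr_eq0P _ _ _ _ pos t0' (Ordinal kn) isT).
have [beta betaM] := exists_mixture (m_ := fun k => mu_ k) b0
  (fun k => probability_setT (mu_ k)) b1.
have beta2 : finite_second_moment beta by exact: mixes_second_moment b0 betaM mu2.
(* Joint convexity, with [mu_ k] written as a mixture of copies of itself. *)
have Tb k : T2bar beta (mu_ k) <= (C * L)%:E.
  have := @T2bar_mixes _ _ n b (fun _ => mu_ k) mu_ (mu_ k) beta (fun _ => C * L)%R b0.
  rewrite -mulr_suml b1 mul1r; apply => //.
  move=> A mA; rewrite -ge0_sume_distrl; last by move=> j _; rewrite lee_fin.
  by rewrite sumEFin b1 mul1e.
have gk k : exists g : probability E R, forall A, measurable A ->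
    g A = (1 - p k)%:E * mu_ k A + (p k)%:E * beta A.
  pose w (j : nat) : R := if j is 0 then (1 - p k)%R else p k.
  pose m_ : nat -> {measure set E -> \bar R} := fun j => if j is 0 then mu_ k else beta.
  have w0 j : (0 <= w j)%R by case: j => //=; rewrite subr_ge0.
  have m1 j : m_ j setT = 1 by case: j => [|j] /=; exact: probability_setT.
  have w1 : (\sum_(j < 2) w j = 1)%R by rewrite !big_ord_recl big_ord0 /= addr0 subrK.
  have [g gM] := exists_mixture w0 m1 w1; exists g => A mA.
  by rewrite gM// !big_ord_recl big_ord0 /= adde0.
have [gam gamE] := choice gk.
have gam2 k : finite_second_moment (gam k).
  move=> i.
  pose w (j : nat) : R := if j is 0 then (1 - p k)%R else p k.
  pose m_ : nat -> probability E R := fun j => if j is 0 then mu_ k else beta.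
  have w0 j : (0 <= w j)%R by case: j => //=; rewrite subr_ge0.
  apply: (@mixes_second_moment _ _ 2 w m_ (gam k) w0) => [A mA|[|j]]; last 2 first.
  - exact: mu2.
  - exact: beta2.
  rewrite !big_ord_recl big_ord0 /= adde0; exact: gamE.
have Tg k : T2bar (gam k) (mu_ k) <= (p k ^+ 2 * (C * L))%:E.
  by apply: (@T2bar_lazy _ _ (mu_ k) beta) => //; rewrite ?p0 ?p1//; exact: gamE.
(* The surplus removed from the weights [cz] fills exactly the deficits, which restores the weights
   [c]. *)
have gamM : mixes n cz (fun k => gam k) mu.
  move=> A mA.
  transitivity (\sum_(k < n) (c k * fine (mu_ k A))%:E).
    by rewrite mm//; apply: eq_bigr => k _; rewrite EFinM -fE.
  have betaE : beta A = (\sum_(k < n) b k * fine (mu_ k A))%:E.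
    by rewrite betaM// -sumEFin; apply: eq_bigr => k _; rewrite EFinM -fE.
  apply/esym; rewrite (eq_bigr (fun k : 'I_n => (cz k * (1 - p k) * fine (mu_ k A) +
      (cz k * p k) * \sum_(j < n) b j * fine (mu_ j A))%:E))%R; last first.
    move=> k _.
    have gE : gam k A = ((1 - p k) * fine (mu_ k A) +
        p k * \sum_(j < n) b j * fine (mu_ j A))%:E%R.
      by rewrite gamE// betaE fE.
    transitivity ((cz k)%:E * ((1 - p k) * fine (mu_ k A) +
        p k * \sum_(j < n) b j * fine (mu_ j A))%:E%R).
      exact: (congr1 (fun y => (cz k)%:E * y) gE).
    by rewrite -EFinM mulrDr !mulrA.
  rewrite !sumEFin; congr EFin; rewrite big_split/= -mulr_suml tauE mulr_sumr.
  rewrite -big_split/=; apply: eq_bigr => k _.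
  rewrite mulrA taub// -mulrDl; congr (_ * _)%R.
  rewrite /cz; have := zpq k; nra.
have T2 : T2bar mu mu' <= (4 * C * L * B)%:E.
  have := T2bar_mixes cz0 mu'M gamM gam2 (fun k _ => Tg k).
  move=> /le_trans; apply; rewrite lee_fin.
  (* The terms [c k - cz k] sum to zero, so adding them makes [marton_le] applicable term by term
     without changing the total 4 C L B. *)
  apply: (@le_trans _ _ (\sum_(k < n) C * L * (4 * (cz k * ln (z k) - cz k + c k)))%R).
    apply: ler_sum => k _; rewrite /cz.
    have := marton_le (z0 k); rewrite -/(p k) => hm.
    have -> : (c k * z k * (p k ^+ 2 * (C * L)) = C * L * c k * (z k * p k ^+ 2))%R by ring.
    have -> : (C * L * (4 * (c k * z k * ln (z k) - c k * z k + c k)) =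
      C * L * c k * (4 * (z k * ln (z k) - z k + 1)))%R by ring.
    by apply: ler_wpM2l => //; rewrite !mulr_ge0// ltW.
  rewrite -!mulr_sumr big_split/= sumrB cz1 c1 -/B; lra.
have B0 : (0 <= B)%R.
  have : (0 <= \sum_(k < n) (4 * (cz k * ln (z k) - cz k + c k)))%R.
    apply: sumr_ge0 => k _; rewrite /cz.
    have -> : (4 * (c k * z k * ln (z k) - c k * z k + c k) =
      c k * (4 * (z k * ln (z k) - z k + 1)))%R by ring.
    apply: mulr_ge0 => //; apply: le_trans (marton_le (z0 k)).
    by rewrite mulr_ge0 ?sqr_ge0// ltW.
  rewrite -!mulr_sumr big_split/= sumrB cz1 c1 -/B; lra.
have mu'2 : finite_second_moment mu' by exact: mixes_second_moment cz0 mu'M mu2.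
have mu_2 : finite_second_moment mu by exact: mixes_second_moment c0 mm mu2.
(* Up to the factor C, the coefficient of B is 4 L (1 + 1 / s) - (1 + s), nonpositive once 4 L <= s.
   The added 1 keeps [s] positive when L = 0. *)
pose s := (4 * L + 1)%R; have s0 : (0 < s)%R by rewrite /s; lra.
have := T2bar_triangle s0 mu'2 mu_2 T1 T2.
move=> /le_trans; apply; rewrite lee_fin.
have h1 : (4 * L * (1 + s^-1) <= 1 + s)%R.
  apply: (@le_trans _ _ (s * (1 + s^-1)))%R.
    by rewrite ler_wpM2r ?addr_ge0 ?invr_ge0 ?ltW// /s; lra.
  by rewrite mulrDr mulr1 divff ?gt_eqF// addrC.
have h2 : (C * B * (4 * L * (1 + s^-1)) <= C * B * (1 + s))%R.
  by rewrite ler_wpM2l// mulr_ge0// ltW.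
have -> : (2 + 4 * L = 1 + s)%R by rewrite /s; ring.
move: h2; set r := s^-1%R; nra.
Qed.

End finite_mixture_inequality.

(** * Stability of the cost under approximation of both measures *)

Section stability.
Context {R : realType} {d : nat}.
Local Notation E := (Rd R d).
Implicit Types (mu nu rho : probability E R) (h : E -> R) (i : 'I_d).

Lemma density_chain rho mu nu (b h : E -> R) : density rho mu b ->
  density mu nu h -> density rho nu (fun x => h x * b x)%R.
Proof.
move=> bd hd; have [mb b0 _] := bd; have [mh h0 hE] := hd; split.
- exact: measurable_funM.
- by move=> x; rewrite mulr_ge0.
- move=> A mA; rewrite hE// integral_mkcond [RHS]integral_mkcond.
  have mhA : measurable_fun setT ((fun x => (h x)%:E) \_ A).
    apply/(measurable_restrictT _ _).1 => //; apply/measurable_EFinP.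
    exact: measurable_funTS.
  rewrite (density_integral bd)//; last first.
    by move=> x; rewrite patchE; case: ifPn => // _; rewrite lee_fin.
  apply: eq_integral => x _; rewrite !patchE; case: ifPn => xA.
    by rewrite -EFinM.
  by rewrite mul0e.
Qed.

Lemma second_moment_square_integrable_density rho mu (b : E -> R) :
  density rho mu b -> square_integrable rho b ->
  (forall i, square_integrable rho (fun x => coord i x ^+ 2)%R) ->
  finite_second_moment mu.
Proof.
move=> bd b2 x2 i; have [mb b0 _] := bd.
have mX : measurable_fun [set: E] (fun x => (coord i x ^+ 2)%:E) := measurable_sqcoord i.
have pX x : 0 <= (coord i x ^+ 2)%:E by rewrite lee_fin sqr_ge0.
rewrite (density_integral bd)//.
have /integrableP[_] := square_integrableM (x2 i) b2.
rewrite (eq_integral (fun x => (coord i x ^+ 2)%:E * (b x)%:E))// => x _.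
rewrite /= ger0_norm -?EFinM//.
by apply: mulr_ge0 => //; exact: sqr_ge0.
Qed.

(** The path nu, nu', mu', mu has two short ends. Two triangle inequalities give the middle step the
    factor (1 + s)^2, close to one, and the ends factors that blow up as s tends to 0; this is
    harmless because [e] is chosen after [s]. *)
Lemma T2bar_stable rho mu nu (b a : E -> R) (c : R) :
  density rho mu b -> density rho nu a -> finite_second_moment mu ->
  (forall e : R, (0 < e)%R -> exists mu' nu' b' a',
    [/\ density rho mu' b', density rho nu' a',
        finite_second_moment mu' /\ finite_second_moment nu',
        \sum_(i < d) \int[rho]_x (`|a x - a' x| * (coord i x) ^+ 2)%:E <= e%:E /\
        \sum_(i < d) \int[rho]_x (`|b' x - b x| * (coord i x) ^+ 2)%:E <= e%:E &
        T2bar mu' nu' <= (c + e)%:E]) ->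
  T2bar mu nu <= c%:E.
Proof.
move=> bd ad mu2 h.
have c0 : (0 <= c)%R.
  apply/ler_addgt0Pr => e /h[mu' [nu' [b' [a' [_ _ _ _]]]]].
  by move=> /(le_trans (T2bar_ge0 _ _)); rewrite lee_fin.
have key (s e : R) : (0 < s)%R -> (0 < e)%R -> T2bar mu nu <=
    ((1 + s) * ((1 + s^-1) * e + (1 + s) * (c + e)) + (1 + s^-1) * e)%:E.
  move=> s0 e0; have [mu' [nu' [b' [a' [b'd a'd [mu'2 nu'2] [aa' bb'] T']]]]] := h _ e0.
  apply: (T2bar_triangle s0 mu'2 mu2); last exact: T2bar_near b'd bd bb'.
  have si : (0 < s^-1)%R by rewrite invr_gt0.
  have := T2bar_triangle si nu'2 mu'2 (T2bar_near ad a'd aa') T'.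
  by rewrite invrK.
apply/lee_addgt0Pr => de' de0'.
suff H (de : R) : (0 < de)%R -> T2bar mu nu <= c%:E + de%:E by exact: H.
move=> de0.
(* Since s <= 1, (1 + s)^2 <= 1 + 3 s, and 3 s c <= de / 2; the other half of [de] is left for the
   ends. *)
pose s := (de / (3 * c + 3 * c + de))%R.
have den0 : (0 < 3 * c + 3 * c + de)%R by rewrite ltr_wpDl// addr_ge0// mulr_ge0.
have s0 : (0 < s)%R by rewrite divr_gt0.
have s1 : (s <= 1)%R by rewrite ler_pdivrMr// mul1r lerDr addr_ge0// mulr_ge0.
have sc : (3 * s * c <= de / 2)%R.
  rewrite /s (_ : 3 * (de / _) * c = de * ((3 * c) / (3 * c + 3 * c + de)))%R; last by ring.
  rewrite ler_pM2l// ler_pdivrMr//; lra.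
pose K := ((1 + s) * ((1 + s^-1) + (1 + s)) + (1 + s^-1))%R.
have si : (0 < s^-1)%R by rewrite invr_gt0.
have K0 : (0 < K)%R by rewrite /K addr_gt0 ?addr_gt0// mulr_gt0 ?addr_gt0// addr_gt0.
pose e := (de / 2 / K)%R.
have e0 : (0 < e)%R by rewrite divr_gt0// divr_gt0.
apply: (le_trans (key s e s0 e0)); rewrite -EFinD lee_fin.
have -> : ((1 + s) * ((1 + s^-1) * e + (1 + s) * (c + e)) + (1 + s^-1) * e =
    (1 + s) ^+ 2 * c + e * K)%R by rewrite /K; ring.
have -> : (e * K = de / 2)%R by rewrite /e divfK// gt_eqF.
have : ((1 + s) ^+ 2 * c <= (1 + 3 * s) * c)%R.
  by rewrite ler_wpM2r//; nra.
lra.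
Qed.

Lemma bounded_pos_Z mu h (B : R) : measurable_fun setT h -> (0 < B)%R ->
  (forall x, B^-1 <= h x <= B)%R -> (B^-1 <= Rintegral mu setT h <= B)%R.
Proof.
move=> mh B0 hB.
have hb : bounded_pos h by split => //; exists B.
have cstE (r : R) : Rintegral mu setT (fun=> r) = r.
  rewrite Rintegral_cst// [X in fine X](_ : _ = 1) ?mulr1//; exact: probability_setT.
have ic (r : R) : mu.-integrable setT (EFin \o (fun=> r)).
  by apply: (@bounded_integrable _ _ _ _ _ `|r|%R) => //; exact: measurable_cst.
apply/andP; split.
  rewrite -[leLHS]cstE; apply: le_Rintegral => //; first exact: bounded_pos_integrable.
  by move=> x _; case/andP : (hB x).
rewrite -[leRHS]cstE; apply: le_Rintegral => //; first exact: bounded_pos_integrable.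
by move=> x _; case/andP : (hB x).
Qed.

Lemma Rintegral_density_diff rho mu mu' (b b' f : E -> R) (F eta : R) :
  density rho mu b -> density rho mu' b' -> measurable_fun setT f ->
  (forall x, `|f x| <= F)%R -> \int[rho]_x `|b' x - b x|%:E <= eta%:E ->
  (`|Rintegral mu' setT f - Rintegral mu setT f| <= F * eta)%R.
Proof.
move=> bd b'd mf fF hd; have [mb b0 _] := bd; have [mb' b0' _] := b'd.
have F0 : (0 <= F)%R by apply: le_trans (fF point).
have fint (m1 : probability E R) : m1.-integrable setT (EFin \o f).
  exact: bounded_integrable fF.
rewrite (density_Rintegral bd)// (density_Rintegral b'd)//.
have ibf (m1 : probability E R) (k : E -> R) : density rho m1 k ->
    rho.-integrable setT (EFin \o (fun x => f x * k x)%R).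
  move=> kd; have [mk k0 _] := kd.
  apply: (@le_integrable _ _ _ _ _ measurableT _ (fun x => F%:E * (k x)%:E)).
  - by apply/measurable_EFinP; exact: measurable_funM.
  - move=> x _; rewrite /= lee_fin !normrM; apply: ler_wpM2r => //.
    by rewrite [leRHS]ger0_norm.
  - by apply: integrableZl => //; exact: density_integrable kd.
rewrite -RintegralB//; [|exact: ibf b'd|exact: ibf bd].
have idf : rho.-integrable setT (EFin \o (fun x => f x * b' x - f x * b x)%R).
  have -> : EFin \o (fun x => f x * b' x - f x * b x)%R =
    (EFin \o (fun x => f x * b' x)%R) \- (EFin \o (fun x => f x * b x)%R).
    by apply/funext => x /=; rewrite EFinB.
  by apply: integrableB => //; [exact: ibf b'd|exact: ibf bd].
apply: le_trans (le_normr_Rintegral measurableT idf) _.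
rewrite -lee_fin {1}/Rintegral fineK; last first.
  exact: (integrable_fin_num measurableT (integrable_norm idf)).
apply: (@le_trans _ _ (\int[rho]_x (F%:E * `|b' x - b x|%:E))).
  apply: ge0_le_integral => //.
  - apply/measurable_EFinP; apply: measurableT_comp => //.
    by apply: measurable_funB; exact: measurable_funM.
  - apply: measurable_funeM; apply/measurable_EFinP; apply: measurableT_comp => //.
    exact: measurable_funB.
  - by move=> x _; rewrite -EFinM lee_fin -mulrBr normrM ler_wpM2r.
rewrite ge0_integralZl_EFin//; first by rewrite EFinM lee_wpmul2l ?lee_fin.
apply/measurable_EFinP; apply: measurableT_comp => //; exact: measurable_funB.
Qed.

End stability.

(** * Bounded tilts of the general mixture *)

Section bounded_tilt_of_mixture.
Context {R : realType} {d : nat} {disp : measure_display}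
  {Theta : measurableType disp}.
Local Notation E := (Rd R d).
Variables (m : probability Theta R) (mu : Theta -> probability E R).
Hypothesis mmu : forall A, measurable A ->
  measurable_fun [set: Theta] (fun theta => mu theta A).
Local Notation mix := (mixture m mmu : probability E R).
Variables (C M : R).
Hypothesis muT : forall theta, T2minus_with (mu theta) C.
Hypothesis M0 : (0 <= M)%R.
Hypothesis muM : forall theta theta', chi2 (mu theta) (mu theta') <= M%:E.
Local Notation L := (ln (1 + M)).

Let L0 : (0 <= L)%R.
Proof. by apply: ln_ge0; rewrite lerDl. Qed.

Let C0 : (0 < C)%R.
Proof. by have [] := muT point. Qed.

(** The inequality of [mu theta], applied to [mu theta'], leaves their relative entropy, which the
    chi-square bound controls. *)
Lemma T2bar_family_le theta theta' :
  T2bar (mu theta) (mu theta') <= (C * L)%:E.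
Proof.
have [_ _ muC] := muT theta; have [_ mu'1 _] := muT theta'.
apply: (le_trans (muC _ mu'1)); rewrite EFinM lee_wpmul2l ?lee_fin ?(ltW C0)//.
have [g gd g2] := chi2_density (muM theta' theta).
exact: relative_entropy_le_ln M0 gd g2.
Qed.

(** The common reference measure: every component has a square-integrable density with respect to
    it. *)
Local Notation rho := (mu point).

Lemma square_integrable_sqcoord theta i :
  square_integrable (mu theta) (fun x => coord i x ^+ 2)%R.
Proof.
split; first by apply: measurable_funX; exact: measurable_coord.
rewrite (eq_integral (fun x => (coord i x ^+ 4)%:E)); first exact: T2minus_moment4.
by move=> x _; rewrite -exprM.
Qed.

Lemma mixture_dominates : mix `<< rho.
Proof.
apply/null_content_dominatesP => A mA A0; rewrite /= /mixture integral0_eq// => theta _.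
have [g gd _] := chi2_density (muM theta point).
by have /null_content_dominatesP := density_dominates gd; apply.
Qed.

(** The sum controls second moments; the added 1 makes the same estimate control the unweighted L^1
    distance, hence normalizing constants and entropies. *)
Let weight (x : E) : R := (1 + \sum_(i < d) coord i x ^+ 2)%R.

Let weight_ge1 x : (1 <= weight x)%R.
Proof. by rewrite lerDl; apply: sumr_ge0 => i _; exact: sqr_ge0. Qed.

Let weight2 : square_integrable rho weight.
Proof.
apply: square_integrableD; first exact: square_integrable_cst.
rewrite (_ : (fun x => _) = (fun x => \sum_(k < d)
   (if insub (k : nat) is Some i then coord (i : 'I_d) x ^+ 2 else 0))%R); last first.
  by apply/funext => x; apply: eq_bigr => k _; rewrite valK.
apply: (@square_integrable_sum _ _ _ rho d (fun k x =>
   (if insub k is Some i then coord (i : 'I_d) x ^+ 2 else 0))%R) => k.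
case: (insub k) => [i|]; first exact: square_integrable_sqcoord.
exact: square_integrable_cst.
Qed.

Lemma sum_weighted_le (u : E -> R) : measurable_fun setT u ->
  \sum_(i < d) \int[rho]_x (`|u x| * coord i x ^+ 2)%:E <=
  \int[rho]_x (`|u x| * weight x)%:E.
Proof.
move=> mu_.
have mX i : measurable_fun [set: E] (fun x => coord i x ^+ 2)%R.
  by apply: measurable_funX; exact: measurable_coord.
have mu' : measurable_fun [set: E] (fun x => `|u x|)%R by exact: measurableT_comp.
rewrite -ge0_integral_sum//; last 2 first.
- by move=> i; apply/measurable_EFinP; exact: measurable_funM.
- by move=> i x _; rewrite lee_fin mulr_ge0// sqr_ge0.
apply: ge0_le_integral => //.
- by move=> x _; apply: sume_ge0 => i _; rewrite lee_fin mulr_ge0// sqr_ge0.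
- apply: emeasurable_sum => i.
  by apply/measurable_EFinP; exact: measurable_funM.
- by apply/measurable_EFinP; apply: measurable_funM => //; case: weight2.
- move=> x _; rewrite sumEFin lee_fin -mulr_sumr ler_wpM2l//.
  by rewrite /weight lerDr.
Qed.

Let exists_densities : exists g : Theta -> E -> R, forall theta,
  density rho (mu theta) (g theta) /\
  \int[rho]_x ((g theta x) ^+ 2)%:E <= (1 + M)%:E.
Proof.
have h theta : exists g : E -> R, density rho (mu theta) g /\
    \int[rho]_x ((g x) ^+ 2)%:E <= (1 + M)%:E.
  by have [g gd g2] := chi2_density (muM theta point); exists g.
by have [g gP] := choice h; exists g.
Qed.

Lemma mixture_density_square_integrable gbar : density rho mix gbar ->
  square_integrable rho gbar.
Proof.
move=> gbard; have [g gP] := exists_densities.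
split; first by case: gbard.
apply: le_lt_trans (ltry (1 + M)%R).
exact: (mixture_density_sqr (fun theta => (gP theta).1) (fun theta => (gP theta).2) gbard).
Qed.

Lemma mixture_second_moment : finite_second_moment mix.
Proof.
have [gbar gbard] := dominates_density mixture_dominates.
apply: (second_moment_square_integrable_density gbard).
  exact: mixture_density_square_integrable.
by move=> i; exact: square_integrable_sqcoord.
Qed.

(** The same [h] tilts the mixture and a nearby empirical mean of components, to which
    [T2bar_finite_mixture] applies. Since [h] lies between [B^-1] and [B], the entropies of the two
    tilts and the weighted distance of their densities are controlled by multiples of [eta]. *)
Lemma mixture_tilt nu (h : E -> R) : bounded_pos h ->
  density mix nu (fun x => h x / Rintegral mix setT h)%R ->
  T2bar mix nu <= (C * (2 + 4 * L) *
    (Rintegral mix setT (fun x => h x * ln (h x)) / Rintegral mix setT h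
      - ln (Rintegral mix setT h)))%:E.
Proof.
move=> hb hd.
have [gbar gbard] := dominates_density mixture_dominates.
have [g gP] := exists_densities.
have gd theta := (gP theta).1; have gV theta := (gP theta).2.
have gbar2 := mixture_density_square_integrable gbard.
have [mgbar gbar0 _] := gbard.
have [mw _] := weight2.
have w0 x : (0 <= weight x)%R by apply: le_trans (weight_ge1 x).
have h0 x := bounded_pos_gt0 x hb.
have [mh [B [B0 hB]]] := hb.
set Z := Rintegral mix setT h in hd *.
set H := Rintegral mix setT (fun x => h x * ln (h x))%R.
have Z0 : (0 < Z)%R := bounded_pos_Z_gt0 mix hb.
have /andP[ZB _] := bounded_pos_Z mix mh B0 hB; rewrite -/Z in ZB.
have [ml [Lh hL]] := bounded_pos_ln hb.
have mhl : measurable_fun setT (fun x => h x * ln (h x))%R by exact: measurable_funM.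
have hlB x : (`|h x * ln (h x)| <= B * Lh)%R.
  by rewrite normrM ler_pM// gtr0_norm//; case/andP : (hB x).
have hBn x : (`|h x| <= B)%R by rewrite gtr0_norm//; case/andP : (hB x).
have Bi0 : (0 < B^-1)%R by rewrite invr_gt0.
have iW : rho.-integrable setT (EFin \o (fun x => gbar x * weight x)%R).
  exact: square_integrableM.
pose W1 := fine (\int[rho]_x (gbar x * weight x)%:E).
have W1E : \int[rho]_x (gbar x * weight x)%:E = W1%:E.
  by rewrite /W1 fineK//; exact: (integrable_fin_num measurableT iW).
have W10 : (0 <= W1)%R.
  by rewrite -lee_fin -W1E; apply: integral_ge0 => x _; rewrite lee_fin mulr_ge0.
apply: (T2bar_stable gbard (density_chain gbard hd) mixture_second_moment) => e e0.
pose A := (C * (2 + 4 * L))%R.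
have A0 : (0 <= A)%R.
  by rewrite /A mulr_ge0 ?(ltW C0)//; have := L0; lra.
have Lh0 : (0 <= Lh)%R by apply: le_trans (hL point).
(* [K1] comes from |h gbar / Z - h ghat / Z'| <= B^2 |ghat - gbar| + B^4 eta gbar. The three terms
   of [K2] bound the effects on the entropy of H' - H, of 1 / Z' - 1 / Z and of ln Z - ln Z'. *)
pose K1 := (B ^+ 2 + B ^+ 4 * W1)%R.
pose K2 := (B * (B * Lh) + `|H| * B ^+ 3 + B ^+ 2)%R.
have B0' := ltW B0.
have K10 : (0 <= K1)%R by rewrite /K1 addr_ge0 ?mulr_ge0 ?exprn_ge0.
have K20 : (0 <= K2)%R by rewrite /K2 !addr_ge0 ?mulr_ge0 ?exprn_ge0.
pose eta := (e / (1 + K1 + A * K2))%R.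
have den0 : (0 < 1 + K1 + A * K2)%R.
  by apply: ltr_wpDr; [exact: mulr_ge0|exact: ltr_wpDr].
have eta0 : (0 < eta)%R by rewrite divr_gt0.
have eta0' := ltW eta0.
have AK0 : (0 <= A * K2)%R := mulr_ge0 A0 K20.
have etaE : (eta * (1 + K1 + A * K2) = e)%R by rewrite /eta divfK// gt_eqF.
have eta1 : (eta <= e)%R.
  have : (0 <= eta * (K1 + A * K2))%R by apply: mulr_ge0 => //; exact: addr_ge0.
  by rewrite -etaE; nra.
have eta2 : (K1 * eta <= e)%R.
  have : (0 <= eta * (1 + A * K2))%R by apply: mulr_ge0 => //; exact: addr_ge0.
  by rewrite -etaE; nra.
have eta3 : (A * (K2 * eta) <= e)%R.
  have : (0 <= eta * (1 + K1))%R by apply: mulr_ge0 => //; exact: addr_ge0.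
  by rewrite -etaE; nra.
have [n [th [n0 hn]]] := exists_empirical_mean gd gV gbard weight2 w0 eta0.
pose c (k : nat) : R := n%:R^-1%R.
have c0 k : (0 <= c k)%R by rewrite invr_ge0.
have c1 : (\sum_(k < n) c k = 1)%R.
  by rewrite /c sumr_const card_ord -[LHS]mulr_natl divff// pnatr_eq0 -lt0n.
have [mu' mu'M] := exists_mixture (m_ := fun k => mu (th k)) c0
  (fun k => probability_setT (mu (th k))) c1.
pose ghat x := (\sum_(k < n) n%:R^-1 * g (th k) x)%R.
have mg k : measurable_fun setT (g (th k)) by case: (gd (th k)).
have g0 k x : (0 <= g (th k) x)%R by case: (gd (th k)).
have ghatd : density rho mu' ghat.
  split.
  - by apply: measurable_sum => k; apply: measurable_funM.
  - by move=> x; apply: sumr_ge0 => k _; rewrite mulr_ge0 ?invr_ge0.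
  - move=> D mD; rewrite mu'M//.
    rewrite (eq_integral (fun x => \sum_(k < n) (n%:R^-1 * g (th k) x)%:E)); last first.
      by move=> x _; rewrite sumEFin.
    rewrite ge0_integral_sum//; last 2 first.
    - move=> k; apply/measurable_EFinP; apply: measurable_funTS.
      by apply: measurable_funM => //; exact: measurable_cst.
    - by move=> k x _; rewrite lee_fin mulr_ge0 ?invr_ge0.
    apply: eq_bigr => k _; have [_ _ gE] := gd (th k).
    under eq_integral do rewrite EFinM.
    rewrite ge0_integralZl_EFin//; last 2 first.
    - by move=> x _; rewrite lee_fin.
    - by apply/measurable_EFinP; apply: measurable_funTS.
    exact: (congr1 (fun y => (c k)%:E * y) (gE D mD)).
have [mghat ghat0 _] := ghatd.
have mu2 k : finite_second_moment (mu (th k)) by exact: T2minus_second_moment.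
have mu'2 : finite_second_moment mu' by exact: mixes_second_moment c0 mu'M mu2.
have [nu' nu'd] := exists_tilt mu' hb.
have T' := T2bar_finite_mixture L0 c0 mu'M (fun k => muT (th k))
  (fun j k => T2bar_family_le (th j) (th k)) hb nu'd.
set Z' := Rintegral mu' setT h in nu'd T' *.
set H' := Rintegral mu' setT (fun x => h x * ln (h x))%R in T'.
have Z'0 : (0 < Z')%R := bounded_pos_Z_gt0 mu' hb.
have /andP[Z'B _] := bounded_pos_Z mu' mh B0 hB; rewrite -/Z' in Z'B.
have mdiff : measurable_fun setT (fun x => ghat x - gbar x)%R by exact: measurable_funB.
have mdiffn : measurable_fun setT (fun x => `|ghat x - gbar x|)%R.
  exact: measurableT_comp.
have hn' : \int[rho]_x `|ghat x - gbar x|%:E <= eta%:E.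
  apply: le_trans hn; apply: ge0_le_integral => //.
  - exact/measurable_EFinP.
  - by apply/measurable_EFinP; exact: measurable_funM.
  - by move=> x _; rewrite lee_fin ler_peMr.
have ZZ : (`|Z' - Z| <= B * eta)%R := Rintegral_density_diff gbard ghatd mh hBn hn'.
have HH : (`|H' - H| <= B * Lh * eta)%R := Rintegral_density_diff gbard ghatd mhl hlB hn'.
have iZ : (Z^-1 <= B)%R by rewrite -[leRHS]invrK lef_pV2 ?posrE.
have iZ' : (Z'^-1 <= B)%R by rewrite -[leRHS]invrK lef_pV2 ?posrE.
have iZ0 : (0 <= Z^-1)%R by rewrite invr_ge0 ltW.
have iZ'0 : (0 <= Z'^-1)%R by rewrite invr_ge0 ltW.
have iZZ : (`|Z^-1 - Z'^-1| <= B ^+ 3 * eta)%R.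
  have -> : (Z^-1 - Z'^-1 = Z^-1 * Z'^-1 * (Z' - Z))%R.
    by field; rewrite !gt_eqF.
  rewrite normrM ger0_norm ?mulr_ge0//.
  have -> : (B ^+ 3 * eta = (B * B) * (B * eta))%R by ring.
  by apply: ler_pM => //; [exact: mulr_ge0|exact: ler_pM].
exists mu', nu', ghat, (fun x => h x / Z' * ghat x)%R; split => //.
- exact: density_chain ghatd nu'd.
- split => //.
  have [mu'd1 _ _] := density_chain gbard hd.
  move=> i; have := mu'2 i.
  have mX : measurable_fun [set: E] (fun x => (coord i x ^+ 2)%:E) := measurable_sqcoord i.
  have pX x : 0 <= (coord i x ^+ 2)%:E by rewrite lee_fin sqr_ge0.
  rewrite (density_integral nu'd)// => mu'2i.
  apply: (@le_lt_trans _ _ (\int[mu']_x ((B * B)%:E * (coord i x ^+ 2)%:E))).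
    apply: ge0_le_integral => //.
    - by move=> x _; rewrite mule_ge0// lee_fin divr_ge0// ltW.
    - apply: emeasurable_funM => //; apply/measurable_EFinP.
      by apply: measurable_funM => //; exact: measurable_cst.
    - exact: measurable_funeM.
    - move=> x _; rewrite muleC; apply: lee_wpmul2r; rewrite lee_fin ?sqr_ge0//.
      by apply: ler_pM => //; [exact: ltW|case/andP : (hB x)].
  rewrite ge0_integralZl_EFin ?mulr_ge0//.
  by rewrite lte_mul_pinfty ?lee_fin ?mulr_ge0.
- split; last first.
    by apply: (le_trans (sum_weighted_le mdiff)); apply: (le_trans hn); rewrite lee_fin.
  have mdd : measurable_fun setT (fun x => h x / Z * gbar x - h x / Z' * ghat x)%R.
    by apply: measurable_funB; apply: measurable_funM => //; apply: measurable_funM => //;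
      exact: measurable_cst.
  apply: (le_trans (sum_weighted_le mdd)).
  apply: (@le_trans _ _ (\int[rho]_x ((B ^+ 2)%:E * (`|ghat x - gbar x| * weight x)%:E +
      (B ^+ 4 * eta)%:E * (gbar x * weight x)%:E))).
    apply: ge0_le_integral => //.
    - by move=> x _; rewrite lee_fin mulr_ge0.
    - apply/measurable_EFinP; apply: measurable_funM => //; exact: measurableT_comp.
    - by apply: emeasurable_funD; apply: measurable_funeM; apply/measurable_EFinP;
        exact: measurable_funM.
    - move=> x _; rewrite -!EFinM -EFinD lee_fin.
      rewrite [leRHS](_ : _ = (B ^+ 2 * `|ghat x - gbar x| + B ^+ 4 * eta * gbar x) * weight x)%R; last by ring.
      apply: ler_wpM2r => //.
      have -> : (h x / Z * gbar x - h x / Z' * ghat x =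
        h x * (Z^-1 - Z'^-1) * gbar x - h x * Z'^-1 * (ghat x - gbar x))%R by ring.
      apply: le_trans (ler_normB _ _) _; rewrite [leLHS]addrC; apply: lerD.
        rewrite !normrM [`|Z'^-1|%R]ger0_norm//.
        apply: ler_wpM2r => //; rewrite expr2; exact: ler_pM.
      rewrite normrM [`|gbar x|%R]ger0_norm//; apply: ler_wpM2r => //.
      have -> : (B ^+ 4 * eta = B * (B ^+ 3 * eta))%R by ring.
      by rewrite normrM; apply: ler_pM.
  have p1 x : [set: E] x -> 0 <= (`|ghat x - gbar x| * weight x)%:E.
    by rewrite lee_fin mulr_ge0.
  have p2 x : [set: E] x -> 0 <= (gbar x * weight x)%:E by rewrite lee_fin mulr_ge0.
  have m1 : measurable_fun [set: E] (fun x => (`|ghat x - gbar x| * weight x)%:E).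
    by apply/measurable_EFinP; exact: measurable_funM.
  have m2 : measurable_fun [set: E] (fun x => (gbar x * weight x)%:E).
    by apply/measurable_EFinP; exact: measurable_funM.
  have q1 : (0 <= B ^+ 2)%R by exact: exprn_ge0.
  have q2 : (0 <= B ^+ 4 * eta)%R by rewrite mulr_ge0 ?exprn_ge0// ltW.
  rewrite ge0_integralD//; last 4 first.
  - by move=> x Tx; rewrite mule_ge0// p1.
  - exact: measurable_funeM.
  - by move=> x Tx; rewrite mule_ge0// p2.
  - exact: measurable_funeM.
  rewrite !ge0_integralZl_EFin// W1E.
  apply: (@le_trans _ _ ((B ^+ 2)%:E * eta%:E + (B ^+ 4 * eta)%:E * W1%:E)).
    by rewrite leeD2r// lee_wpmul2l.
  rewrite -!EFinM -EFinD lee_fin; apply: le_trans eta2; rewrite /K1; lra.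
apply: (le_trans T'); rewrite lee_fin -/A.
have : (H' / Z' - ln Z' <= H / Z - ln Z + K2 * eta)%R.
  have e1 : (H' / Z' - H / Z <= (B * (B * Lh) + `|H| * B ^+ 3) * eta)%R.
    have -> : (H' / Z' - H / Z = (H' - H) * Z'^-1 - H * (Z^-1 - Z'^-1))%R by ring.
    apply: le_trans (ler_norm _) _; apply: le_trans (ler_normB _ _) _.
    rewrite [leRHS]mulrDl; apply: lerD.
      rewrite normrM [`|Z'^-1|%R]ger0_norm//.
      have -> : (B * (B * Lh) * eta = (B * Lh * eta) * B)%R by ring.
      exact: ler_pM.
    by rewrite normrM -mulrA; apply: ler_pM.
  have e2 : (ln Z - ln Z' <= B ^+ 2 * eta)%R.
    rewrite -ln_div ?posrE//.
    have : (ln (1 + (Z / Z' - 1)) <= Z / Z' - 1)%R.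
      by apply: le_ln1Dx; rewrite ltrBrDr addNr divr_gt0.
    rewrite subrKC => /le_trans; apply.
    have -> : (Z / Z' - 1 = - (Z' - Z) * Z'^-1)%R by field; rewrite gt_eqF.
    apply: le_trans (ler_norm _) _; rewrite normrM normrN [`|Z'^-1|%R]ger0_norm//.
    have -> : (B ^+ 2 * eta = B * eta * B)%R by ring.
    exact: ler_pM.
  rewrite /K2; lra.
move=> /(ler_wpM2l A0) hA; apply: (le_trans hA).
by rewrite mulrDr lerD2l.
Qed.

End bounded_tilt_of_mixture.

(** * Dominated convergence and clipped densities *)

Lemma Rintegral_dominated_cvg {disp : measure_display} {T : measurableType disp}
    {R : realType} (m : probability T R) (f_ : nat -> T -> R) (f G : T -> R) :
  (forall n, measurable_fun setT (f_ n)) -> measurable_fun setT f ->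
  (forall x, f_ n x @[n --> \oo] --> f x) ->
  (forall n x, `|f_ n x| <= G x)%R -> m.-integrable setT (EFin \o G) ->
  Rintegral m setT (f_ n) @[n --> \oo] --> Rintegral m setT f.
Proof.
move=> mf_ mf cf fG iG.
have [if_ _ cv] : [/\ m.-integrable setT (EFin \o f),
    [sequence \int[m]_x `|(f_ n x)%:E - (f x)%:E|]_n @ \oo --> 0 &
    [sequence \int[m]_x (f_ n x)%:E]_n @ \oo --> \int[m]_x (f x)%:E].
  apply: (@dominated_convergence _ _ _ m setT measurableT
    (fun n x => (f_ n x)%:E) (EFin \o f) (EFin \o G)) => //.
  - by move=> n; exact/measurable_EFinP.
  - exact/measurable_EFinP.
  - apply: aeW => x _; apply: cvg_EFin; first exact: nearW.
    exact: cf.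
  - by apply: aeW => x n _; rewrite /= lee_fin.
apply: fine_cvg; rewrite fineK//; exact: (integrable_fin_num measurableT if_).
Qed.

Section clipping.
Context {R : realType}.
Implicit Types (t : R) (n : nat).

Local Notation N n := (n.+1%:R : R).

(** The values lie in [1 / (n + 1), n + 1], so that a clipped density is [bounded_pos]. *)
Definition clip n t : R := if (t < (N n)^-1)%R then ((N n)^-1)%R else Num.min t (N n).

Definition xlnx t : R := (t * ln t)%R.

(* Unlike xlnx (clip n t), this is dominated by `|xlnx t|. *)
Definition clip_xlnx n t : R :=
  if (t < (N n)^-1)%R then 0%R else xlnx (Num.min t (N n)).

Let N0 n : (0 < N n)%R. Proof. by rewrite ltr0n. Qed.

Let N1 n : (1 <= N n)%R. Proof. by rewrite ler1n. Qed.

Let iN1 n : ((N n)^-1 <= 1)%R. Proof. by rewrite invf_le1. Qed.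

Let iN0 n : (0 < (N n)^-1)%R. Proof. by rewrite invr_gt0. Qed.

Lemma clip_bound n t : ((N n)^-1 <= clip n t <= N n)%R.
Proof.
rewrite /clip; case: ifPn => [_|]; first by rewrite lexx (le_trans (iN1 n)).
rewrite -leNgt => h; rewrite le_min h (le_trans (iN1 n))//= ge_min lexx orbT //.
Qed.

Lemma clip_dist n t : (0 <= t <= N n)%R -> (`|clip n t - t| <= (N n)^-1)%R.
Proof.
move=> /andP[t0 tN]; rewrite /clip; case: ifPn => [h|_].
  by rewrite ger0_norm ?subr_ge0 ?(ltW h)// gerBl.
by rewrite (elimT min_idPl tN) subrr normr0 ltW.
Qed.

Lemma clip_le n t : (0 <= t)%R -> (clip n t <= t + 1)%R.
Proof.
move=> t0; rewrite /clip; case: ifPn => [h|_].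
  by rewrite (le_trans (iN1 n))// lerDr.
by rewrite ge_min lerDl ler01.
Qed.

Lemma min_le_clip n t : (Num.min t (N n) <= clip n t)%R.
Proof.
by rewrite /clip; case: ifPn => // h; rewrite ge_min (ltW h).
Qed.

Lemma eventually_le (r : R) : \forall n \near \oo, (r <= N n)%R.
Proof.
exists (Num.truncn `|r|) => // n /= rn.
apply: (le_trans (ler_norm r)); apply: ltW.
have /truncn_itv/andP[_ h] : (0 <= `|r|)%R by [].
by apply: lt_le_trans h _; rewrite ler_nat ltnS.
Qed.

Lemma eventually_inv_lt (r : R) : (0 < r)%R -> \forall n \near \oo, ((N n)^-1 < r)%R.
Proof.
move=> r0; have := eventually_le (r^-1 + 1)%R; apply: filterS => n h.
rewrite -[ltRHS]invrK ltf_pV2 ?posrE ?invr_gt0//.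
by apply: lt_le_trans h; rewrite ltrDl.
Qed.

Lemma clip_cvg t : (0 <= t)%R -> clip n t @[n --> \oo] --> t.
Proof.
move=> t0; apply/cvgrPdist_lt => e e0.
have h1 := eventually_le t; have h2 := eventually_inv_lt e0.
move: h1 h2; apply: filterS2 => n h1 h2; rewrite distrC.
by apply: le_lt_trans h2; apply: clip_dist; rewrite t0.
Qed.

Lemma xlnx_geB1 t : (0 <= t)%R -> (t - 1 <= xlnx t)%R.
Proof.
rewrite le_eqVlt => /predU1P[<-|t0]; first by rewrite /xlnx mul0r sub0r lerN10.
have : (ln (1 + (t^-1 - 1)) <= t^-1 - 1)%R.
  by apply: le_ln1Dx; rewrite ltrBrDr addNr invr_gt0.
rewrite subrKC lnV ?posrE// => h.
have : (t * - ln t <= t * (t^-1 - 1))%R by rewrite ler_pM2l.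
rewrite mulrBr mulfV ?gt_eqF// mulr1 mulrN /xlnx; lra.
Qed.

(** Where the two sides differ, [clip n t] is the inverse of n + 1, whose logarithm is nonpositive.
    An upper bound suffices, since the entropies of the clipped tilts only occur in upper bounds for
    costs. *)
Lemma xlnx_clip_le n t : (xlnx (clip n t) <= clip_xlnx n t)%R.
Proof.
rewrite /clip /clip_xlnx; case: ifPn => // _.
by rewrite /xlnx mulr_ge0_le0 ?(ltW (iN0 n))// ln_le0.
Qed.

Lemma clip_xlnx_norm n t : (0 <= t)%R -> (`|clip_xlnx n t| <= `|xlnx t|)%R.
Proof.
move=> t0; rewrite /clip_xlnx; case: ifPn => [_|_]; first by rewrite normr0.
have [tN|tN] := leP t (N n); first by rewrite lexx.
have lN : (0 <= ln (N n))%R by exact: ln_ge0.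
have lNt : (ln (N n) <= ln t)%R.
  by rewrite ler_ln ?posrE ?ltW// (lt_trans _ tN).
rewrite /xlnx !ger0_norm ?mulr_ge0//.
- by rewrite ler_pM// ltW.
- exact: le_trans lNt.
Qed.

Lemma clip_xlnx_cvg t : (0 <= t)%R -> clip_xlnx n t @[n --> \oo] --> xlnx t.
Proof.
move=> t0; apply: cvg_near_cst.
move: t0; rewrite le_eqVlt => /predU1P[<-|t0].
  by apply: nearW => n; rewrite /clip_xlnx iN0 /xlnx mul0r.
have h1 := eventually_le t; have h2 := eventually_inv_lt t0.
move: h1 h2; apply: filterS2 => n h1 h2.
by rewrite /clip_xlnx ltNge (ltW h2)/= (elimT min_idPl h1).
Qed.

Lemma measurable_clip n : measurable_fun setT (clip n).
Proof.
apply: measurable_fun_ifT => //.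
- by apply: measurable_fun_ltr => //; exact: measurable_cst.
- by apply: measurable_minr => //; exact: measurable_cst.
Qed.

Lemma measurable_xlnx : measurable_fun setT xlnx.
Proof. by apply: measurable_funM => //; exact: measurable_ln. Qed.

Lemma measurable_clip_xlnx n : measurable_fun setT (clip_xlnx n).
Proof.
apply: measurable_fun_ifT => //.
- by apply: measurable_fun_ltr => //; exact: measurable_cst.
- apply: (measurableT_comp measurable_xlnx).
  by apply: measurable_minr => //; exact: measurable_cst.
Qed.

End clipping.

(** * Entropy as an integral against the reference measure *)

Section entropy_integral.
Context {R : realType} {d : nat}.
Local Notation E := (Rd R d).
Implicit Types (mu nu : probability E R) (h : E -> R) (i : 'I_d).

(** Change of measure on positive and negative parts, hence without integrability. Where [h x] is
    zero, [lne] is [-oo] but its product with the density is 0. *)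
Lemma relative_entropy_xlnx mu nu h : density mu nu h ->
  relative_entropy nu mu = \int[mu]_x (xlnx (h x))%:E.
Proof.
move=> hd; have [mh h0 _] := hd.
rewrite (relative_entropy_density hd) integralE [RHS]integralE.
have ml := measurable_lne_EFin mh.
rewrite !(density_integral hd)//; [|exact: measurable_funeneg|exact: measurable_funepos].
congr (_ - _); apply: eq_integral => x _.
- rewrite !funeposE /xlnx; have := h0 x; rewrite le_eqVlt => /predU1P[<-|hx].
    by rewrite mule0 mul0r maxxx.
  rewrite lne_EFin// muleC -EFin_max -EFinM -EFin_max.
  by rewrite maxr_pMr ?mulr0// ltW.
- rewrite !funenegE /xlnx; have := h0 x; rewrite le_eqVlt => /predU1P[<-|hx].
    by rewrite mule0 mul0r oppe0 maxxx.
  rewrite lne_EFin// muleC -!EFinN -EFin_max -EFinM -EFin_max.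
  by rewrite maxr_pMr ?mulr0 ?mulrN// ltW.
Qed.

(** Integrate t - 1 <= t ln t at the density; the left side has integral zero because both masses
    are one. *)
Lemma relative_entropy_ge0 mu nu : 0 <= relative_entropy nu mu.
Proof.
have [num|num] := pselect (nu `<< mu); last by rewrite /relative_entropy asboolF ?leey.
have [h hd] := dominates_density num; have [mh h0 hE] := hd.
rewrite (relative_entropy_xlnx hd).
have ih := density_integrable hd.
have i1 : mu.-integrable setT (fun x => 1%R%:E : \bar R).
  by apply: (@bounded_integrable _ _ _ _ (fun=> 1%R) 1%R) => // x; rewrite normr1.
have -> : 0 = \int[mu]_x (h x - 1)%:E :> \bar R.
  rewrite integralB_EFin// -hE// integral_cst// [X in _ * X]probability_setT.
  rewrite mule1 [X in X - _](_ : _ = 1) ?subee//; exact: probability_setT.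
apply: le_integral_measurable => [||x].
- by apply/measurable_EFinP; apply: measurable_funB.
- by apply/measurable_EFinP; apply: (measurableT_comp measurable_xlnx).
- by rewrite lee_fin xlnx_geB1.
Qed.

(** The negative part of t ln t is at most 1, so that only the positive part could fail to be
    integrable, and finite entropy excludes this. *)
Lemma xlnx_integrable mu nu h : density mu nu h -> relative_entropy nu mu < +oo ->
  mu.-integrable setT (EFin \o (fun x => xlnx (h x))).
Proof.
move=> hd; rewrite (relative_entropy_xlnx hd) => hfin; have [mh h0 _] := hd.
have mx : measurable_fun setT (fun x => xlnx (h x)).
  exact: (measurableT_comp measurable_xlnx).
have mxE : measurable_fun setT (EFin \o (fun x => xlnx (h x))) by exact/measurable_EFinP.
have neg_lty : \int[mu]_x (fun x => (xlnx (h x))%:E)^\- x < +oo.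
  apply: (@le_lt_trans _ _ (\int[mu]_x 1)).
    apply: ge0_le_integral => //; first exact: measurable_funeneg.
    move=> x _; rewrite funenegE ge_max lee01 andbT /= lee_fin.
    by have := xlnx_geB1 (h0 x); have := h0 x; lra.
  by rewrite integral_cst// [X in _ * X]probability_setT mule1 ltry.
have neg_fin : \int[mu]_x (fun x => (xlnx (h x))%:E)^\- x \is a fin_num.
  by rewrite ge0_fin_numE//; exact: integral_ge0.
apply/integrableP; split => //.
rewrite (eq_integral (fun x => (fun x => (xlnx (h x))%:E)^\+ x +
    (fun x => (xlnx (h x))%:E)^\- x)); last first.
  by move=> x _; rewrite -[LHS]/((abse \o (fun x => (xlnx (h x))%:E)) x) fune_abse.
rewrite ge0_integralD//; [|exact: measurable_funepos|exact: measurable_funeneg].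
apply: lte_add_pinfty => //.
have hfin' : \int[mu]_x (fun x => (xlnx (h x))%:E)^\+ x -
    \int[mu]_x (fun x => (xlnx (h x))%:E)^\- x < +oo.
  by rewrite -integralE.
move: hfin'; rewrite -(fineK neg_fin).
have : 0 <= \int[mu]_x (fun x => (xlnx (h x))%:E)^\+ x by exact: integral_ge0.
by case: (\int[mu]_x _) => [r _ _| |//] //; exact: ltry.
Qed.

End entropy_integral.

(** * From bounded tilts to arbitrary measures *)

Section from_bounded_tilts.
Context {R : realType} {d : nat}.
Local Notation E := (Rd R d).
Implicit Types (mu nu : probability E R) (h : E -> R) (i : 'I_d).

(** From x^2 <= 2 (x - m)^2 + 2 m^2 with m the barycenter, and Jensen for m^2. It bounds the moments
    of a starting measure by those of the target and the cost. *)
Lemma second_moment_le a b (p : R.-pker E ~> E) i : transports a b p ->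
  \int[a]_x ((coord i x) ^+ 2)%:E <=
  2%:E * \int[a]_x (sqdisp p i x)%:E + 2%:E * \int[b]_x ((coord i x) ^+ 2)%:E.
Proof.
move=> pab.
have mX : measurable_fun [set: E] (fun x => (coord i x ^+ 2)%:E) := measurable_sqcoord i.
have pX (x : E) : 0 <= (coord i x ^+ 2)%:E by rewrite lee_fin sqr_ge0.
have ms := measurable_EFin_sqdisp p i.
have mI : measurable_fun [set: E] (fun x => \int[p x]_y (coord i y ^+ 2)%:E).
  exact: measurable_integral_pkernel.
rewrite (integral_bind pab)//.
have s0 x : [set: E] x -> 0 <= (sqdisp p i x)%:E by rewrite lee_fin sqr_ge0.
have q0 x : [set: E] x -> 0 <= \int[p x]_y (coord i y ^+ 2)%:E.
  by move=> _; exact: integral_ge0.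
rewrite -!ge0_integralZl_EFin// -ge0_integralD//; last 4 first.
- by move=> x Tx; rewrite mule_ge0// s0.
- exact: measurable_funeM.
- by move=> x Tx; rewrite mule_ge0// q0.
- exact: measurable_funeM.
apply: ge0_le_integral => //.
- by apply: emeasurable_funD; exact: measurable_funeM.
- move=> x _.
  apply: (@le_trans _ _ (2%:E * (sqdisp p i x)%:E + 2%:E * (bary p i x ^+ 2)%:E)).
    rewrite -!EFinM -EFinD lee_fin /sqdisp.
    by have := sqr_ge0 (coord i x - 2 * bary p i x); lra.
  rewrite leeD2l// lee_wpmul2l ?lee_fin//.
  by apply: sqr_Rintegral_le; [exact: prob_kernel|exact: measurable_coord].
Qed.

Lemma T2bar_of_bounded_tilts mu (K : R) : (0 < K)%R -> finite_second_moment mu ->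
  (forall h nu, bounded_pos h ->
    density mu nu (fun x => h x / Rintegral mu setT h)%R ->
    T2bar mu nu <=
    (K * (Rintegral mu setT (fun x => h x * ln (h x)) / Rintegral mu setT h
      - ln (Rintegral mu setT h)))%:E) ->
  forall nu, T2bar mu nu <= K%:E * relative_entropy nu mu.
Proof.
move=> K0 mu2 tilts nu.
have [Hfin|] := ltP (relative_entropy nu mu) +oo; last first.
  by rewrite leye_eq => /eqP ->; rewrite gt0_muley ?lte_fin// leey.
have num : nu `<< mu.
  by apply: contrapT => num; move: Hfin; rewrite /relative_entropy asboolF.
have [h hd] := dominates_density num; have [mh h0 hE] := hd.
have ixl := xlnx_integrable hd Hfin.
pose H := Rintegral mu setT (fun x => xlnx (h x)).
have HE : relative_entropy nu mu = H%:E.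
  rewrite (relative_entropy_xlnx hd) /H /Rintegral fineK//.
  exact: (integrable_fin_num measurableT ixl).
have H0 : (0 <= H)%R by rewrite -lee_fin -HE relative_entropy_ge0.
rewrite HE -EFinM.
have ih := density_integrable hd.
have i1 : mu.-integrable setT (EFin \o (fun=> 1%R)).
  by apply: (@bounded_integrable _ _ _ _ _ 1%R) => // x; rewrite normr1.
have ih1 : mu.-integrable setT (EFin \o (fun x => h x + 1)%R).
  rewrite (_ : _ \o _ = (EFin \o h) \+ (EFin \o (fun=> 1%R))); first exact: integrableD.
  by apply/funext => x /=; rewrite EFinD.
pose hn n x := clip n (h x).
have mhn n : measurable_fun setT (hn n) := measurableT_comp (measurable_clip n) mh.
have hnb n : bounded_pos (hn n).
  by split => //; exists n.+1%:R; split; [rewrite ltr0n|move=> x; exact: clip_bound].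
have hn0 n x : (0 < hn n x)%R := bounded_pos_gt0 x (hnb n).
have hnle n x : (hn n x <= h x + 1)%R by exact: clip_le.
have hnc x : hn n x @[n --> \oo] --> h x by exact: clip_cvg.
pose Z n := Rintegral mu setT (hn n).
have Z0 n : (0 < Z n)%R := bounded_pos_Z_gt0 mu (hnb n).
have Zc : Z n @[n --> \oo] --> (1 : R)%R.
  have -> : (1 = Rintegral mu setT h)%R.
    rewrite /Rintegral -hE// (_ : nu setT = 1)//; exact: probability_setT.
  apply: (Rintegral_dominated_cvg _ _ _ _ ih1) => // n x.
  by rewrite gtr0_norm.
pose P n := Rintegral mu setT (fun x => clip_xlnx n (h x)).
have mP n : measurable_fun setT (fun x => clip_xlnx n (h x)).
  exact: (measurableT_comp (measurable_clip_xlnx n)).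
have inx := integrable_norm ixl.
have Pc : P n @[n --> \oo] --> H.
  apply: (Rintegral_dominated_cvg _ _ _ _ inx) => //.
  - exact: (measurableT_comp measurable_xlnx).
  - by move=> x; exact: clip_xlnx_cvg.
  - by move=> n x; exact: clip_xlnx_norm.
(* An upper bound for the entropy of the clipped tilt. Its integrand is the dominated [clip_xlnx],
   so that it converges to [H]. *)
pose U n := (P n / Z n - ln (Z n))%R.
have Uc : U n @[n --> \oo] --> H.
  rewrite -[X in _ --> X](_ : H / 1 - ln 1 = H)%R; last by rewrite ln1 divr1 subr0.
  apply: cvgB.
    by apply: cvgM => //; apply: cvgV => //; exact: oner_neq0.
  by apply: (cvg_comp _ _ Zc); exact: continuous_ln.
have [nun nund] := choice (fun n => exists_tilt mu (hnb n)).
have TU n : T2bar mu (nun n) <= (K * U n)%:E.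
  apply: (le_trans (tilts _ _ (hnb n) (nund n))); rewrite lee_fin ler_pM2l//.
  rewrite /U lerD2r; apply: ler_wpM2r; first by rewrite invr_ge0 (ltW (Z0 n)).
  apply: le_Rintegral => //.
  - exact: bounded_pos_entropy_integrable.
  - apply: le_integrable ixl => //; first exact/measurable_EFinP.
    by move=> x _; rewrite /= lee_fin clip_xlnx_norm.
  - by move=> x _; exact: xlnx_clip_le.
pose om (x : E) : R := (\sum_(i < d) coord i x ^+ 2)%R.
have om0 x : (0 <= om x)%R by apply: sumr_ge0 => i _; exact: sqr_ge0.
have mX2 i : measurable_fun [set: E] (fun x => coord i x ^+ 2)%R.
  by apply: measurable_funX; exact: measurable_coord.
have mom : measurable_fun [set: E] om by exact: measurable_sum.
have omint (m : probability E R) : finite_second_moment m ->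
    m.-integrable setT (EFin \o om).
  move=> m2; rewrite (_ : EFin \o om = (fun x => \sum_(i < d) (coord i x ^+ 2)%:E)).
    apply: integrable_sum => // i _; apply/integrableP; split.
      exact/measurable_EFinP.
    rewrite (eq_integral (fun x => (coord i x ^+ 2)%:E))// => x _.
    by rewrite gee0_abs// lee_fin sqr_ge0.
  by apply/funext => x; rewrite sumEFin.
have nun2 n : finite_second_moment (nun n).
  move=> i; have [mhz h0z _] := nund n.
  have mX : measurable_fun [set: E] (fun x => (coord i x ^+ 2)%:E) := measurable_sqcoord i.
  have pX (x : E) : 0 <= (coord i x ^+ 2)%:E by rewrite lee_fin sqr_ge0.
  rewrite (density_integral (nund n))//.
  apply: (@le_lt_trans _ _ (\int[mu]_x ((n.+1%:R / Z n)%:E * (coord i x ^+ 2)%:E))).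
    apply: ge0_le_integral => //.
    - by move=> x _; rewrite mule_ge0// lee_fin.
    - by apply: emeasurable_funM => //; exact/measurable_EFinP.
    - exact: measurable_funeM.
    - move=> x _; rewrite muleC; apply: lee_wpmul2r => //.
      rewrite lee_fin; apply: ler_wpM2r; first by rewrite invr_ge0 (ltW (Z0 n)).
      by have /andP[] := clip_bound n (h x).
  rewrite ge0_integralZl_EFin//; last by rewrite divr_ge0// ltW.
  by rewrite lte_mul_pinfty ?lee_fin// ?divr_ge0// ?(ltW (Z0 n))//; exact: mu2.
have nu2 : finite_second_moment nu.
  move=> i.
  have ev : \forall n \near \oo, (U n <= H + 1)%R /\ (Z n <= 2)%R.
    have e1 : \forall n \near \oo, (U n <= H + 1)%R by apply: (cvgr_le _ Uc); rewrite ltrDl.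
    have e2 : \forall n \near \oo, (Z n <= 2)%R by apply: (cvgr_le _ Zc); rewrite ltr1n.
    by move: e1 e2; apply: filterS2.
  have [n0 _ hn0'] := ev.
  pose A := fine (\int[mu]_x (coord i x ^+ 2)%:E).
  have AE : \int[mu]_x (coord i x ^+ 2)%:E = A%:E.
    rewrite /A fineK// ge0_fin_numE ?mu2//.
    by apply: integral_ge0 => x _; rewrite lee_fin sqr_ge0.
  have A0 : (0 <= A)%R.
    by rewrite -lee_fin -AE; apply: integral_ge0 => x _; rewrite lee_fin sqr_ge0.
  pose Q := (2 * (2 * (K * (H + 1) + 1)) + 2 * A)%R.
  have Q0 : (0 <= Q)%R.
    by rewrite /Q; have := mulr_ge0 (ltW K0) (addr_ge0 H0 ler01); lra.
  have nunQ n : (n0 <= n)%N -> \int[nun n]_x (coord i x ^+ 2)%:E <= Q%:E.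
    move=> /hn0'[/= Un _].
    have /T2bar_le_transports : T2bar mu (nun n) <= (K * (H + 1))%:E.
      by apply: (le_trans (TU n)); rewrite lee_fin ler_pM2l.
    move=> /(_ _ ltr01)[p pab hp].
    apply: (le_trans (second_moment_le i pab)); rewrite AE.
    have -> : Q%:E = 2%:E * (2 * (K * (H + 1) + 1))%:E + 2%:E * A%:E.
      by rewrite -!EFinM -EFinD.
    apply: leeD => //; apply: lee_wpmul2l => //.
    rewrite EFinM -lee_pdivrMl//; apply: le_trans hp.
    rewrite lee_wpmul2l ?lee_fin// (bigD1 i)//= leeDl// sume_ge0// => j _.
    by apply: integral_ge0 => x _; exact: EFin_sqdisp_ge0.
  have pX (x : E) : 0 <= (coord i x ^+ 2)%:E by rewrite lee_fin sqr_ge0.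
  rewrite (density_integral hd)//; last exact/measurable_EFinP.
  rewrite (eq_integral (fun x => (coord i x ^+ 2 * h x)%:E)); last first.
    by move=> x _; rewrite EFinM.
  (* The truncations of [h] lie below [Z n] times the density of the tilt, with [Z n] at most 2 and
     moments at most [Q] from index [n0] on; hence the shift by [n0] below. *)
  apply: (@le_lt_trans _ _ (2 * Q)%:E); last exact: ltry.
  apply: (@integral_le_of_exhaustion _ _ _ _ _
    (fun k x => coord i x ^+ 2 * Num.min (h x) (k + n0).+1%:R)%R).
  - exact: measurable_funM.
  - by move=> x; rewrite mulr_ge0// sqr_ge0.
  - move=> k; apply: measurable_funM => //; apply: measurable_minr => //.
  - by move=> k x; rewrite mulr_ge0 ?sqr_ge0// le_min h0 ler0n.
  - move=> x k l kl; apply: ler_wpM2l; first exact: sqr_ge0.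
    by rewrite le_min ge_min lexx/= ge_min ler_nat ltnS leq_add2r kl orbT.
  - move=> x; exists (Num.truncn (h x)); apply: ler_wpM2l; first exact: sqr_ge0.
    rewrite le_min lexx/= ltW//; have /truncn_itv/andP[_ hh] := h0 x.
    by apply: lt_le_trans hh _; rewrite ler_nat ltnS leq_addr.
  move=> k; set n := (k + n0)%N.
  have n0n : (n0 <= n)%N by rewrite leq_addl.
  have [/= _ Zn2] := hn0' n n0n.
  apply: (@le_trans _ _ ((Z n)%:E * \int[nun n]_x (coord i x ^+ 2)%:E)).
    have [mhz h0z _] := nund n.
    rewrite (density_integral (nund n))//; last exact/measurable_EFinP.
    rewrite -ge0_integralZl_EFin ?(ltW (Z0 n))//; last 2 first.
    - by move=> x _; rewrite mule_ge0// lee_fin.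
    - by apply: emeasurable_funM; exact/measurable_EFinP.
    apply: ge0_le_integral => //.
    - by move=> x _; rewrite lee_fin mulr_ge0 ?sqr_ge0// le_min h0 ler0n.
    - apply/measurable_EFinP; apply: measurable_funM => //.
      by apply: measurable_minr.
    - by apply: measurable_funeM; apply: emeasurable_funM; exact/measurable_EFinP.
    - move=> x _; rewrite -!EFinM lee_fin.
      have -> : (Z n * (coord i x ^+ 2 * (hn n x / Z n)) = coord i x ^+ 2 * hn n x)%R.
        by field; rewrite gt_eqF.
      by apply: ler_wpM2l; [exact: sqr_ge0|exact: min_le_clip].
  apply: (@le_trans _ _ ((Z n)%:E * Q%:E)).
    by rewrite lee_wpmul2l ?lee_fin ?(ltW (Z0 n))// nunQ.
  by rewrite -EFinM lee_fin ler_wpM2r.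
have iomh : mu.-integrable setT (EFin \o (fun x => om x * h x)%R).
  apply/integrableP; split; first by apply/measurable_EFinP; exact: measurable_funM.
  have /integrableP[_] := omint nu nu2.
  rewrite (density_integral hd)//; last first.
    by apply: measurableT_comp => //; exact/measurable_EFinP.
  rewrite (eq_integral (fun x => `|(EFin \o (fun x => om x * h x)%R) x|))// => x _ /=.
  by rewrite -EFinM ger0_norm// [in RHS]ger0_norm// mulr_ge0.
have iG : mu.-integrable setT (EFin \o (fun x => (h x + 1) * om x)%R).
  rewrite (_ : _ \o _ = (EFin \o (fun x => om x * h x)%R) \+ (EFin \o om)).
    by apply: integrableD => //; exact: omint.
  by apply/funext => x /=; rewrite -EFinD; congr EFin; ring.
pose D n := Rintegral mu setT (fun x => `|h x - hn n x| * om x)%R.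
pose S n := Rintegral mu setT (fun x => hn n x * om x)%R.
have mdn n : measurable_fun setT (fun x => `|h x - hn n x|)%R.
  by apply: measurableT_comp => //; exact: measurable_funB.
have Dle n x : (`| `|h x - hn n x| * om x| <= (h x + 1) * om x)%R.
  rewrite normrM normr_id [`|om x|%R]ger0_norm//; apply: ler_wpM2r => //.
  rewrite ler_norml; have := hnle n x; have := hn0 n x; have := h0 x.
  by move=> *; apply/andP; split; lra.
have Sle n x : (`|hn n x * om x| <= (h x + 1) * om x)%R.
  by rewrite normrM [`|om x|%R]ger0_norm// gtr0_norm//; apply: ler_wpM2r.
have Dc : D n @[n --> \oo] --> (0 : R)%R.
  have -> : (0 = Rintegral mu setT (fun x => 0 : R))%R by rewrite Rintegral_cst// mul0r.
  apply: (Rintegral_dominated_cvg _ _ _ _ iG) => //.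
  - by move=> n; exact: measurable_funM.
  - move=> x; rewrite -[X in _ --> X](mul0r (om x)); apply: cvgMl.
    rewrite -[X in _ --> X](normr0 R) -(subrr (h x)); apply: cvg_norm.
    by apply: cvgB => //; exact: cvg_cst.
have Sc : S n @[n --> \oo] --> Rintegral mu setT (fun x => h x * om x)%R.
  apply: (Rintegral_dominated_cvg _ _ _ _ iG) => //.
  - by move=> n; exact: measurable_funM.
  - exact: measurable_funM.
  - by move=> x; apply: cvgMl; exact: hnc.
(* The weighted integral of the bound |h - hn / Z| <= |h - hn| + |1 - 1 / Z| hn. *)
pose err n := (D n + `|1 - (Z n)^-1| * S n)%R.
have errc : err n @[n --> \oo] --> (0 : R)%R.
  rewrite -[X in _ --> X](_ : 0 + `|1 - 1^-1| * Rintegral mu setT (fun x => h x * om x) = 0)%R; last first.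
    by rewrite invr1 subrr normr0 mul0r addr0.
  apply: cvgD => //; apply: cvgM => //; apply: cvg_norm; apply: cvgB; first exact: cvg_cst.
  by apply: cvgV => //; exact: oner_neq0.
(* The reference and the target are both [mu]; only [nu] gets approximated. *)
have mumu : density mu mu (fun=> 1%R).
  by split => // A mA; rewrite integral_cst// mul1e.
apply: (T2bar_stable mumu hd mu2) => e e0.
have [n [nU nerr]] : exists n, (K * U n <= K * H + e)%R /\ (err n <= e)%R.
  have e1 : \forall n \near \oo, (K * U n <= K * H + e)%R.
    have KU : (K * U n)%R @[n --> \oo] --> (K * H)%R by apply: cvgMr.
    by apply: (cvgr_le _ KU); rewrite ltrDl.
  have e2 : \forall n \near \oo, (err n <= e)%R by exact: (cvgr_le _ errc).
  have e12 : \forall n \near \oo, (K * U n <= K * H + e)%R /\ (err n <= e)%R.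
    by move: e1 e2; apply: filterS2.
  by have [n ?] := filter_ex e12; exists n.
exists mu, (nun n), (fun=> 1%R), (fun x => hn n x / Z n)%R; split => //.
- split; last first.
    rewrite big1 ?lee_fin ?ltW// => i _; rewrite integral0_eq// => x _.
    by rewrite subrr normr0 mul0r.
  have mb : measurable_fun setT (fun x => `|h x - hn n x / Z n|)%R.
    apply: measurableT_comp => //; apply: measurable_funB => //.
    by apply: measurable_funM.
  rewrite -ge0_integral_sum//; last 2 first.
  - by move=> i; apply/measurable_EFinP; exact: measurable_funM.
  - by move=> i x _; rewrite lee_fin mulr_ge0// sqr_ge0.
  have iD : mu.-integrable setT (EFin \o (fun x => `|h x - hn n x| * om x)%R).
    apply: le_integrable iG => //.
      by apply/measurable_EFinP; exact: measurable_funM.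
    by move=> x _; rewrite /= lee_fin [leRHS]ger0_norm// mulr_ge0// addr_ge0.
  have iS : mu.-integrable setT (EFin \o (fun x => hn n x * om x)%R).
    apply: le_integrable iG => //.
      by apply/measurable_EFinP; exact: measurable_funM.
    by move=> x _; rewrite /= lee_fin [leRHS]ger0_norm// mulr_ge0// addr_ge0.
  have DE : \int[mu]_x (`|h x - hn n x| * om x)%:E = (D n)%:E.
    by rewrite /D /Rintegral fineK//; exact: (integrable_fin_num measurableT iD).
  have SE : \int[mu]_x (hn n x * om x)%:E = (S n)%:E.
    by rewrite /S /Rintegral fineK//; exact: (integrable_fin_num measurableT iS).
  apply: (@le_trans _ _ (err n)%:E); last by rewrite lee_fin.
  rewrite /err EFinD EFinM -DE -SE.
  rewrite -ge0_integralZl_EFin//; last 2 first.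
  - by move=> x _; rewrite lee_fin mulr_ge0// ltW.
  - by apply/measurable_EFinP; exact: measurable_funM.
  rewrite -ge0_integralD//; last 4 first.
  - by move=> x _; rewrite lee_fin mulr_ge0.
  - by apply/measurable_EFinP; exact: measurable_funM.
  - by move=> x _; rewrite mule_ge0 ?lee_fin// mulr_ge0// ltW.
  - by apply: measurable_funeM; apply/measurable_EFinP; exact: measurable_funM.
  apply: le_integral_measurable.
  - apply: emeasurable_sum => i.
    by apply/measurable_EFinP; exact: measurable_funM.
  - apply: emeasurable_funD; first by apply/measurable_EFinP; exact: measurable_funM.
    by apply: measurable_funeM; apply/measurable_EFinP; exact: measurable_funM.
  - move=> x; rewrite sumEFin -EFinM -EFinD lee_fin -mulr_sumr -/(om x) mulrA -mulrDl.
    apply: ler_wpM2r => //.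
    have -> : (h x - hn n x / Z n = (h x - hn n x) + (1 - (Z n)^-1) * hn n x)%R by ring.
    apply: le_trans (ler_normD _ _) _; rewrite lerD2l normrM.
    by rewrite [`|hn n x|%R]gtr0_norm.
- by apply: (le_trans (TU n)); rewrite lee_fin.
Qed.

End from_bounded_tilts.

(** * The numerical constant and the theorem *)

(** For M >= 14 the coefficient (2 + M) / 4 is at least 4. Below, (14 - M) ln (1 + M) <= 24 is
    needed. The tangent of ln at e^2, with e^2 >= 4, gives ln (1 + M) <= 1 + (1 + M) / 4, and 24 -
    (14 - M)(5 + M) / 4 is a positive quadratic centered at 9/2. *)
Lemma ln_factor_le (R : realType) (M : R) : (0 <= M)%R ->
  (2 + 4 * ln (1 + M) <= 8 + 4^-1 * (2 + M) * ln (1 + M))%R.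
Proof.
move=> M0; have y0 : (0 < 1 + M)%R by rewrite ltr_wpDr.
have L0 : (0 <= ln (1 + M))%R by apply: ln_ge0; rewrite lerDl.
have [M14|M14] := leP 14%R M; first by nra.
have e2 : (2 <= expR 1 :> R)%R by apply: le_trans (expR_ge1Dx _); lra.
have lnle : (ln (1 + M) <= 1 + (1 + M) / 4)%R.
  have q0 : (0 < (1 + M) / (expR 1 ^+ 2))%R.
    by rewrite divr_gt0// exprn_gt0// expR_gt0.
  have := le_ln1Dx (x := ((1 + M) / (expR 1 ^+ 2) - 1)%R).
  rewrite ltrBrDr addNr => /(_ q0); rewrite subrKC ln_div ?posrE ?exprn_gt0 ?expR_gt0//.
  rewrite lnXn ?expR_gt0// expRK => h.
  have : ((1 + M) / expR 1 ^+ 2 <= (1 + M) / 4)%R.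
    rewrite ler_pM2l// lef_pV2 ?posrE ?exprn_gt0 ?expR_gt0//.
    by nra.
  lra.
have M14' : (0 <= 14 - M)%R by rewrite subr_ge0 ltW.
by have := ler_wpM2l M14' lnle; have := sqr_ge0 (M - 9 / 2); lra.
Qed.

Section optimal_constant.
Context {R : realType} {d : nat}.
Local Notation E := (Rd R d).
Implicit Types mu nu : probability E R.

Lemma C_T2minus_ge0 mu : 0 <= C_T2minus mu.
Proof. by apply: le_ereal_inf_tmp => _ [C [C0 _ _] <-]; rewrite lee_fin ltW. Qed.

(** Nonnegativity of the entropy makes the set of admissible constants upward closed. The infimum
    can be 0, which is not admissible. *)
Lemma T2minus_with_gt mu (C : R) : C_T2minus mu < C%:E -> T2minus_with mu C.
Proof.
move=> /ereal_inf_lt[_ [C' [C'0 mu1 muC'] <-]]; rewrite lte_fin => C'C.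
split => //; first exact: lt_trans C'C.
move=> nu nu1; apply: (le_trans (muC' _ nu1)).
by apply: lee_wpmul2r; rewrite ?lee_fin ?(ltW C'C)// relative_entropy_ge0.
Qed.

Lemma chi2_ge0 mu nu : 0 <= chi2 mu nu.
Proof.
rewrite /chi2; case: ifPn => // _; apply: integral_ge0 => x _; exact: sqre_ge0.
Qed.

Lemma finite_second_moment_P1 mu : finite_second_moment mu -> P1 mu.
Proof.
move=> mu2.
have mX i : measurable_fun [set: E] (fun x => (coord i x ^+ 2)%:E) := measurable_sqcoord i.
have X0 i (x : E) : 0 <= (coord i x ^+ 2)%:E by rewrite lee_fin sqr_ge0.
apply: (@le_lt_trans _ _ (\int[mu]_x (1 + \sum_(i < d) (coord i x ^+ 2)%:E))).
  apply: ge0_le_integral => //.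
  - by move=> x _; rewrite lee_fin sqrtr_ge0.
  - by apply/measurable_EFinP; exact: measurable_enorm.
  - by apply: emeasurable_funD => //; exact: emeasurable_sum.
  - move=> x _; rewrite sumEFin -EFinD lee_fin.
    set s := (\sum_(i < d) _)%R.
    have s0 : (0 <= s)%R by apply: sumr_ge0 => i _; exact: sqr_ge0.
    have := sqr_sqrtr s0; rewrite -/(enorm x) => <-.
    by have := sqr_ge0 (enorm x - 1); have := sqr_ge0 (enorm x); lra.
rewrite ge0_integralD//; last 2 first.
- by move=> x _; exact: sume_ge0.
- exact: emeasurable_sum.
rewrite integral_cst// mul1e ge0_integral_sum//.
apply: lte_add_pinfty.
  by rewrite (le_lt_trans (probability_le1 _ _))// ltry.
by apply: lte_sum_pinfty => i _; exact: mu2.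
Qed.

End optimal_constant.

Theorem corollary4p6 (R : realType) (d : nat)
    (disp : measure_display) (Theta : measurableType disp)
    (m : probability Theta R) (mu : Theta -> probability (Rd R d) R)
    (mmu : forall A, measurable A ->
       measurable_fun [set: Theta] (fun theta => mu theta A)) :
  let C_Theta := ereal_sup [set C_T2minus (mu theta) | theta in [set: Theta]] in
  let M_Theta := ereal_sup [set chi2 (mu theta) (mu theta') |
                   theta in [set: Theta] & theta' in [set: Theta]] in
  let mu_mix : probability (Rd R d) R := mixture m mmu in
  C_Theta < +oo ->
  M_Theta < +oo ->
  T2minus mu_mix /\
  C_T2minus mu_mix <=
    C_Theta * (8%:E + 4^-1%:E * (2%:E + M_Theta) * lne (1 + M_Theta)).
Proof.
move=> C_Theta M_Theta mu_mix.
have Cub theta : C_T2minus (mu theta) <= C_Theta by apply: ereal_sup_ubound; exists theta.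
have Mub theta theta' : chi2 (mu theta) (mu theta') <= M_Theta.
  by apply: ereal_sup_ubound; exists theta => //; exists theta'.
(* [Theta] has a point, so both suprema dominate a nonnegative value; being finite, they are real
   numbers. *)
have C0 : 0 <= C_Theta := le_trans (C_T2minus_ge0 _) (Cub point).
have M0 : 0 <= M_Theta := le_trans (chi2_ge0 _ _) (Mub point point).
move: C_Theta M_Theta C0 M0 Cub Mub => [c| |] [M| |]// c0 M0 Cub Mub _ _.
rewrite lee_fin in c0; rewrite lee_fin in M0.
pose K := (8 + 4^-1 * (2 + M) * ln (1 + M))%R.
have KE : 8%:E + 4^-1%:E * (2%:E + M%:E) * lne (1 + M%:E) = K%:E.
  by rewrite -EFinD lne_EFin ?ltr_wpDr// -EFinD -!EFinM -EFinD.
have L0 : (0 <= ln (1 + M))%R by apply: ln_ge0; rewrite lerDl.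
have K0 : (0 < K)%R by have := ln_factor_le M0; rewrite -/K; lra.
(* Every [C] above [c] is used because [c] may be 0; the bound with [c] itself is recovered in the
   infimum. *)
have main C : (c < C)%R -> T2minus_with mu_mix (C * K).
  move=> cC; have C0 : (0 < C)%R := le_lt_trans c0 cC.
  have muT theta : T2minus_with (mu theta) C.
    by apply: T2minus_with_gt; apply: le_lt_trans (Cub theta) _; rewrite lte_fin.
  have mix2 : finite_second_moment mu_mix := mixture_second_moment m mmu muT Mub.
  split; [exact: mulr_gt0|exact: finite_second_moment_P1|move=> nu _].
  apply: (@le_trans _ _ ((C * (2 + 4 * ln (1 + M)))%:E * relative_entropy nu mu_mix)).
    apply: T2bar_of_bounded_tilts => //; first by rewrite mulr_gt0//; lra.
    by move=> h nu' hb hd; exact: mixture_tilt.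
  apply: lee_wpmul2r; first exact: relative_entropy_ge0.
  by rewrite lee_fin ler_pM2l//; exact: ln_factor_le.
split; first by exists ((c + 1) * K)%R; apply: main; rewrite ltrDl.
rewrite KE; apply/lee_addgt0Pr => e e0.
rewrite -EFinM -EFinD (_ : c * K + e = (c + e / K) * K)%R.
  by apply: ereal_inf_lbound; exists ((c + e / K) * K)%R => //; apply: main; rewrite ltrDl divr_gt0.
by rewrite mulrDl divfK ?gt_eqF.
Qed.
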